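(* With the notation and assumptions of the context, let $n\in\mathbb{Z}_{>0}$, $i\in\{1,\ldots,g\}$, $\pi\in T_{n,i}$, and $h(T):=h(T^{\mu_i};\pi)$. Then $[h(T)]\in\Gamma_A[p^n]_{\mu_i}$. Consequently, there is an injective map $$T_{n,i}\to\Gamma_A[p^n]_{\mu_i},\qquad\pi\mapsto[h(T^{\mu_i};\pi)].$$
   Context: $p$ is a prime, $K$ a finite extension of $\mathbb{Q}_p$, $|\cdot|$ its absolute value with $|p|=1/p$, $O_K=\{|a|\le1\}$, $\mathcal{M}_K=\{|a|<1\}$. $K((\frac1T))$ is the field of series $\sum_{i\le n}v_iT^i$; the degree is the largest exponent with nonzero coefficient. $A\subset K((\frac1T))$ is a $K$-subalgebra with $A\cap K[[\frac1T]]=K$ and $g:=\dim_KK((\frac1T))/(A+K[[\frac1T]])<\infty$. Put $\underline{M}(A)=\{\deg v : 0\ne v\in A\}=\{s_1<s_2<\cdots\}\subset\mathbb{Z}_{\ge0}$ and $\mathbb{Z}_{\ge0}\setminus\underline{M}(A)=\{\mu_1<\cdots<\mu_g\}$. The standard basis of $A$ is the unique basis $v_i=\sum_jv_{ij}T^j$ with $v_i$ monic of degree $s_i$ and $v_{i,s_j}=0$ for $i>j\ge1$; $A$ is assumed strictly integral, i.e. all $v_{ij}\in O_K$. $d$ is an integer with $p\equiv1\bmod d$ and $d\ge\mu_g$, $\zeta_d\in\mathbb{Z}_p$ is a primitive $d$-th root of unity, and the automorphism $\delta:\sum a_nT^n\mapsto\sum a_n(\zeta_dT)^n$ of $K((\frac1T))$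 is assumed to restrict to an automorphism of $A$. Let $O(A)$ be the set of elements of $A$ with coefficients in $O_K$; one has $O_K[[\frac1T]][T]=O(A)\oplus\frac1TO_K[[\frac1T]]\oplus\bigoplus_iO_KT^{\mu_i}$, and $\mathbf{e}^{(k)}=(e^{(k)}_{ij})\in M_g(O_K)$ is defined by $T^{\mu_jp^k}-\sum_ie^{(k)}_{ij}T^{\mu_i}\in O(A)\oplus\frac1TO_K[[\frac1T]]$; under the present assumptions it is diagonal. Put $l_i(X):=\sum_{k\ge0}\frac{e^{(k)}_{ii}}{p^k}X^{p^k}$ and $T_{n,i}:=\{\pi\in\mathcal{M}_K : l_i(\pi)=0,\ |\pi|\le|p|^{1/(p^n-p^{n-1})}\}$. $H:=\{\sum_{i\in\mathbb{Z}}a_iT^i : a_i\in K,\ \sup|a_i|<\infty,\ \lim_{i\to+\infty}|a_i|=0\}$, a field complete for $\|\sum a_iT^i\|=\sup|a_i|$; $A^{\mathrm{an}}$ is the closure of $A$ in $H$. For $0\le\rho<1$, $\Gamma_\rho:=\{h=\sum h_iT^i\in H^* : \|h\|=|h_0|=1,\ |h_i|\le\rho^i\ \forall i>0\}$, $\Gamma:=\bigcup_{0\le\rho<1}\Gamma_\rho$, $\Gamma_A:=\Gamma/\big(((A^{\mathrm{an}})^*\cap\Gamma)\Gamma_0\big)$; $[h]$ is the class of $h$. The map $\sum a_nT^n\mapsto\sum a_n(\zeta_dT)^n$ on $H$ induces an automorphism $\delta$ of $\Gamma_A$. $\Gamma_A[p^n]$ is the subgroup of elements killed by $p^n$ (a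 $\mathbb{Z}_p$-module), and $\Gamma_A[p^n]_\mu$ is the set of $\alpha\in\Gamma_A[p^n]$ with $\delta\alpha=\zeta_d^\mu\alpha$ (module notation; multiplicatively $\delta(\alpha)=\alpha^{\zeta_d^\mu}$). With $l(T):=\sum_{k\ge0}p^{-k}T^{p^k}$, $h(T;\pi):=\exp(l(\pi T))$, so $h(T^{\mu_i};\pi)=\exp(l(\pi T^{\mu_i}))$. *)

(* Defs.v *)
From HB Require Import structures.
From mathcomp Require Import all_boot all_order all_algebra all_field.
From mathcomp Require Import all_classical all_reals all_analysis.

Set Implicit Arguments.
Unset Strict Implicit.
Unset Printing Implicit Defensive.

Import Order.TTheory GRing.Theory Num.Theory.
Import numFieldNormedType.Exports.

Local Open Scope classical_set_scope.
Local Open Scope ring_scope.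

Section AbsoluteValue.
Variables (R : realType) (F : fieldType) (abs : F -> R).

Definition nonarch_absval : Prop :=
  [/\ forall x, 0 <= abs x,
      forall x, abs x = 0 <-> x = 0,
      forall x y, abs (x * y) = abs x * abs y &
      forall x y, abs (x + y) <= Num.max (abs x) (abs y)].

Definition tends_to (u : nat -> F) (l : F) : Prop :=
  abs (u n - l) @[n --> \oo] --> (0 : R).

Definition seq_limit (u : nat -> F) : F := xget 0 [set l | tends_to u l].

Definition cauchy_seq (u : nat -> F) : Prop :=
  forall eps : R, 0 < eps -> exists N : nat, forall m n : nat,
    (N <= m)%N -> (N <= n)%N -> abs (u m - u n) < eps.

(* (F, abs) is the completion of the rationals for the p-adic absolute value;
   it is thereby determined up to a unique isometric isomorphism.  That abs is
   ultrametric with |p| = 1/p forces F to have characteristic 0 and abs to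
   restrict to the p-adic absolute value on the rationals. *)
Definition is_Qp (p : nat) : Prop :=
  [/\ nonarch_absval,
      abs p%:R = p%:R^-1,
      forall u, cauchy_seq u -> exists l, tends_to u l &
      forall (x : F) (eps : R), 0 < eps ->
        exists q : rat, abs (x - ratr q) < eps].

Definition integers : set F := [set x | abs x <= 1].
Definition maximal_ideal : set F := [set x | abs x < 1].

End AbsoluteValue.

(* A bilateral series \sum_(i in Z) a_i T^i is the function i |-> a_i.  Both
   K((1/T)) and H are sets of such functions. *)
Section Series.
Variables (R : realType) (K : fieldType) (abs : K -> R).

Definition biseries := int -> K.

Definition monomial (m : int) : biseries := fun j => (j == m)%:R.

Definition const_series (c : K) : biseries := fun j => c * (j == 0)%:R.

(* (a b)_n = \sum_(i in Z) a_i b_(n-i).  For a, b in K((1/T)) only finitely many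
   terms are nonzero; for a, b in H the sum converges in K. *)
Definition smul (a b : biseries) : biseries := fun n =>
  seq_limit abs (fun N => \sum_(i < N)
    (a (Posz i) * b (n - Posz i) + a (Negz i) * b (n - Negz i))).

(* K((1/T)) *)
Definition laurent : set biseries :=
  [set a | exists n : int, forall j, n < j -> a j = 0].

(* K[[1/T]] *)
Definition powser_inv : set biseries := [set a | forall j, 0 < j -> a j = 0].

Definition has_degree (a : biseries) (m : int) : Prop :=
  a m != 0 /\ forall j, m < j -> a j = 0.

Definition sum_set (U V : set biseries) : set biseries :=
  [set f | exists a b, [/\ U a, V b & f = a + b]].

Definition subalgebra (A : set biseries) : Prop :=
  [/\ A `<=` laurent,
      A (monomial 0),
      forall a b, A a -> A b -> A (a + b),
      forall (c : K) a, A a -> A (fun j => c * a j) &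
      forall a b, A a -> A b -> A (smul a b)].

(* dim_K V/W = g : there is a family of g elements of V whose classes form a
   basis of V/W. *)
Definition quotient_dim (V W : set biseries) (g : nat) : Prop :=
  exists b : 'I_g -> biseries,
    [/\ forall i, V (b i),
        forall f, V f -> exists c : 'I_g -> K,
          W (fun j => f j - \sum_(i < g) c i * b i j) &
        forall c : 'I_g -> K,
          W (fun j => \sum_(i < g) c i * b i j) -> forall i, c i = 0].

(* \underline{M}(A) *)
Definition degrees (A : set biseries) : set int :=
  [set m | exists2 v, A v & has_degree v m].

Definition is_basis (A : set biseries) (v : nat -> biseries) : Prop :=
  (forall a, A a <-> exists (N : nat) (c : nat -> K),
     a = fun j => \sum_(i < N) c i * v i j) /\
  (forall (N : nat) (c : nat -> K),
     (forall j, \sum_(i < N) c i * v i j = 0) ->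
     forall i, (i < N)%N -> c i = 0).

(* Indices start from 0: s m and v m stand for s_(m+1) and v_(m+1). *)
Definition standard_basis (A : set biseries) (s : nat -> nat)
    (v : nat -> biseries) : Prop :=
  [/\ is_basis A v,
      forall m, has_degree (v m) (s m)%:Z,
      forall m, v m (s m)%:Z = 1 &
      forall m k, (k < m)%N -> v m (s k)%:Z = 0].

(* O(A) *)
Definition integral_part (A : set biseries) : set biseries :=
  [set a | A a /\ forall j, integers abs (a j)].

(* (1/T) O_K[[1/T]] *)
Definition integral_tail : set biseries :=
  [set a | (forall j, 0 <= j -> a j = 0) /\ (forall j, integers abs (a j))].

Definition frobenius_matrix (p : nat) (A : set biseries) (g : nat)
    (mu : 'I_g -> nat) (k : nat) (e : 'M[K]_g) : Prop :=
  (forall i j, integers abs (e i j)) /\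
  (forall j, sum_set (integral_part A) integral_tail
    (fun m => monomial (mu j * p ^ k)%N%:Z m -
              \sum_(i < g) e i j * monomial (mu i)%:Z m)).

(* \sum_n a_n T^n |-> \sum_n a_n (z T)^n *)
Definition twist (z : K) (a : biseries) : biseries := fun n => a n * z ^ n.

Definition Hset : set biseries :=
  [set a | has_ubound (range (fun i => abs (a i))) /\
           abs (a n%:Z) @[n --> \oo] --> (0 : R)].

Definition gauss_norm (a : biseries) : R := sup (range (fun i => abs (a i))).

(* The closure of A in H *)
Definition Aan (A : set biseries) : set biseries :=
  [set h | Hset h /\
     forall eps : R, 0 < eps -> exists2 a, A a & gauss_norm (h - a) < eps].

Definition unit_group (B : set biseries) : set biseries :=
  [set a | B a /\ exists2 b, B b & smul a b = monomial 0].

Definition Gamma_rho (rho : R) : set biseries :=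
  [set h | [/\ unit_group Hset h,
               gauss_norm h = abs (h 0), abs (h 0) = 1 &
               forall i : nat, (0 < i)%N -> abs (h i%:Z) <= rho ^+ i]].

Definition Gamma : set biseries :=
  [set h | exists rho : R, [/\ 0 <= rho, rho < 1 & Gamma_rho rho h]].

Definition set_mul (U V : set biseries) : set biseries :=
  [set f | exists a b, [/\ U a, V b & f = smul a b]].

(* ((A^an)^* \cap Gamma) Gamma_0 *)
Definition Gamma_ker (A : set biseries) : set biseries :=
  set_mul (unit_group (Aan A) `&` Gamma) (Gamma_rho 0).

(* Elements of Gamma_A are cosets of Gamma_ker A, with the product of subsets as
   group law and Gamma_ker A itself as neutral element. *)
Definition coset_class (A : set biseries) (h : biseries) : set biseries :=
  [set f | exists2 u, Gamma_ker A u & f = smul h u].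

Definition Gamma_quot (A : set biseries) : set (set biseries) :=
  [set coset_class A h | h in Gamma].

Definition coset_pow (A : set biseries) (alpha : set biseries) (m : nat) :
  set biseries := iter m (set_mul alpha) (Gamma_ker A).

Definition Gamma_torsion (A : set biseries) (m : nat) : set (set biseries) :=
  [set alpha | Gamma_quot A alpha /\ coset_pow A alpha m = Gamma_ker A].

(* l(T) = \sum_k p^-k T^(p^k), as the sequence of its coefficients *)
Definition l_coef (p : nat) : nat -> K :=
  fun n => \sum_(k < n.+1 | (p ^ k)%N == n) (p%:R : K) ^- k.

(* Coefficient of T^n in \sum_m f^m / m!, for a power series f with f 0 = 0:
   only the terms m <= n and the coefficients of f up to T^n contribute. *)
Definition exp_coef (f : nat -> K) : nat -> K :=
  fun n => (\sum_(m < n.+1)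
    (m`!%:R^-1 : K) *: (\poly_(i < n.+1) f i) ^+ m)`_n.

(* Coefficients of h(T; pi) = exp (l (pi T)) *)
Definition h_coef (p : nat) (pi : K) : nat -> K :=
  exp_coef (fun n => l_coef p n * pi ^+ n).

(* h(T^mu; pi) *)
Definition h_series (p mu : nat) (pi : K) : biseries := fun j =>
  match j with
  | Posz n => if (mu %| n)%N then h_coef p pi (n %/ mu)%N else 0
  | Negz _ => 0
  end.

(* T_(n,i) *)
Definition T_set (p g : nat) (e : nat -> 'M[K]_g) (n : nat) (i : 'I_g) :
  set K :=
  [set pi | [/\ maximal_ideal abs pi,
                tends_to abs (fun N => \sum_(k < N)
                  e k i i / p%:R ^+ k * pi ^+ (p ^ k)) 0 &
                abs pi <= abs p%:R `^ ((p ^ n - p ^ n.-1)%N%:R^-1)]].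

End Series.

Section Eigenspace.
Variables (R : realType) (Qp : fieldType) (absp : Qp -> R).
Variables (K : fieldExtType Qp) (abs : K -> R).

(* For c in Z_p, a natural number congruent to c modulo p^n Z_p *)
Definition Zp_residue (p n : nat) (c : Qp) : nat :=
  xget 0%N [set m : nat | absp (m%:R - c) <= p%:R ^- n].

(* The action of c in Z_p on the p^n-torsion element alpha: Z_p acts through
   Z_p / p^n Z_p = Z / p^n Z. *)
Definition Zp_act (p n : nat) (A : set (biseries K)) (c : Qp)
    (alpha : set (biseries K)) : set (biseries K) :=
  coset_pow abs A alpha (Zp_residue p n c).

(* Gamma_A[p^n]_mu; delta acts on a coset by taking its image. *)
Definition Gamma_eigen (p n : nat) (zeta : Qp) (A : set (biseries K))
    (mu : nat) : set (set (biseries K)) :=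
  [set alpha | Gamma_torsion abs A (p ^ n) alpha /\
     twist (zeta%:A : K) @` alpha = Zp_act p n A (zeta ^+ mu) alpha].

End Eigenspace.

(* Main.v *)
Require Import Defs.
From HB Require Import structures.
From mathcomp Require Import all_boot all_order all_algebra all_field.
From mathcomp Require Import all_classical all_reals all_analysis.
From mathcomp Require Import zify ring lra.
Set Implicit Arguments.
Unset Strict Implicit.
Unset Printing Implicit Defensive.
Import Order.TTheory GRing.Theory Num.Theory.
Import numFieldNormedType.Exports.
Local Open Scope classical_set_scope.
Local Open Scope ring_scope.

(* For z in Z_p put h_z := exp (z l(pi T^mu)), mu := mu_i.  By the integrality of
   the Artin-Hasse exponential (Dwork) and continuity in z, the coefficient of
   T^(mu q) in h_z is bounded by |pi|^q, so z |-> h_z is a homomorphism from Z_p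
   to Gamma.  Since zeta^p = zeta, the automorphism delta maps h = h_1 to
   h_(zeta^mu) and forces the matrices e^(k) to be diagonal.

   Writing T^(mu p^k) = e_k T^mu + a_k + t_k with a_k in O(A) and t_k in the
   tail, the equation l_i(pi) = 0 yields p^n l(pi T^mu) = a + t, where a lies in
   A^an, t has only negative exponents, and the bound on |pi| makes both small
   enough for exp to converge in H.  Hence h_(p^n z) = exp(za) exp(zt) lies in
   the kernel for all z in Z_p; z = 1 gives the torsion statement, and
   z = (zeta^mu - m)/p^n the eigenspace statement.

   Injectivity only needs |pi|, |pi'| < 1: in a factorisation of h(pi)/h(pi') in
   the kernel, the coefficient pi - pi' of T^mu would have to be cancelled by
   terms that are strictly smaller, because mu is not a degree of A. *)

(** * Ultrametric fields and sums over Z *)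

(** The exponent has to run through Z_p and not only through the integers: delta h differs from the
    power h^m by the factor h_(p^n w) with w = (zeta^mu - m)/p^n, a p-adic integer that is in
    general not an integer. The obstacle is that l(pi T^mu) can lie outside the disc where exp
    converges. Therefore h_z is built from formal exponentials of power series, and its bounds come
    from integrality, not from convergence. Only after multiplication by p^n do the coefficients
    p^(n-k) pi^(p^k) drop to |p| r or below, where r = p^(-1/(p-1)) is the radius of convergence of
    exp. There the formal exponential agrees with a convergent one in H, where exp(a + t) can be
    split into factors that may involve negative powers of T. The constant in T_(n,i) is what the
    term k = n - 1 requires, namely |pi|^(p^(n-1)) <= r. *)

Section ValuedField.
Context {R : realType} {F : fieldType} {abs : F -> R}.
Hypothesis abs_na : nonarch_absval abs.

Lemma vabs_ge0 x : 0 <= abs x.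
Proof. by case: abs_na. Qed.

Lemma vabs_eq0 x : (abs x == 0) = (x == 0).
Proof. by case: abs_na => _ h _ _; apply/eqP/eqP; case: (h x). Qed.

Lemma vabs0 : abs 0 = 0.
Proof. by apply/eqP; rewrite vabs_eq0. Qed.

Lemma vabsM x y : abs (x * y) = abs x * abs y.
Proof. by case: abs_na. Qed.

Lemma vabs_gt0 x : (0 < abs x) = (x != 0).
Proof. by rewrite lt_neqAle eq_sym vabs_eq0 vabs_ge0 andbT. Qed.

Lemma vabsD_le x y C : abs x <= C -> abs y <= C -> abs (x + y) <= C.
Proof.
case: abs_na => _ _ _ h hx hy; apply: (le_trans (h x y)).
by rewrite ge_max hx hy.
Qed.

Lemma vabs1 : abs 1 = 1.
Proof.
have nz : abs 1 != 0 by rewrite vabs_eq0 oner_eq0.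
by apply: (mulfI nz); rewrite -vabsM !mulr1.
Qed.

Lemma vabsN x : abs (- x) = abs x.
Proof.
suff h : abs (- 1) = 1 by rewrite -mulN1r vabsM h mul1r.
apply/eqP; rewrite -(@eqrXn2 _ 2) ?vabs_ge0 //.
by rewrite expr2 -vabsM mulrNN mulr1 vabs1 expr1n.
Qed.

Lemma vabsB_le x y C : abs x <= C -> abs y <= C -> abs (x - y) <= C.
Proof. by move=> hx hy; apply: vabsD_le; rewrite ?vabsN. Qed.

Lemma vabs_subC x y : abs (x - y) = abs (y - x).
Proof. by rewrite -vabsN opprB. Qed.

Lemma vabsX x m : abs (x ^+ m) = abs x ^+ m.
Proof. by elim: m => [|m IH]; rewrite ?expr0 ?vabs1 // !exprS vabsM IH. Qed.

Lemma vabsV x : abs x^-1 = (abs x)^-1.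
Proof.
have [->|nz] := eqVneq x 0; first by rewrite invr0 vabs0 invr0.
apply: (mulfI (x := abs x)); first by rewrite vabs_eq0.
by rewrite -vabsM !mulfV ?vabs1 ?vabs_eq0.
Qed.

Lemma vabs_expz x (m : int) : abs x = 1 -> abs (x ^ m) = 1.
Proof.
by move=> h; case: m => m; rewrite ?NegzE -?exprnP -?exprnN ?vabsV vabsX h
  expr1n ?invr1.
Qed.

Lemma vabs_sum_le (I : Type) (r : seq I) (P : pred I) (f : I -> F) C :
  0 <= C -> (forall i, P i -> abs (f i) <= C) ->
  abs (\sum_(i <- r | P i) f i) <= C.
Proof.
move=> C0 h; elim/big_rec: _ => [|i x Pi hx]; first by rewrite vabs0.
by apply: vabsD_le => //; apply: h.
Qed.

Lemma vabs_nat_le1 m : abs m%:R <= 1.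
Proof.
elim: m => [|m IH]; first by rewrite vabs0 ler01.
by rewrite -natr1; apply: vabsD_le; rewrite ?vabs1.
Qed.

Lemma vabsD_eq x y : abs y < abs x -> abs (x + y) = abs x.
Proof.
move=> lt; apply/eqP; rewrite eq_le; apply/andP; split.
  by apply: vabsD_le => //; apply: ltW.
rewrite leNgt; apply/negP => lt2.
have : abs x <= Num.max (abs (x + y)) (abs y).
  rewrite -{1}[x](addrK y).
  by apply: vabsD_le; rewrite ?vabsN le_max lexx ?orbT.
by rewrite le_max leNgt lt2 /= leNgt lt.
Qed.

Lemma eq_of_vabs_le x y : (forall eps, 0 < eps -> abs (x - y) <= eps) -> x = y.
Proof.
move=> h; apply/eqP; rewrite -subr_eq0 -vabs_eq0 eq_le vabs_ge0 andbT.
by apply/ler_addgt0Pr => eps e0; rewrite add0r h.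
Qed.

Lemma tends_toP (u : nat -> F) l : tends_to abs u l <->
  forall eps, 0 < eps ->
    exists N : nat, forall m, (N <= m)%N -> abs (u m - l) <= eps.
Proof.
split=> [/cvgr0Pnorm_le h eps e0|h].
  have [N _ hN] := h eps e0.
  exists N => m Nm; have := hN m Nm.
  by rewrite /= ger0_norm ?vabs_ge0.
apply/cvgr0Pnorm_le => eps e0; have [N hN] := h eps e0.
by exists N => // m /= Nm; rewrite ger0_norm ?vabs_ge0 // hN.
Qed.

Lemma tends_to_unique (u : nat -> F) l l' :
  tends_to abs u l -> tends_to abs u l' -> l = l'.
Proof.
move=> /tends_toP h /tends_toP h'; apply: eq_of_vabs_le => eps e0.
have [N hN] := h _ e0; have [N' hN'] := h' _ e0.
rewrite -[l](subrK (u (maxn N N'))) -addrA; apply: vabsD_le.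
  by rewrite vabs_subC hN // leq_maxl.
by rewrite hN' // leq_maxr.
Qed.

Lemma seq_limitE (u : nat -> F) l : tends_to abs u l -> seq_limit abs u = l.
Proof.
move=> h; rewrite /seq_limit; apply: xget_unique => // l' h'.
exact: tends_to_unique h' h.
Qed.

End ValuedField.

Definition complete_field {R : realType} {F : fieldType} (abs : F -> R) : Prop :=
  forall u, cauchy_seq abs u -> exists l, tends_to abs u l.

Section SumOverZ.
Context {R : realType} {K : fieldType} {abs : K -> R}.
Hypothesis abs_na : nonarch_absval abs.
Hypothesis abs_cp : complete_field abs.
Implicit Types f g : int -> K.

(** Convergence to 0 along the cofinite sets of indices: the form of summability over Z that does
    not depend on an order of summation. *)
Definition vanishing f := forall eps : R, 0 < eps ->
  exists s : seq int, forall i, i \notin s -> abs (f i) <= eps.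

(** These are the partial sums of [smul], so that [smulE] below holds by conversion. *)
Definition zsum f : K :=
  seq_limit abs (fun N => \sum_(i < N) (f (Posz i) + f (Negz i))).

(** The interval from -N to N - 1, as [Negz i] is -(i + 1); it indexes the N-th partial sum of
    [zsum]. *)
Definition zbox N : seq int :=
  [seq Posz i | i <- iota 0 N] ++ [seq Negz i | i <- iota 0 N].

Lemma mem_zbox N (i : int) :
  (i \in zbox N) = match i with Posz m => (m < N)%N | Negz m => (m < N)%N end.
Proof.
rewrite mem_cat; case: i => m.
  rewrite mem_map ?mem_iota ?add0n; last by move=> x y [].
  by case: (m < N)%N => //=; apply/negP => /mapP [].
rewrite orbC mem_map ?mem_iota ?add0n; last by move=> x y [].
by case: (m < N)%N => //=; apply/negP => /mapP [].
Qed.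

Lemma zbox_uniq N : uniq (zbox N).
Proof.
rewrite cat_uniq !map_inj_uniq ?iota_uniq ?andbT //=; try by move=> x y [].
by apply/hasPn => x /mapP [m _ ->]; apply/negP => /mapP [].
Qed.

Lemma big_zbox N f :
  \sum_(i <- zbox N) f i = \sum_(i < N) (f (Posz i) + f (Negz i)).
Proof.
rewrite big_cat !big_map big_split /=.
by have -> : iota 0 N = index_iota 0 N; rewrite ?big_mkord // /index_iota subn0.
Qed.

Lemma sub_zbox (s : seq int) :
  exists N, forall M, (N <= M)%N -> {subset s <= zbox M}.
Proof.
elim: s => [|x s [N hN]]; first by exists 0%N.
exists (maxn N `|x|.+1) => M; rewrite geq_max => /andP [NM xM] y.
rewrite in_cons => /orP [/eqP ->|/(hN M NM) //].
rewrite mem_zbox; case: x xM => m /=; lia.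
Qed.

Lemma big_seq_sub_le f (s t : seq int) eps : 0 <= eps -> uniq s -> uniq t ->
  {subset s <= t} -> (forall i, i \notin s -> abs (f i) <= eps) ->
  abs (\sum_(i <- t) f i - \sum_(i <- s) f i) <= eps.
Proof.
move=> e0 us ut st h; rewrite (bigID [in s]) /=.
rewrite -big_filter (perm_big s) /=; last first.
  apply: uniq_perm; rewrite ?filter_uniq // => i; rewrite mem_filter.
  by case: (boolP (i \in s)) => //= /st ->.
by rewrite addrAC subrr add0r; apply: vabs_sum_le.
Qed.

(* Every property of [zsum] below is read off from this approximation. *)
Lemma zsum_approx f (s : seq int) eps : vanishing f -> 0 <= eps -> uniq s ->
  (forall i, i \notin s -> abs (f i) <= eps) ->
  abs (zsum f - \sum_(i <- s) f i) <= eps.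
Proof.
move=> vf e0 us hs.
pose u N := \sum_(i < N) (f (Posz i) + f (Negz i)).
have [|l hl] := abs_cp (u := u).
  move=> e e_gt0; have e2 : 0 < e / 2 by rewrite divr_gt0.
  have [t ht] := vf _ e2; have [N hN] := sub_zbox (undup t).
  exists N => m n Nm Nn; apply: (@le_lt_trans _ _ (e / 2)); last by lra.
  rewrite /u -!big_zbox.
  rewrite -[X in abs X](subrKA (\sum_(i <- undup t) f i)).
  apply: vabsD_le => //; last rewrite vabs_subC //.
    by apply: big_seq_sub_le; rewrite ?(ltW e2) ?undup_uniq ?zbox_uniq //;
      [exact: hN | move=> i; rewrite mem_undup; exact: ht].
  by apply: big_seq_sub_le; rewrite ?(ltW e2) ?undup_uniq ?zbox_uniq //;
      [exact: hN | move=> i; rewrite mem_undup; exact: ht].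
rewrite /zsum (seq_limitE abs_na hl).
apply/ler_addgt0Pr => e e_gt0.
have [N1 h1] := (tends_toP abs_na u l).1 hl e e_gt0.
have [N2 h2] := sub_zbox s.
set M := maxn N1 N2.
rewrite -[X in abs X](subrKA (u M)); apply: vabsD_le => //.
  by rewrite vabs_subC // (le_trans (h1 _ (leq_maxl _ _))) // lerDr.
rewrite /u -big_zbox (@le_trans _ _ eps) ?lerDl ?(ltW e_gt0) //.
by apply: big_seq_sub_le; rewrite ?zbox_uniq //; apply: h2; apply: leq_maxr.
Qed.

Lemma zsum_finite f (s : seq int) : uniq s ->
  (forall i, i \notin s -> f i = 0) -> zsum f = \sum_(i <- s) f i.
Proof.
move=> us h; have h0 i : i \notin s -> abs (f i) <= 0.
  by move=> /h ->; rewrite vabs0.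
apply: (eq_of_vabs_le abs_na) => eps e0; apply: (le_trans _ (ltW e0)).
apply: zsum_approx => // e e1; exists s => i /h0 hi.
exact: le_trans hi (ltW e1).
Qed.

Lemma vanishing_common f g eps : vanishing f -> vanishing g -> 0 < eps ->
  exists s, [/\ uniq s, forall i, i \notin s -> abs (f i) <= eps &
                forall i, i \notin s -> abs (g i) <= eps].
Proof.
move=> vf vg e0; have [s hs] := vf _ e0; have [t ht] := vg _ e0.
exists (undup (s ++ t)); rewrite undup_uniq; split=> // i;
  rewrite mem_undup mem_cat negb_or => /andP [h1 h2]; [exact: hs|exact: ht].
Qed.

Lemma vanishingD f g : vanishing f -> vanishing g ->
  vanishing (fun i => f i + g i).
Proof.
move=> vf vg e e0; have [s [_ h1 h2]] := vanishing_common vf vg e0.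
by exists s => i hi; apply: vabsD_le; [|apply: h1|apply: h2].
Qed.

Lemma vanishingZ c f : vanishing f -> vanishing (fun i => c * f i).
Proof.
(* Adding 1 keeps the divisor positive when c = 0. *)
move=> vf e e0; have c0 : 0 < abs c + 1 by rewrite ltr_pwDr ?vabs_ge0.
have [s hs] := vf _ (divr_gt0 e0 c0); exists s => i /hs hi.
rewrite vabsM // (le_trans (ler_wpM2l (vabs_ge0 abs_na c) hi)) //.
rewrite mulrCA ger_pMr // ler_pdivrMr // mul1r lerDl //.
Qed.

Lemma zsumD f g : vanishing f -> vanishing g ->
  zsum (fun i => f i + g i) = zsum f + zsum g.
Proof.
move=> vf vg; apply: (eq_of_vabs_le abs_na) => e e0.
have [s [us h1 h2]] := vanishing_common vf vg e0.
have h3 := zsum_approx (vanishingD vf vg) (ltW e0) us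
  (fun i hi => vabsD_le abs_na (h1 i hi) (h2 i hi)).
rewrite big_split /= in h3.
have := zsum_approx vf (ltW e0) us h1; have := zsum_approx vg (ltW e0) us h2.
set a := \sum_(i <- s) f i in h3 *; set b := \sum_(i <- s) g i in h3 *.
move=> hb ha.
have -> : zsum (fun i => f i + g i) - (zsum f + zsum g) =
  (zsum (fun i => f i + g i) - (a + b)) - ((zsum f - a) + (zsum g - b)).
  by ring.
by apply: vabsB_le => //; apply: vabsD_le.
Qed.

Lemma zsumZ c f : vanishing f -> zsum (fun i => c * f i) = c * zsum f.
Proof.
move=> vf; apply: (eq_of_vabs_le abs_na) => e e0.
have c0 : 0 < abs c + 1 by rewrite ltr_pwDr ?vabs_ge0.
have de : 0 < e / (abs c + 1) by rewrite divr_gt0.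
have hc : abs c * (e / (abs c + 1)) <= e.
  by rewrite mulrCA ger_pMr // ler_pdivrMr // mul1r lerDl.
have [s hs] := vf _ de.
have hs1 i : i \notin undup s -> abs (f i) <= e / (abs c + 1).
  by rewrite mem_undup; apply: hs.
have hs2 i : i \notin undup s -> abs (c * f i) <= e.
  move=> /hs1 hi; rewrite vabsM //.
  exact: le_trans (ler_wpM2l (vabs_ge0 abs_na c) hi) hc.
have h1 := zsum_approx vf (ltW de) (undup_uniq s) hs1.
have h2 := zsum_approx (vanishingZ c vf) (ltW e0) (undup_uniq s) hs2.
rewrite -mulr_sumr in h2.
rewrite -[X in abs X](subrKA (c * \sum_(i <- undup s) f i)).
apply: vabsD_le => //; rewrite -mulrBr vabsM // vabs_subC //.
exact: le_trans (ler_wpM2l (vabs_ge0 abs_na c) h1) hc.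
Qed.

Lemma vanishing_reindex (phi psi : int -> int) f :
  cancel psi phi -> cancel phi psi -> vanishing f ->
  vanishing (fun i => f (phi i)).
Proof.
move=> h1 h2 vf e e0; have [s hs] := vf _ e0.
exists (map psi s) => i hi; apply: hs; apply: contra hi => hi.
by apply/mapP; exists (phi i).
Qed.

Lemma zsum_reindex (phi psi : int -> int) f :
  cancel psi phi -> cancel phi psi -> vanishing f ->
  zsum (fun i => f (phi i)) = zsum f.
Proof.
move=> h1 h2 vf; apply: (eq_of_vabs_le abs_na) => e e0.
have [s0 hs0] := vf _ e0; pose s := undup s0.
have us : uniq s by apply: undup_uniq.
have hs i : i \notin s -> abs (f i) <= e by rewrite mem_undup; apply: hs0.
have um : uniq (map psi s) by rewrite map_inj_uniq //; apply: can_inj h1.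
have hm i : i \notin map psi s -> abs (f (phi i)) <= e.
  move=> hi; apply: hs; apply: contra hi => hi; apply/mapP.
  by exists (phi i).
have := zsum_approx (vanishing_reindex h1 h2 vf) (ltW e0) um hm.
rewrite big_map; under eq_bigr => i _ do rewrite h1.
move=> hA; have hB := zsum_approx vf (ltW e0) us hs.
rewrite -[X in abs X](subrKA (\sum_(i <- s) f i)).
by apply: vabsD_le => //; rewrite vabs_subC.
Qed.

Lemma zsum_le f C : vanishing f -> 0 <= C -> (forall i, abs (f i) <= C) ->
  abs (zsum f) <= C.
Proof.
by move=> vf C0 h; have := @zsum_approx f [::] C vf C0 isT (fun i _ => h i);
  rewrite big_nil subr0.
Qed.

Lemma zsum_fubini_approx (F : int -> int -> K) s e : 0 < e -> uniq s ->
  (forall i, vanishing (F i)) -> vanishing (fun i => zsum (F i)) ->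
  (forall i j, (i \notin s) || (j \notin s) -> abs (F i j) <= e) ->
  abs (zsum (fun i => zsum (F i)) - \sum_(i <- s) \sum_(j <- s) F i j) <= e.
Proof.
move=> e0 us v1 v2 h.
rewrite -[X in abs X](subrKA (\sum_(i <- s) zsum (F i))).
apply: vabsD_le => //.
  apply: zsum_approx => //; first exact: ltW.
  move=> i hi; apply: zsum_le => //; first exact: ltW.
  by move=> j; apply: h; rewrite hi.
rewrite -sumrB; apply: vabs_sum_le => //; first exact: ltW.
move=> i _; apply: zsum_approx => //; first exact: ltW.
by move=> j hj; apply: h; rewrite hj orbT.
Qed.

(** Joint smallness outside a finite square makes both iterated sums close to the same finite double
    sum over that square. *)
Lemma zsum_fubini (F : int -> int -> K) :
  (forall e, 0 < e -> exists s : seq int, forall i j,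
     (i \notin s) || (j \notin s) -> abs (F i j) <= e) ->
  zsum (fun i => zsum (F i)) = zsum (fun j => zsum (F^~ j)).
Proof.
move=> h.
have v1 i : vanishing (F i).
  by move=> e /h [s hs]; exists s => j hj; apply: hs; rewrite hj orbT.
have v1' j : vanishing (F^~ j).
  by move=> e /h [s hs]; exists s => i hi; apply: hs; rewrite hi.
have v2 : vanishing (fun i => zsum (F i)).
  move=> e e0; have [s hs] := h _ e0; exists s => i hi.
  by apply: zsum_le => //; [exact: ltW|move=> j; apply: hs; rewrite hi].
have v2' : vanishing (fun j => zsum (F^~ j)).
  move=> e e0; have [s hs] := h _ e0; exists s => j hj.
  by apply: zsum_le => //; [exact: ltW|move=> i; apply: hs; rewrite hj orbT].
apply: (eq_of_vabs_le abs_na) => e e0; have [s0 hs0] := h _ e0.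
pose s := undup s0; have us : uniq s by apply: undup_uniq.
have hs i j : (i \notin s) || (j \notin s) -> abs (F i j) <= e.
  by rewrite !mem_undup; apply: hs0.
have hA := zsum_fubini_approx e0 us v1 v2 hs.
have hs' i j : (i \notin s) || (j \notin s) -> abs (F j i) <= e.
  by rewrite orbC; apply: hs.
have hB := zsum_fubini_approx e0 us v1' v2' hs'.
rewrite exchange_big /= in hB.
rewrite -[X in abs X](subrKA (\sum_(i <- s) \sum_(j <- s) F i j)).
by apply: vabsD_le => //; rewrite vabs_subC.
Qed.

End SumOverZ.

(** * The ring H *)

Lemma HsetP (R : realType) (K : fieldType) (abs : K -> R) (a : biseries K) :
  nonarch_absval abs ->
  Hset abs a <-> (exists C, forall j, abs (a j) <= C) /\
    (forall eps, 0 < eps -> exists N : nat, forall j : int,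
       N%:Z <= j -> abs (a j) <= eps).
Proof.
move=> abs_na; split=> [[[C hC] h]|[[C hC] h]].
  split; first by exists C => j; apply: hC; exists j.
  move=> e e0; move/cvgr0Pnorm_le: h => /(_ e e0) [N _ hN].
  exists N => -[m Nm|m //]; have := hN m Nm.
  by rewrite /= ger0_norm ?vabs_ge0.
split; first by exists C => _ [j _ <-].
apply/cvgr0Pnorm_le => e e0; have [N hN] := h e e0.
by exists N => // m /= Nm; rewrite ger0_norm ?vabs_ge0 // hN.
Qed.

(* The proof arguments only make the ring structure below canonical. *)
Record Hring (R : realType) (K : fieldType) (abs : K -> R)
  (abs_na : nonarch_absval abs) (abs_cp : complete_field abs) :=
  MkH { hval :> int -> K; hvalP : Hset abs hval }.

Section Hring.
Context {R : realType} {K : fieldType} {abs : K -> R}.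
Variables (abs_na : nonarch_absval abs) (abs_cp : complete_field abs).

Local Notation H := (Hring abs_na abs_cp).
Implicit Types x y z : H.

HB.instance Definition _ := gen_eqMixin H.
HB.instance Definition _ := gen_choiceMixin H.

Lemma hval_inj : injective (fun x : H => hval x).
Proof.
move=> [x hx] [y hy] /= xy; subst y; congr MkH; exact: Prop_irrelevance.
Qed.

Lemma hring_ext x y : (forall j, x j = y j) -> x = y.
Proof. by move=> xy; apply: hval_inj; apply/funext. Qed.

Lemma hval_bounded x : exists2 C, 1 <= C & forall j, abs (x j) <= C.
Proof.
have [[C hC] _] := (HsetP _ abs_na).1 (hvalP x).
exists (Num.max 1 C) => [|j]; first by rewrite le_max lexx.
by rewrite le_max hC orbT.
Qed.

Lemma hval_small x eps : 0 < eps ->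
  exists N : nat, forall j : int, N%:Z <= j -> abs (x j) <= eps.
Proof. by have [_ h] := (HsetP _ abs_na).1 (hvalP x); apply: h. Qed.

Lemma Hset_add x y : Hset abs (fun j => x j + y j).
Proof.
apply/HsetP => //.
have [C C1 hC] := hval_bounded x; have [D D1 hD] := hval_bounded y.
split; first exists (Num.max C D) => j.
  by apply: vabsD_le; rewrite // le_max ?hC ?hD ?orbT.
move=> e e0; have [N hN] := hval_small x e0; have [M hM] := hval_small y e0.
exists (maxn N M) => j hj; apply: vabsD_le => //; [apply: hN|apply: hM]; lia.
Qed.

Lemma Hset_scale c x : Hset abs (fun j => c * x j).
Proof.
apply/HsetP => //.
have [C C1 hC] := hval_bounded x.
split; first exists (abs c * C) => j.
  by rewrite vabsM // ler_wpM2l // vabs_ge0.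
move=> e e0; have c0 : 0 < abs c + 1 by rewrite ltr_pwDr ?vabs_ge0.
have [N hN] := hval_small x (divr_gt0 e0 c0).
exists N => j /hN hj; rewrite vabsM //.
rewrite (le_trans (ler_wpM2l (vabs_ge0 abs_na c) hj)) //.
by rewrite mulrCA ger_pMr // ler_pdivrMr // mul1r lerDl.
Qed.

Lemma Hset_opp x : Hset abs (fun j => - x j).
Proof.
have -> : (fun j => - x j) = (fun j => - 1 * x j).
  by apply/funext => j; rewrite mulN1r.
exact: Hset_scale.
Qed.

Lemma Hset_finite (a : biseries K) (s : seq int) :
  (forall j, j \notin s -> a j = 0) -> Hset abs a.
Proof.
move=> h; apply/HsetP => //; split.
  exists (\big[Num.max/0]_(j <- s) abs (a j)) => j.
  case: (boolP (j \in s)) => [js|/h ->]; last first.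
    by rewrite vabs0 //; elim/big_rec: _ => // i x _ hx; rewrite le_max hx orbT.
  elim: s js {h} => // i s IH; rewrite in_cons big_cons le_max.
  by case/orP => [/eqP ->|/IH ->]; rewrite ?lexx ?orbT.
move=> e e0; have [N hN] := sub_zbox s.
exists N => j Nj; rewrite h ?vabs0 ?ltW //.
by apply/negP => /(hN N (leqnn N)); rewrite mem_zbox; case: j Nj => m; lia.
Qed.

Definition H_zero : H := MkH abs_na abs_cp (@Hset_finite (fun _ => 0) [::] (fun _ _ => erefl)).
Definition H_add x y : H := MkH abs_na abs_cp (Hset_add x y).
Definition H_opp x : H := MkH abs_na abs_cp (Hset_opp x).
Definition H_scale c x : H := MkH abs_na abs_cp (Hset_scale c x).

Fact H_addA : associative H_add.
Proof. by move=> x y z; apply: hring_ext => j /=; rewrite addrA. Qed.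
Fact H_addC : commutative H_add.
Proof. by move=> x y; apply: hring_ext => j /=; rewrite addrC. Qed.
Fact H_add0 : left_id H_zero H_add.
Proof. by move=> x; apply: hring_ext => j /=; rewrite add0r. Qed.
Fact H_addN : left_inverse H_zero H_opp H_add.
Proof. by move=> x; apply: hring_ext => j /=; rewrite addNr. Qed.

HB.instance Definition _ := GRing.isZmodule.Build H H_addA H_addC H_add0 H_addN.

Lemma notin_zbox N (i : int) : i \notin zbox N -> N%:Z <= i \/ i < - N%:Z.
Proof. by rewrite mem_zbox; case: i => m; lia. Qed.

Lemma conv_term_le x y C eps (N : nat) : 0 < C -> 0 <= eps ->
  (forall j, abs (x j) <= C) -> (forall j, abs (y j) <= C) ->
  (forall j : int, N%:Z <= j -> abs (x j) <= eps / C) ->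
  (forall j : int, N%:Z <= j -> abs (y j) <= eps / C) ->
  forall i j, N%:Z <= i \/ N%:Z <= j -> abs (x i * y j) <= eps.
Proof.
move=> C0 e0 hx hy sx sy i j; rewrite vabsM // => -[] h.
  have -> : eps = eps / C * C by rewrite divfK // gt_eqF.
  by apply: ler_pM; rewrite ?vabs_ge0 //; apply: sx.
have -> : eps = C * (eps / C) by rewrite mulrC divfK // gt_eqF.
by apply: ler_pM; rewrite ?vabs_ge0 //; apply: sy.
Qed.

(** The tails are measured against eps / C so that a product with one factor in the tail is at most
    eps, as in [conv_term_le]. *)
Lemma hval_common x y eps : 0 < eps -> exists C (N : nat), [/\ 0 < C,
  forall j, abs (x j) <= C, forall j, abs (y j) <= C,
  forall j : int, N%:Z <= j -> abs (x j) <= eps / C &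
  forall j : int, N%:Z <= j -> abs (y j) <= eps / C].
Proof.
move=> e0; have [C C1 hC] := hval_bounded x; have [D D1 hD] := hval_bounded y.
pose M := Num.max C D; have M0 : 0 < M.
  by rewrite lt_max (lt_le_trans ltr01 C1).
have [N hN] := hval_small x (divr_gt0 e0 M0).
have [P hP] := hval_small y (divr_gt0 e0 M0).
exists M, (maxn N P); split=> // j.
- by rewrite le_max hC.
- by rewrite le_max hD orbT.
- by move=> hj; apply: hN; lia.
- by move=> hj; apply: hP; lia.
Qed.

Lemma conv_vanishing x y n : vanishing (abs := abs) (fun i => x i * y (n - i)).
Proof.
move=> e e0; have [C [N [C0 h1 h2 h3 h4]]] := hval_common x y e0.
(* As i + (n - i) = n, an index i outside this box has i >= N or n - i >= N; elements of H are small
   only in the positive direction. *)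
exists (zbox (N + `|n|).+1) => i /notin_zbox hi.
by apply: (conv_term_le C0 (ltW e0) h1 h2 h3 h4); lia.
Qed.

Lemma smulE (a b : biseries K) n :
  smul abs a b n = zsum (abs := abs) (fun i => a i * b (n - i)).
Proof. by []. Qed.

Lemma Hset_mul x y : Hset abs (smul abs (hval x) (hval y)).
Proof.
apply/HsetP => //; split.
  have [C [N [C0 h1 h2 h3 h4]]] := hval_common x y ltr01.
  exists (C * C) => n; rewrite smulE; apply: zsum_le => //; first exact: conv_vanishing.
    by rewrite mulr_ge0 ?ltW.
  by move=> i; rewrite vabsM // ler_pM ?vabs_ge0.
move=> e e0; have [C [N [C0 h1 h2 h3 h4]]] := hval_common x y e0.
(* Two indices whose sum is at least 2N cannot both be below N. *)
exists N.*2 => n Nn; rewrite smulE; apply: zsum_le => //; first exact: conv_vanishing.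
  exact: ltW.
by move=> i; apply: (conv_term_le C0 (ltW e0) h1 h2 h3 h4); lia.
Qed.

Lemma Hset_monomial m : Hset abs (monomial K m).
Proof.
by apply: (@Hset_finite _ [:: m]) => j; rewrite inE /monomial => /negPf ->.
Qed.

Definition H_mul x y : H := MkH abs_na abs_cp (Hset_mul x y).
Definition H_mono m : H := MkH abs_na abs_cp (Hset_monomial m).

Fact H_mulC : commutative H_mul.
Proof.
move=> x y; apply: hring_ext => n; rewrite /= !smulE.
rewrite -(@zsum_reindex _ _ _ abs_na abs_cp (fun i => n - i) (fun i => n - i)).
- by congr zsum; apply/funext => i; rewrite subKr mulrC.
- exact: subKr.
- exact: subKr.
- exact: conv_vanishing.
Qed.

Fact H_mul1 : left_id (H_mono 0) H_mul.
Proof.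
move=> x; apply: hring_ext => n; rewrite /= smulE.
rewrite (@zsum_finite _ _ _ abs_na abs_cp _ [:: 0]) //.
  by rewrite big_seq1 /= /monomial eqxx mul1r subr0.
by move=> i; rewrite inE /= /monomial => /negPf ->; rewrite mul0r.
Qed.

Fact H_mulDl : left_distributive H_mul H_add.
Proof.
move=> x y z; apply: hring_ext => n; rewrite /= !smulE.
rewrite -zsumD //; try exact: conv_vanishing.
by congr zsum; apply/funext => i; rewrite mulrDl.
Qed.

Fact H_mulA : associative H_mul.
Proof.
move=> x y z; apply: hring_ext => n; rewrite /= !smulE.
(* Both sides are iterated sums of F, in the two orders. *)
pose F k i := x i * y (k - i) * z (n - k).
transitivity (zsum (abs := abs) (fun i => zsum (abs := abs) (F^~ i))).
  congr zsum; apply/funext => i /=; rewrite smulE -zsumZ //; last first.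
    exact: conv_vanishing.
  rewrite -(@zsum_reindex _ _ _ abs_na abs_cp (fun k => k - i) (fun k => k + i)).
  - congr zsum; apply/funext => k; rewrite /F mulrA; congr (_ * z _); ring.
  - exact: addrK.
  - exact: subrK.
  - exact/vanishingZ/conv_vanishing.
rewrite -(@zsum_fubini _ _ _ abs_na abs_cp F).
  congr zsum; apply/funext => k; rewrite smulE mulrC -zsumZ //.
    by congr zsum; apply/funext => i; rewrite /F mulrC.
  exact: conv_vanishing.
move=> e e0.
have [C C1 hC] := hval_bounded x; have [D D1 hD] := hval_bounded y.
have [E E1 hE] := hval_bounded z.
pose B := C * D * E.
have C0 : 0 < C by apply: lt_le_trans ltr01 C1.
have D0 : 0 < D by apply: lt_le_trans ltr01 D1.
have E0 : 0 < E by apply: lt_le_trans ltr01 E1.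
have B0 : 0 < B by rewrite !mulr_gt0.
have [N1 h1] := hval_small x (divr_gt0 e0 B0).
have [N2 h2] := hval_small y (divr_gt0 e0 B0).
have [N3 h3] := hval_small z (divr_gt0 e0 B0).
have eB : e = e / B * B by rewrite divfK // gt_eqF.
have q0 : 0 <= e / B by rewrite ltW ?divr_gt0.
(* The three bounds are at least 1, so B dominates the product of any two of them. *)
have prod3 a b c : 0 <= a -> 0 <= b -> 0 <= c -> a <= C -> b <= D -> c <= E ->
    [\/ a <= e / B, b <= e / B | c <= e / B] -> a * b * c <= e.
  move=> a0 b0 c0 ha hb hc hs.
  have ab : 0 <= a * b by apply: mulr_ge0.
  case: hs => h.
  - rewrite eB (@le_trans _ _ (e / B * D * E)) //.
      by apply: ler_pM => //; apply: ler_pM.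
    rewrite -mulrA ler_wpM2l // /B -mulrA ler_peMl // ltW // mulr_gt0 //.
  - rewrite eB (@le_trans _ _ (C * (e / B) * E)) //.
      by apply: ler_pM => //; apply: ler_pM.
    rewrite mulrAC mulrC ler_wpM2l // /B -mulrA.
    by rewrite ler_wpM2l ?(ltW C0) // ler_peMl // ltW.
  - rewrite eB (@le_trans _ _ (C * D * (e / B))) //.
      by apply: ler_pM => //; apply: ler_pM.
    rewrite mulrC ler_wpM2l // /B ler_peMr // ltW // mulr_gt0 //.
(* The indices i, k - i and n - k add up to n: outside this box they cannot lie below N1, N2 and N3
   all at once. *)
exists (zbox (N1 + N2 + N3 + `|n|).+1) => k i hki.
rewrite /F !vabsM //; apply: prod3; rewrite ?vabs_ge0 //.
case: (lerP N1%:Z i) => [/h1|a1]; first by constructor 1.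
case: (lerP N2%:Z (k - i)) => [/h2|a2]; first by constructor 2.
constructor 3; apply: h3.
by case/orP: hki => /notin_zbox; lia.
Qed.

Fact H_one_neq0 : H_mono 0 != 0.
Proof.
apply/eqP => /(congr1 (fun x : H => x 0)) /=.
by rewrite /monomial eqxx => /eqP; rewrite oner_eq0.
Qed.

HB.instance Definition _ := GRing.Zmodule_isComNzRing.Build H
  H_mulA H_mulC H_mul1 H_mulDl H_one_neq0.

Fact H_scaleA c d x : H_scale c (H_scale d x) = H_scale (c * d) x.
Proof. by apply: hring_ext => j /=; rewrite mulrA. Qed.
Fact H_scale1 : left_id 1 H_scale.
Proof. by move=> x; apply: hring_ext => j /=; rewrite mul1r. Qed.
Fact H_scaleDr : right_distributive H_scale +%R.
Proof. by move=> c x y; apply: hring_ext => j /=; rewrite mulrDr. Qed.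
Fact H_scaleDl x : {morph H_scale^~ x : a b / a + b}.
Proof. by move=> c d; apply: hring_ext => j /=; rewrite mulrDl. Qed.

HB.instance Definition _ := GRing.Zmodule_isLmodule.Build K H
  H_scaleA H_scale1 H_scaleDr H_scaleDl.

Fact H_scaleAl (c : K) x y : c *: (x * y) = (c *: x) * y.
Proof.
apply: hring_ext => n /=; rewrite !smulE -zsumZ //; last exact: conv_vanishing.
by congr zsum; apply/funext => i; rewrite mulrA.
Qed.

HB.instance Definition _ := GRing.Lmodule_isLalgebra.Build K H H_scaleAl.
HB.instance Definition _ := GRing.Lalgebra_isComAlgebra.Build K H.

Lemma hval0 j : (0 : H) j = 0. Proof. by []. Qed.
Lemma hvalD x y j : (x + y) j = x j + y j. Proof. by []. Qed.
Lemma hvalN x j : (- x) j = - x j. Proof. by []. Qed.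
Lemma hvalB x y j : (x - y) j = x j - y j. Proof. by []. Qed.
Lemma hvalZ c x j : (c *: x) j = c * x j. Proof. by []. Qed.
Lemma hval1 j : (1 : H) j = (j == 0)%:R. Proof. by []. Qed.
Lemma hvalM x y : hval (x * y) = smul abs (hval x) (hval y). Proof. by []. Qed.

Lemma hval_sum (I : Type) (r : seq I) (P : pred I) (f : I -> H) j :
  (\sum_(i <- r | P i) f i) j = \sum_(i <- r | P i) f i j.
Proof. by elim/big_rec2: _ => // i y1 y2 _ <-. Qed.

(** Equivalent to a Gauss norm at most C, but free of the supremum. *)
Definition hbd x (C : R) := forall j, abs (x j) <= C.

Lemma hbd_le x C D : C <= D -> hbd x C -> hbd x D.
Proof. by move=> CD h j; apply: le_trans (h j) CD. Qed.

Lemma hbd0 C : 0 <= C -> hbd 0 C.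
Proof. by move=> C0 j; rewrite hval0 vabs0. Qed.

Lemma hbd1 : hbd 1 1.
Proof. by move=> j; rewrite hval1 vabs_nat_le1. Qed.

Lemma hbdD x y C : hbd x C -> hbd y C -> hbd (x + y) C.
Proof. by move=> hx hy j; apply: vabsD_le. Qed.

Lemma hbdN x C : hbd x C -> hbd (- x) C.
Proof. by move=> hx j; rewrite hvalN vabsN. Qed.

Lemma hbdB x y C : hbd x C -> hbd y C -> hbd (x - y) C.
Proof. by move=> hx hy; apply: hbdD => //; apply: hbdN. Qed.

Lemma hbdZ c x C : hbd x C -> hbd (c *: x) (abs c * C).
Proof. by move=> hx j; rewrite hvalZ vabsM // ler_wpM2l ?vabs_ge0. Qed.

Lemma hbd_sum (I : Type) (r : seq I) (P : pred I) (f : I -> H) C : 0 <= C ->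
  (forall i, P i -> hbd (f i) C) -> hbd (\sum_(i <- r | P i) f i) C.
Proof.
by move=> C0 h j; rewrite hval_sum; apply: vabs_sum_le => // i Pi; apply: h.
Qed.

Lemma hbd_ge0 x C : hbd x C -> 0 <= C.
Proof. by move=> /(_ 0); apply: le_trans; apply: vabs_ge0. Qed.

Lemma hbdM x y C D : hbd x C -> hbd y D -> hbd (x * y) (C * D).
Proof.
move=> hx hy n; rewrite hvalM smulE.
apply: zsum_le; rewrite ?mulr_ge0 ?(hbd_ge0 hx) ?(hbd_ge0 hy) //.
  exact: conv_vanishing.
by move=> i; rewrite vabsM // ler_pM ?vabs_ge0.
Qed.

Lemma hbdX x C m : hbd x C -> hbd (x ^+ m) (C ^+ m).
Proof.
move=> hx; elim: m => [|m IH]; first by rewrite !expr0; apply: hbd1.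
by rewrite !exprS; apply: hbdM.
Qed.

Lemma hbd_exists x : exists2 C, 1 <= C & hbd x C.
Proof. exact: hval_bounded. Qed.

Lemma hring_eq_of_hbd x y : (forall e, 0 < e -> hbd (x - y) e) -> x = y.
Proof.
move=> h; apply: hring_ext => j; apply: (eq_of_vabs_le abs_na) => e e0.
exact: h.
Qed.

Lemma gauss_norm_lt x eps : gauss_norm abs (hval x) < eps -> hbd x eps.
Proof.
move=> h j; apply: le_trans (ltW h); apply: ub_le_sup; last by exists j.
by have [C _ hC] := hval_bounded x; exists C => _ [i _ <-].
Qed.

Lemma gauss_norm_le x C : hbd x C -> gauss_norm abs (hval x) <= C.
Proof.
move=> h; apply: ge_sup; first by exists (abs (x 0)), 0.
by move=> _ [i _ <-].
Qed.

Definition hcvg (f : nat -> H) (S : H) := forall eps, 0 < eps ->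
  exists N, forall m, (N <= m)%N -> hbd (S - f m) eps.

Lemma hcvg_unique f S S' : hcvg f S -> hcvg f S' -> S = S'.
Proof.
move=> h h'; apply: hring_eq_of_hbd => e e0.
have [N hN] := h _ e0; have [M hM] := h' _ e0.
rewrite -(subrKA (f (maxn N M))); apply: hbdD; first by apply: hN; lia.
by rewrite -opprB; apply: hbdN; apply: hM; lia.
Qed.

Lemma hcvg_bd f S C : 0 <= C -> hcvg f S -> (forall m, hbd (f m) C) -> hbd S C.
Proof.
move=> C0 h hf j; apply/ler_addgt0Pr => e e0; have [N hN] := h e e0.
rewrite -[S](subrK (f N)) hvalD; apply: vabsD_le => //.
  by apply: le_trans (hN N (leqnn N) j) _; rewrite lerDr.
by apply: le_trans (hf N j) _; rewrite lerDl ltW.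
Qed.

Lemma hcvg_coef f S j c N : hcvg f S ->
  (forall m, (N <= m)%N -> f m j = c) -> S j = c.
Proof.
move=> h hc; apply: (eq_of_vabs_le abs_na) => e e0.
have [M hM] := h _ e0; rewrite -(hc (maxn N M)); last by lia.
by apply: hM; lia.
Qed.

Lemma hcvgD f g S S' : hcvg f S -> hcvg g S' -> hcvg (fun m => f m + g m) (S + S').
Proof.
move=> h h' e e0; have [N hN] := h e e0; have [M hM] := h' e e0.
exists (maxn N M) => m hm; rewrite opprD addrACA.
by apply: hbdD; [apply: hN|apply: hM]; lia.
Qed.

Lemma hcvgM f g S S' : hcvg f S -> hcvg g S' ->
  hcvg (fun m => f m * g m) (S * S').
Proof.
move=> h h' e e0.
have [C C1 hC] := hbd_exists S; have [D D1 hD] := hbd_exists S'.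
have C0 : 0 < C by apply: lt_le_trans ltr01 C1.
have D0 : 0 < D by apply: lt_le_trans ltr01 D1.
have [N hN] := h _ (divr_gt0 e0 D0).
(* The minimum serves twice: C * e' <= e for the term with S, and e * e' <= e for the product of the
   two errors. *)
pose e' := Num.min 1 (e / C).
have e'0 : 0 < e' by rewrite lt_min ltr01 divr_gt0.
have [M hM] := h' _ e'0.
have [N' hN'] := h _ e0.
exists (maxn N (maxn N' M)) => m hm.
have -> : S * S' - f m * g m =
  S * (S' - g m) + ((S - f m) * S' - (S - f m) * (S' - g m)) by ring.
apply: hbdD; last apply: hbdB.
- apply: (@hbd_le _ (C * e')); last by apply: hbdM => //; apply: hM; lia.
  rewrite (@le_trans _ _ (C * (e / C))) //; last by rewrite mulrC divfK ?gt_eqF.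
  by rewrite ler_wpM2l ?(ltW C0) // ge_min lexx orbT.
- apply: (@hbd_le _ (e / D * D)); first by rewrite divfK ?gt_eqF.
  by apply: hbdM => //; apply: hN; lia.
- apply: (@hbd_le _ (e * e')); last first.
    by apply: hbdM; [apply: hN'|apply: hM]; lia.
  by rewrite -[leRHS]mulr1 ler_wpM2l ?(ltW e0) // ge_min lexx.
Qed.

Lemma hcvg_ext f g S : (forall e, 0 < e -> exists N, forall m, (N <= m)%N ->
  hbd (f m - g m) e) -> hcvg f S -> hcvg g S.
Proof.
move=> h hf e e0; have [N hN] := h e e0; have [M hM] := hf e e0.
exists (maxn N M) => m hm; rewrite -(subrKA (f m)).
by apply: hbdD; [apply: hM|apply: hN]; lia.
Qed.

(** In the ultrametric setting terms tending to 0 suffice. The limit is taken coefficient by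
    coefficient; it lies in H because the tail bounds are uniform in the coefficient. *)
Lemma hseries_cvg (x : nat -> H) :
  (forall eps, 0 < eps -> exists N, forall m, (N <= m)%N -> hbd (x m) eps) ->
  exists S, hcvg (fun m => \sum_(i < m) x i) S.
Proof.
move=> h; pose P m := \sum_(i < m) x i.
have tail N e : 0 <= e -> (forall m, (N <= m)%N -> hbd (x m) e) ->
    forall m, (N <= m)%N -> hbd (P m - P N) e.
  move=> e0 hN m Nm; rewrite /P -!(big_mkord xpredT) (big_cat_nat (leq0n N) Nm) //=.
  rewrite addrAC subrr add0r big_seq; apply: hbd_sum => // i.
  by rewrite mem_index_iota => /andP [/hN].
have lim j : exists l, tends_to abs (fun m => P m j) l.
  apply: abs_cp => e e0; have e2 : 0 < e / 2 by rewrite divr_gt0.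
  have [N hN] := h _ e2; exists N => m n Nm Nn.
  apply: (@le_lt_trans _ _ (e / 2)); last by lra.
  rewrite -[X in abs X](subrKA (P N j)); apply: vabsD_le => //.
    exact: (tail _ _ (ltW e2) hN m Nm j).
  rewrite vabs_subC //; exact: (tail _ _ (ltW e2) hN n Nn j).
pose S j := seq_limit abs (fun m => P m j).
have SP j : tends_to abs (fun m => P m j) (S j).
  by have [l hl] := lim j; rewrite /S (seq_limitE abs_na hl).
have close e : 0 < e -> exists N, forall m, (N <= m)%N ->
    forall j, abs (S j - P m j) <= e.
  move=> e0; have [N hN] := h _ e0; exists N => m Nm j.
  have [M hM] := (tends_toP abs_na _ _).1 (SP j) _ e0.
  rewrite -[X in abs X](subrKA (P (maxn m M) j)); apply: vabsD_le => //.
    by rewrite vabs_subC //; apply: hM; lia.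
  apply: (tail m e (ltW e0)); [|by lia].
  by move=> k mk; apply: hN; lia.
have SH : Hset abs S.
  apply/HsetP => //; split.
    have [N hN] := close _ ltr01; have [C C1 hC] := hval_bounded (P N).
    exists C => j; rewrite -[S j](subrK (P N j)); apply: vabsD_le => //.
    exact: le_trans (hN N (leqnn N) j) C1.
  move=> e e0; have [N hN] := close e e0; have [M hM] := hval_small (P N) e0.
  exists M => j Mj; rewrite -[S j](subrK (P N j)).
  by apply: vabsD_le => //; [apply: hN|apply: hM].
by exists (MkH abs_na abs_cp SH) => e /close.
Qed.

End Hring.

(** * Finite extensions and p-adic integers *)

Section FiniteExtension.
Context {R : realType} {F : fieldType} {absp : F -> R}.
Context {K : fieldExtType F} {abs : K -> R}.
Hypothesis absp_na : nonarch_absval absp.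
Hypothesis absp_cp : complete_field absp.
Hypothesis abs_na : nonarch_absval abs.
Hypothesis abs_ext : forall x : F, abs x%:A = absp x.

Lemma vabsZ (c : F) (x : K) : abs (c *: x) = absp c * abs x.
Proof. by rewrite -mulr_algl vabsM // abs_ext. Qed.

Definition complete_in (U : {vspace K}) := forall u, (forall m, u m \in U) ->
  cauchy_seq abs u -> exists2 l, l \in U & tends_to abs u l.

(** Otherwise elements u_m of U with b + u_m smaller than 1/(m+1) would form a Cauchy sequence,
    whose limit -b would lie in U. *)
Lemma dist_gt0 (U : {vspace K}) b : complete_in U -> b \notin U ->
  exists2 C, 0 < C & forall u, u \in U -> C <= abs (b + u).
Proof.
move=> Ucp bU; apply: contrapT => hno.
have ex (m : nat) : exists u, u \in U /\ abs (b + u) < m.+1%:R^-1.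
  apply: contrapT => h; apply: hno; exists m.+1%:R^-1.
    by rewrite invr_gt0 ltr0Sn.
  move=> u uU; rewrite leNgt; apply/negP => lt; apply: h.
  by exists u.
have [u hu] := choice ex.
have small e : 0 < e -> exists N, forall m, (N <= m)%N -> abs (b + u m) < e.
  move=> e0; pose N := Num.bound e^-1; exists N => m Nm.
  apply: lt_trans (hu m).2 _; rewrite -[e]invrK ltf_pV2 ?posrE ?invr_gt0 //.
  apply: (lt_le_trans (archi_boundP _)); first by rewrite invr_ge0 ltW.
  by rewrite ler_nat leqW.
have [|l lU hl] := Ucp u (fun m => (hu m).1).
  move=> e e0; have [N hN] := small e e0; exists N => m n Nm Nn.
  have -> : u m - u n = (b + u m) - (b + u n) by ring.
  apply: (@le_lt_trans _ _ (Num.max (abs (b + u m)) (abs (b + u n)))).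
    by apply: vabsB_le; rewrite // le_max lexx ?orbT.
  by rewrite gt_max !hN.
case/negP: bU; suff -> : b = - l by rewrite rpredN.
apply: (eq_of_vabs_le abs_na) => e e0; have [N hN] := small e e0.
have [M hM] := (tends_toP abs_na _ _).1 hl e e0.
have -> : b - - l = (b + u (maxn N M)) - (u (maxn N M) - l) by ring.
by apply: vabsB_le => //; [apply/ltW/hN|apply: hM]; lia.
Qed.

(** The distance C from b to U bounds the coordinate along b by |c b + v| / C, so both coordinates
    of a Cauchy sequence are Cauchy. *)
Lemma complete_in_addv (U : {vspace K}) b :
  complete_in U -> complete_in (<[b]> + U)%VS.
Proof.
move=> Ucp; have [bU|bU] := boolP (b \in U).
  suff -> : (<[b]> + U)%VS = U by [].
  by apply/addv_idPr; rewrite -memvE.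
have [C C0 hC] := dist_gt0 Ucp bU.
have coef_le c v : v \in U -> absp c <= abs (c *: b + v) / C.
  move=> vU; rewrite ler_pdivlMr // mulrC.
  have [->|c0] := eqVneq c 0; first by rewrite vabs0 // mulr0 vabs_ge0.
  have -> : c *: b + v = c *: (b + c^-1 *: v).
    by rewrite scalerDr scalerA mulfV // scale1r.
  rewrite vabsZ mulrC ler_wpM2l ?vabs_ge0 // hC // rpredZ //.
move=> x xU xcauchy.
have dec m : exists cv : F * K, cv.2 \in U /\ x m = cv.1 *: b + cv.2.
  have /memv_addP [y /vlineP [c ->] [v vU ->]] := xU m.
  by exists (c, v).
have {dec}[cv hcv] := choice dec.
pose c m := (cv m).1; pose w m := (cv m).2.
have xE m : x m = c m *: b + w m by case: (hcv m).
have wU m : w m \in U by case: (hcv m).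
have subE m n : x m - x n = (c m - c n) *: b + (w m - w n).
  by rewrite !xE scalerBl; ring.
have cc_le m n : absp (c m - c n) <= abs (x m - x n) / C.
  by rewrite subE coef_le // rpredB.
have [|c0 hc0] := absp_cp (u := c).
  move=> e e0; have [N hN] := xcauchy _ (mulr_gt0 e0 C0).
  exists N => m n Nm Nn; apply: le_lt_trans (cc_le m n) _.
  by rewrite ltr_pdivrMr // hN.
have [|w0 w0U hw0] := Ucp w wU.
  (* The first bound controls x_m - x_n, the second one the part along b. *)
  move=> e e0; pose e1 := Num.min e (e / (abs b + 1) * C).
  have b1 : 0 < abs b + 1 by rewrite ltr_pwDr ?vabs_ge0.
  have e10 : 0 < e1 by rewrite lt_min e0 mulr_gt0 // divr_gt0.
  have [N hN] := xcauchy _ e10; exists N => m n Nm Nn.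
  have h := hN m n Nm Nn; rewrite lt_min in h; case/andP: h => h1 h2.
  have -> : w m - w n = (x m - x n) - (c m - c n) *: b by rewrite subE; ring.
  apply: (@le_lt_trans _ _ (Num.max (abs (x m - x n)) (abs ((c m - c n) *: b)))).
    by apply: vabsB_le; rewrite // le_max lexx ?orbT.
  rewrite gt_max h1 vabsZ; apply: (@le_lt_trans _ _ (abs (x m - x n) / C * abs b)).
    by rewrite ler_wpM2r ?vabs_ge0.
  have h3 : abs (x m - x n) / C < e / (abs b + 1) by rewrite ltr_pdivrMr.
  apply: (@le_lt_trans _ _ (abs (x m - x n) / C * (abs b + 1))).
    rewrite ler_wpM2l ?lerDl // divr_ge0 ?vabs_ge0 //; exact: ltW.
  by rewrite -ltr_pdivlMr.
exists (c0 *: b + w0); first by rewrite memv_add // memvZ ?memv_line.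
apply/(tends_toP abs_na) => e e0.
have b1 : 0 < abs b + 1 by rewrite ltr_pwDr ?vabs_ge0.
have [N hN] := (tends_toP absp_na _ _).1 hc0 _ (divr_gt0 e0 b1).
have [M hM] := (tends_toP abs_na _ _).1 hw0 _ e0.
exists (maxn N M) => m hm.
have -> : x m - (c0 *: b + w0) = (c m - c0) *: b + (w m - w0).
  by rewrite xE scalerBl; ring.
apply: vabsD_le => //; last by apply: hM; lia.
rewrite vabsZ; apply: (@le_trans _ _ (e / (abs b + 1) * (abs b + 1))).
  by apply: ler_pM; rewrite ?vabs_ge0 ?lerDl //; apply: hN; lia.
by rewrite divfK // gt_eqF.
Qed.

Lemma finite_ext_complete : complete_field abs.
Proof.
have cX (X : seq K) : complete_in <<X>>%VS.
  elim: X => [|x X IH]; last by rewrite span_cons; apply: complete_in_addv.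
  move=> u hu _; exists 0; first exact: mem0v.
  apply/(tends_toP abs_na) => e e0; exists 0%N => m _.
  have := hu m; rewrite span_nil memv0 => /eqP ->.
  by rewrite subrr vabs0 // ltW.
move=> u cu; have [|l _ hl] := cX (vbasis fullv) u _ cu; last by exists l.
by move=> m; rewrite (span_basis (vbasisP fullv)) memvf.
Qed.

End FiniteExtension.

(** * Absolute values of integers and factorials, and arithmetic of Z_p *)

Section PadicField.
Context {R : realType} {F : fieldType} {abs : F -> R} {p : nat}.
Hypothesis p_prime : prime p.
Hypothesis abs_na : nonarch_absval abs.
Hypothesis abs_p : abs p%:R = p%:R^-1.

Let p_gt0 : 0 < p%:R :> R.
Proof. by rewrite ltr0n prime_gt0. Qed.

Let pV_ge0 : 0 <= p%:R^-1 :> R.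
Proof. by rewrite invr_ge0 ltW. Qed.

Let pV_lt1 : p%:R^-1 < 1 :> R.
Proof. by rewrite invf_lt1 // ltr1n prime_gt1. Qed.

Lemma vabs_pX N : abs (p%:R ^+ N) = p%:R ^- N.
Proof. by rewrite vabsX // abs_p exprVn. Qed.

(** In a Bezout relation a p - b m = 1, |m| < 1 would make both terms smaller than 1. *)
Lemma vabs_nat_coprime m : ~~ (p %| m)%N -> abs m%:R = 1.
Proof.
rewrite -prime_coprime // => /coprimeP -/(_ (prime_gt0 p_prime)) [[a b] /= h].
apply/eqP; rewrite eq_le vabs_nat_le1 //= leNgt; apply/negP => lt.
have /(congr1 abs) : (a * p)%N%:R - (b * m)%N%:R = 1 :> F.
  by rewrite -natrB ?h //; lia.
apply/eqP; rewrite vabs1 // lt_eqF //.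
apply: (@le_lt_trans _ _ (Num.max p%:R^-1 (abs m%:R))); last first.
  by rewrite gt_max pV_lt1 lt.
apply: vabsB_le => //; rewrite natrM vabsM // le_max.
  by rewrite abs_p -[X in _ <= X](mul1r) ler_wpM2r // vabs_nat_le1.
by rewrite -[X in _ || (_ <= X)](mul1r) ler_wpM2r ?vabs_nat_le1 ?vabs_ge0 ?orbT.
Qed.

Lemma vabs_nat m : (0 < m)%N -> abs m%:R = p%:R ^- logn p m.
Proof.
move=> m0; have [m' cop {1}->] := pfactor_coprime p_prime m0.
rewrite natrM natrX vabsM // vabs_pX vabs_nat_coprime ?mul1r //.
by rewrite -prime_coprime.
Qed.

Lemma natr_padic_neq0 m : (0 < m)%N -> m%:R != 0 :> F.
Proof.
move=> m0; rewrite -(vabs_eq0 abs_na) vabs_nat // invr_eq0 expf_eq0.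
by rewrite (gt_eqF p_gt0) andbF.
Qed.

Lemma p_neq0 : p%:R != 0 :> F.
Proof. exact/natr_padic_neq0/prime_gt0. Qed.

Lemma dvdn_of_vabs_le m N : abs m%:R <= p%:R ^- N -> (p ^ N %| m)%N.
Proof.
case: m => [|m]; first by rewrite dvdn0.
rewrite vabs_nat // lef_pV2 ?posrE ?exprn_gt0 // ler_eXn2l ?ltr1n ?prime_gt1 //.
by rewrite pfactor_dvdn.
Qed.

(* The copy of Z_p inside F. *)
Definition Zp_in (x : F) := forall N, exists m : nat,
  abs (x - m%:R) <= p%:R ^- N.

Lemma Zp_nat m : Zp_in m%:R.
Proof. by move=> N; exists m; rewrite subrr vabs0 // invr_ge0 exprn_ge0. Qed.

Lemma Zp0 : Zp_in 0. Proof. exact: (Zp_nat 0). Qed.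
Lemma Zp1 : Zp_in 1. Proof. exact: (Zp_nat 1). Qed.

Lemma Zp_le1 x : Zp_in x -> abs x <= 1.
Proof.
move=> /(_ 0%N) [m]; rewrite expr0 invr1 => h; rewrite -[x](subrK m%:R).
by apply: vabsD_le => //; apply: vabs_nat_le1.
Qed.

Lemma ZpD x y : Zp_in x -> Zp_in y -> Zp_in (x + y).
Proof.
move=> hx hy N; have [m hm] := hx N; have [n hn] := hy N; exists (m + n)%N.
by rewrite natrD opprD addrACA; apply: vabsD_le.
Qed.

Lemma ZpM x y : Zp_in x -> Zp_in y -> Zp_in (x * y).
Proof.
move=> hx hy N; have [m hm] := hx N; have [n hn] := hy N; exists (m * n)%N.
have -> : x * y - (m * n)%N%:R = x * (y - n%:R) + n%:R * (x - m%:R).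
  by rewrite natrM; ring.
have N0 : 0 <= p%:R ^- N :> R by rewrite invr_ge0 exprn_ge0.
apply: vabsD_le => //; rewrite vabsM // -[leRHS]mul1r;
  by apply: ler_pM; rewrite ?vabs_ge0 ?vabs_nat_le1 ?Zp_le1 //.
Qed.

Lemma ZpN x : Zp_in x -> Zp_in (- x).
Proof.
move=> hx N; have [m hm] := hx N; exists (m * (p ^ N - 1))%N.
have -> : - x - (m * (p ^ N - 1))%N%:R = - (x - m%:R) - m%:R * p%:R ^+ N.
  by rewrite natrM natrB ?natrX ?expn_gt0 ?prime_gt0 //; ring.
apply: vabsB_le => //; first by rewrite vabsN.
rewrite vabsM // vabs_pX -[leRHS]mul1r.
by rewrite ler_wpM2r ?vabs_nat_le1 // invr_ge0 exprn_ge0.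
Qed.

Lemma ZpB x y : Zp_in x -> Zp_in y -> Zp_in (x - y).
Proof. by move=> hx /ZpN; apply: ZpD. Qed.

Lemma Zp_sum (I : Type) (r : seq I) (P : pred I) f :
  (forall i, P i -> Zp_in (f i)) -> Zp_in (\sum_(i <- r | P i) f i).
Proof. by move=> h; elim/big_ind: _ => //; [exact: Zp0|exact: ZpD]. Qed.

Lemma ZpX x m : Zp_in x -> Zp_in (x ^+ m).
Proof.
move=> hx; elim: m => [|m IH]; first exact: Zp1.
by rewrite exprS; apply: ZpM.
Qed.

Lemma Zp_inv_nat b : ~~ (p %| b)%N -> Zp_in b%:R^-1.
Proof.
move=> pb N.
have b0 : (0 < b)%N by case: b pb; rewrite ?dvdn0.
have /coprimeP -/(_ b0) [[u v] /= h] : coprime b (p ^ N).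
  by rewrite coprime_sym coprimeXl // prime_coprime.
(* By the Bezout relation, u inverts b modulo p^N. *)
exists u.
have -> : b%:R^-1 - u%:R = - (v%:R * p%:R ^+ N) / b%:R :> F.
  have -> : - (v%:R * p%:R ^+ N) = 1 - u%:R * b%:R :> F.
    have ubE : (u * b = 1 + v * p ^ N)%N by lia.
    by rewrite -[u%:R * _]natrM ubE natrD natrM natrX; ring.
  by field; apply: natr_padic_neq0.
rewrite vabsM // vabsV // (vabs_nat_coprime pb) invr1 mulr1 vabsN //.
rewrite vabsM // vabs_pX -[leRHS]mul1r.
by rewrite ler_wpM2r ?vabs_nat_le1 // invr_ge0 exprn_ge0.
Qed.

Lemma Zp_ratio (a b : nat) : (0 < b)%N -> abs (a%:R / b%:R) <= 1 ->
  Zp_in (a%:R / b%:R).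
Proof.
move=> b0; have [b' cop bE] := pfactor_coprime p_prime b0.
set k := logn p b in bE.
have b'1 : ~~ (p %| b')%N by rewrite -prime_coprime.
rewrite vabsM // vabsV // (vabs_nat b0) invrK.
rewrite -ler_pdivlMr ?exprn_gt0 // div1r => /dvdn_of_vabs_le /dvdnP [a' ->].
have -> : (a' * p ^ k)%N%:R / b%:R = a'%:R * b'%:R^-1 :> F.
  rewrite bE !natrM natrX; field.
  rewrite expf_neq0 ?p_neq0 ?andbT //=; apply: natr_padic_neq0.
  by case: b' b'1 {cop bE}; rewrite ?dvdn0.
by apply: ZpM; [exact: Zp_nat|exact: Zp_inv_nat].
Qed.

Lemma Zp_div_pX x n : Zp_in x -> abs x <= p%:R ^- n -> Zp_in (x / p%:R ^+ n).
Proof.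
(* Division by p^n costs n digits of precision. *)
move=> hx xn N; have [m hm] := hx (N + n)%N.
have pn0 : 0 < p%:R ^- n :> R by rewrite invr_gt0 exprn_gt0.
have /dvdn_of_vabs_le /dvdnP [m' mE] : abs m%:R <= p%:R ^- n.
  rewrite -[m%:R](subKr x); apply: vabsB_le => //; apply: le_trans hm _.
  rewrite exprD invfM ger_pMl // invf_le1 ?exprn_gt0 //.
  by rewrite exprn_ege1 // ler1n prime_gt0.
exists m'; have -> : x / p%:R ^+ n - m'%:R = (x - m%:R) / p%:R ^+ n.
  by rewrite mE natrM natrX mulrBl mulfK // expf_neq0 // p_neq0.
rewrite vabsM // vabsV // vabs_pX invrK -ler_pdivlMr ?exprn_gt0 //.
by rewrite -invfM -exprD addnC addnC.
Qed.

Lemma vabs_subX_le x y m : abs x <= 1 -> abs y <= 1 ->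
  abs (x ^+ m - y ^+ m) <= abs (x - y).
Proof.
move=> hx hy; rewrite subrXX vabsM // -[leRHS]mulr1.
rewrite ler_wpM2l ?vabs_ge0 //; apply: vabs_sum_le => // i _.
by rewrite vabsM // !(vabsX abs_na) mulr_ile1 ?exprn_ge0 ?vabs_ge0 // exprn_ile1
  ?vabs_ge0 //.
Qed.

(** Fermat's little theorem passes to x from a natural number congruent to x modulo p. *)
Lemma Zp_fermat x : Zp_in x -> exists2 b, Zp_in b & x ^+ p = x + p%:R * b.
Proof.
move=> hx; have [m] := hx 1%N; rewrite expr1 => hm.
exists ((x ^+ p - x) / p%:R ^+ 1); last first.
  by rewrite expr1 mulrC divfK ?p_neq0 // addrC subrK.
apply: Zp_div_pX; first by apply: ZpB => //; apply: ZpX.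
rewrite expr1.
have -> : x ^+ p - x = (x ^+ p - m%:R ^+ p) + (m%:R ^+ p - m%:R) - (x - m%:R).
  by ring.
apply: vabsB_le => //; apply: vabsD_le => //.
  by apply: (le_trans _ hm); apply: vabs_subX_le; rewrite ?vabs_nat_le1 ?Zp_le1 //.
have le_m : (m <= m ^ p)%N.
  by case: (m) (prime_gt0 p_prime) => // m' p0; rewrite -{1}[m'.+1]expn1 leq_pexp2l.
rewrite -natrX -natrB //.
have /eqP := fermat_little m p_prime.
rewrite (eqn_mod_dvd _ le_m) => /dvdnP [q ->].
rewrite natrM vabsM // abs_p -[leRHS]mul1r.
by rewrite ler_wpM2r ?vabs_nat_le1 //.
Qed.

(** Legendre's recursion v(n!) = m + v(m!) with m = n %/ p: by strong induction (p - 1) v(n!) < (p -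
    1) m + m = p m <= n if m > 0, and v(n!) = 0 if n < p. *)
Lemma logn_fact_bound n : (0 < n)%N -> (p.-1 * logn p n`! < n)%N.
Proof.
have p1 := prime_gt1 p_prime.
elim/ltn_ind: n => n IH n0.
have [np|pn] := ltnP n p.
  suff -> : logn p n`! = 0%N by rewrite muln0.
  rewrite logn_fact // big_nat big1 // => k /andP [k1 _].
  by rewrite divn_small // (leq_trans np) // -{1}[p]expn1 leq_exp2l.
have q0 : (0 < n %/ p)%N by rewrite divn_gt0 ?prime_gt0.
have qn : (n %/ p < n)%N by rewrite ltn_Pdiv.
suff -> : logn p n`! = (n %/ p + logn p (n %/ p)`!)%N.
  have := IH _ qn q0; have := leq_trunc_div n p; nia.
rewrite !logn_fact // big_nat_recl // expn1; congr addn.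
rewrite (@big_cat_nat _ _ _ (n %/ p).+1 1 n) //=.
rewrite [X in (_ + X)%N]big_nat [X in (_ + X)%N]big1 ?addn0.
  by apply: eq_bigr => k _; rewrite expnS divnMA.
move=> k /andP [k1 _]; rewrite expnS divnMA divn_small //.
by apply: leq_trans k1 _; apply/ltnW/ltn_expl.
Qed.

(** Here [r] is p^(-1/(p-1)), the radius of convergence of exp, characterised by its power so that
    no real exponent enters. *)
Lemma vabs_fact_ge (r : R) m : 0 < r -> r <= 1 -> r ^+ p.-1 = p%:R^-1 ->
  r ^+ m <= abs m`!%:R.
Proof.
move=> r0 r1 rp; rewrite vabs_nat ?fact_gt0 // -exprVn -rp -exprM.
case: m => [|m]; first by rewrite fact0 logn1 muln0.
by rewrite ler_wiXn2l // ?ltW //; apply/ltnW/logn_fact_bound.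
Qed.

(** These are the coefficients of exp(pT) in positive degree; their divisibility by p is an input
    for Dwork's argument. *)
Lemma Zp_pX_fact m : (0 < m)%N ->
  exists2 b, Zp_in b & p%:R ^+ m / m`!%:R = p%:R * b :> F.
Proof.
case: m => // m _; exists (p%:R ^+ m / m.+1`!%:R); last by rewrite mulrA -exprS.
rewrite -natrX; apply: Zp_ratio; first exact: fact_gt0.
rewrite natrX vabsM // vabsV // vabs_pX vabs_nat ?fact_gt0 // invrK.
rewrite mulrC ler_pdivrMr ?exprn_gt0 // mul1r ler_eXn2l ?ltr1n ?prime_gt1 //.
have := logn_fact_bound (ltn0Sn m); have := prime_gt1 p_prime; nia.
Qed.

End PadicField.

(** * Formal exponentials and the Artin-Hasse series *)

Section ExpPartialSum.
Context {K : fieldType} {V : comAlgType K}.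
Hypothesis natr_neq0 : forall m, (0 < m)%N -> m%:R != 0 :> K.
Implicit Types x y : V.

(** Stated in any commutative algebra to serve twice: in polynomials for formal exponentials, in H
    for convergent ones. *)
Definition exp_psum (M : nat) x : V := \sum_(m < M) (m`!%:R^-1 : K) *: x ^+ m.

Definition exp_term x y (i j : nat) : V :=
  ((i`!%:R^-1 : K) * j`!%:R^-1) *: (x ^+ i * y ^+ j).

Lemma fact_scale_exprD x y m :
  (m`!%:R^-1 : K) *: (x + y) ^+ m = \sum_(i < m.+1) exp_term x y i (m - i).
Proof.
rewrite addrC exprDn scaler_sumr; apply: eq_bigr => i _.
rewrite /exp_term [y ^+ _ * _]mulrC -scaler_nat scalerA; congr (_ *: _).
have im : (i <= m)%N by rewrite -ltnS.
have f0 k : k`!%:R != 0 :> K by rewrite natr_neq0 // fact_gt0.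
rewrite -(bin_fact im) !natrM; field.
by rewrite !f0 natr_neq0 ?bin_gt0.
Qed.

Lemma exp_psum_add M x y :
  exp_psum M (x + y) = \sum_(i < M) \sum_(j < M - i) exp_term x y i j.
Proof.
elim: M => [|M IH]; first by rewrite /exp_psum !big_ord0.
rewrite {1}/exp_psum big_ord_recr /= -/(exp_psum M (x + y)) IH.
rewrite fact_scale_exprD.
have -> : \sum_(i < M.+1) \sum_(j < M.+1 - i) exp_term x y i j =
    \sum_(i < M.+1) (\sum_(j < M - i) exp_term x y i j + exp_term x y i (M - i)).
  apply: eq_bigr => i _; have iM : (i <= M)%N by rewrite -ltnS.
  by rewrite subSn // big_ord_recr.
by rewrite big_split /= [X in _ = X + _]big_ord_recr /= subnn big_ord0 addr0.
Qed.

(** The error consists of terms of total degree at least M: they do not reach the lower coefficients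
    of a formal product, and they are small in H. *)
Lemma exp_psumM M x y : exp_psum M x * exp_psum M y =
  exp_psum M (x + y) + \sum_(i < M) \sum_(M - i <= j < M) exp_term x y i j.
Proof.
rewrite exp_psum_add -big_split /= /exp_psum big_distrlr /=.
apply: eq_bigr => i _.
rewrite -(big_mkord xpredT (exp_term x y i)) -big_cat_nat ?leq_subr //=.
rewrite big_mkord; apply: eq_bigr => j _.
by rewrite /exp_term -scalerAl -scalerAr scalerA.
Qed.

End ExpPartialSum.

Section FormalExp.
Context {K : fieldType}.
Hypothesis natr_neq0 : forall m, (0 < m)%N -> m%:R != 0 :> K.
Implicit Types (P Q : {poly K}) (f g : nat -> K).

Lemma coefM_eq P P' Q Q' n :
  (forall j, (j <= n)%N -> P`_j = P'`_j) ->
  (forall j, (j <= n)%N -> Q`_j = Q'`_j) ->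
  forall j, (j <= n)%N -> (P * Q)`_j = (P' * Q')`_j.
Proof.
move=> hP hQ j jn; rewrite !coefM; apply: eq_bigr => i _.
by rewrite hP ?hQ //; have := ltn_ord i; lia.
Qed.

Lemma coefX_eq P Q n m : (forall j, (j <= n)%N -> P`_j = Q`_j) ->
  forall j, (j <= n)%N -> (P ^+ m)`_j = (Q ^+ m)`_j.
Proof.
move=> h; elim: m => [|m IH] //.
by rewrite !exprS; apply: coefM_eq.
Qed.

Lemma coefM_low P Q a b : (forall j, (j < a)%N -> P`_j = 0) ->
  (forall j, (j < b)%N -> Q`_j = 0) ->
  forall j, (j < a + b)%N -> (P * Q)`_j = 0.
Proof.
move=> hP hQ j jab; rewrite coefM big1 // => i _.
have [ia|ai] := ltnP i a; first by rewrite hP ?mul0r.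
by rewrite hQ ?mulr0 //; have := ltn_ord i; lia.
Qed.

Lemma coefX_low P m : P`_0 = 0 -> forall j, (j < m)%N -> (P ^+ m)`_j = 0.
Proof.
move=> P0; elim: m => [|m IH] // j jm; rewrite exprS.
by apply: (@coefM_low _ _ 1 m) => // -[].
Qed.

Definition trunc n f : {poly K} := \poly_(i < n.+1) f i.

Lemma coef_trunc n f j : (j <= n)%N -> (trunc n f)`_j = f j.
Proof. by rewrite coef_poly ltnS => ->. Qed.

(** As f has no constant term, P^m starts in degree at least m, so every M > j gives the same
    coefficient. *)
Lemma exp_coef_psum f P M j : f 0%N = 0 -> (forall i, (i <= j)%N -> P`_i = f i) ->
  (j < M)%N -> (exp_psum M P)`_j = exp_coef f j.
Proof.
move=> f0 hP jM; rewrite /exp_coef /exp_psum !coef_sum.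
rewrite -(big_mkord xpredT (fun m : nat => (m`!%:R^-1 *: P ^+ m)`_j)).
rewrite (@big_cat_nat _ _ _ j.+1) //= [X in _ + X]big_nat.
rewrite [X in _ + X]big1 ?addr0; last first.
  move=> m /andP [jm _]; rewrite coefZ coefX_low ?mulr0 //.
  by rewrite hP.
rewrite big_mkord; apply: eq_bigr => m _; rewrite !coefZ; congr (_ * _).
by apply: (@coefX_eq _ _ j) => // i ij; rewrite coef_trunc // hP.
Qed.

Lemma exp_coef_at0 f : exp_coef f 0 = 1.
Proof. by rewrite /exp_coef big_ord1 fact0 invr1 scale1r expr0 coef1. Qed.

Lemma exp_coef_at1 f : exp_coef f 1 = f 1%N.
Proof.
rewrite /exp_coef big_ord_recr big_ord1 /= expr0 expr1 coefD !coefZ coef1 mulr0.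
by rewrite add0r coef_poly /= factS fact0 muln1 invr1 mul1r.
Qed.

Lemma exp_coef_ext f g : f =1 g -> exp_coef f = exp_coef g.
Proof. by move=> /funext ->. Qed.

Lemma exp_coef_zero n : exp_coef (fun=> 0 : K) n = (n == 0%N)%:R.
Proof.
rewrite -(@exp_coef_psum _ 0 n.+1) //; last by move=> i _; rewrite coef0.
rewrite /exp_psum big_ord_recl big1 ?addr0.
  by rewrite /= fact0 invr1 scale1r expr0 coef1.
by move=> i _; rewrite /= expr0n /= scaler0.
Qed.

Lemma exp_coefD f g n : f 0%N = 0 -> g 0%N = 0 ->
  exp_coef (fun i => f i + g i) n =
  \sum_(i < n.+1) exp_coef f i * exp_coef g (n - i)%N.
Proof.
move=> f0 g0; set P := trunc n f; set Q := trunc n g.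
transitivity ((exp_psum n.+1 P * exp_psum n.+1 Q)`_n); last first.
  rewrite coefM; apply: eq_bigr => i _.
  congr (_ * _); apply: exp_coef_psum => //; try lia;
    move=> k ki; apply: coef_trunc; have := ltn_ord i; lia.
rewrite exp_psumM // coefD -(@exp_coef_psum _ (P + Q) n.+1) //.
- rewrite -[LHS]addr0; congr (_ + _); apply/esym.
  rewrite coef_sum big1 // => i _; rewrite coef_sum big_nat big1 // => j /andP [ij _].
  rewrite /exp_term coefZ (@coefM_low _ _ i j) ?mulr0 //; last by lia.
  + by apply: coefX_low; rewrite coef_trunc.
  + by apply: coefX_low; rewrite coef_trunc.
- by rewrite f0 g0 addr0.
- by move=> i ni; rewrite coefD !coef_trunc.
Qed.

Lemma exp_coef_natmul f m N n : f 0%N = 0 -> (n <= N)%N ->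
  exp_coef (fun i => m%:R * f i) n = (trunc N (exp_coef f) ^+ m)`_n.
Proof.
move=> f0; elim: m n => [|m IH] n nN.
  rewrite expr0 coef1 -exp_coef_zero; congr exp_coef.
  by apply/funext => i; rewrite mul0r.
have -> : (fun i => m.+1%:R * f i) = (fun i => f i + m%:R * f i).
  by apply/funext => i; rewrite -nat1r mulrDl mul1r.
rewrite exp_coefD // ?f0 ?mulr0 // exprS coefM; apply: eq_bigr => i _.
have := ltn_ord i => im.
by rewrite coef_trunc ?IH //; lia.
Qed.

Lemma exp_coef_dilate f c n : f 0%N = 0 ->
  exp_coef (fun i => f i * c ^+ i) n = exp_coef f n * c ^+ n.
Proof.
move=> f0; rewrite /exp_coef !coef_sum mulr_suml; apply: eq_bigr => m _.
rewrite !coefZ -mulrA; congr (_ * _).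
set Q := \poly_(i < n.+1) (f i * c ^+ i); rewrite -/(trunc n f).
suff H k j : (j <= n)%N -> (Q ^+ k)`_j = (trunc n f ^+ k)`_j * c ^+ j by apply: H.
elim: k j => [|k IH] j jn.
  by rewrite !expr0 !coef1; case: j jn => [|j] _ /=; rewrite ?expr0 ?mulr1 ?mul0r.
rewrite !exprS !coefM mulr_suml; apply: eq_bigr => i _.
have ij : (i <= j)%N by rewrite -ltnS.
rewrite IH; last by lia.
rewrite !coef_poly ltnS (leq_trans ij jn).
have -> : c ^+ j = c ^+ i * c ^+ (j - i) by rewrite -exprD subnKC.
by ring.
Qed.

(** The coefficients of f(T^d). *)
Definition expand (d : nat) f : nat -> K :=
  fun j => if (d %| j)%N then f (j %/ d)%N else 0.

Lemma exp_coef_expand d f n : (0 < d)%N -> f 0%N = 0 ->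
  exp_coef (expand d f) n = expand d (exp_coef f) n.
Proof.
move=> d0 f0; rewrite -(@exp_coef_psum _ (trunc n f \Po 'X^d) n.+1) //.
- have -> : exp_psum n.+1 (trunc n f \Po 'X^d) = exp_psum n.+1 (trunc n f) \Po 'X^d.
    rewrite /exp_psum raddf_sum /=; apply: eq_bigr => m _.
    by rewrite comp_polyZ rmorphXn.
  rewrite coef_comp_poly_Xn // /expand; case: ifP => // _.
  have ndn : (n %/ d <= n)%N by apply: leq_div.
  apply: exp_coef_psum => // i ind.
  by apply: coef_trunc; apply: leq_trans ind ndn.
- by rewrite /expand dvdn0 div0n.
- move=> i ni; rewrite coef_comp_poly_Xn // /expand; case: ifP => // _.
  by apply: coef_trunc; apply: leq_trans (leq_div _ _) ni.
Qed.

Lemma exp_coef_linear (c : K) n :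
  exp_coef (fun i => c * (i == 1%N)%:R) n = c ^+ n / n`!%:R.
Proof.
rewrite -(@exp_coef_psum _ (c *: 'X) n.+1) ?mulr0 //; last first.
  by move=> i _; rewrite coefZ coefX.
rewrite /exp_psum coef_sum (bigD1 ord_max) //= big1 ?addr0.
  by rewrite exprZn !coefZ coefXn eqxx mulr1 mulrC.
move=> i ni; rewrite exprZn !coefZ coefXn.
have -> : (n == i :> nat) = false.
  by apply/negbTE; apply: contra ni => /eqP ni; apply/eqP/val_inj.
by rewrite !mulr0.
Qed.

(** The right-hand side is a polynomial in z, which gives the continuity in z used by
    [exp_l_integral]. *)
Lemma exp_coef_scalar (z : K) f n :
  exp_coef (fun i => z * f i) n =
  \sum_(m < n.+1) z ^+ m * (m`!%:R^-1 * (trunc n f ^+ m)`_n).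
Proof.
rewrite /exp_coef coef_sum; apply: eq_bigr => m _.
have -> : \poly_(i < n.+1) (z * f i) = z *: trunc n f.
  by apply/polyP => i; rewrite coefZ !coef_poly; case: ifP; rewrite ?mulr0.
by rewrite exprZn !coefZ; ring.
Qed.

End FormalExp.

(** * Integrality of the Artin-Hasse exponential and of its p-adic powers *)

Section ArtinHasse.
Context {R : realType} {K : fieldType} {abs : K -> R} {p : nat}.
Hypothesis p_prime : prime p.
Hypothesis abs_na : nonarch_absval abs.
Hypothesis abs_p : abs p%:R = p%:R^-1.

Let natr_neq0 m : (0 < m)%N -> m%:R != 0 :> K.
Proof. exact: (natr_padic_neq0 p_prime abs_na abs_p). Qed.

Let p0 : p%:R != 0 :> K. Proof. exact/natr_neq0/prime_gt0. Qed.

Local Notation Zp := (Zp_in (abs := abs) (p := p)).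
Local Notation l := (@l_coef K p).
Local Notation a := (exp_coef l).

Lemma l_coef_pX k : l (p ^ k)%N = p%:R ^- k.
Proof.
have lt : (k < (p ^ k).+1)%N by rewrite ltnS ltnW // ltn_expl ?prime_gt1.
rewrite /l_coef (bigD1 (Ordinal lt)) //= big1 ?addr0 // => i /andP [/eqP pi].
case/negP; apply/eqP/val_inj => /=; apply/eqP.
by rewrite -(eqn_exp2l _ _ (prime_gt1 p_prime)) pi.
Qed.

Lemma l_coef_eq0 q : (forall k, (p ^ k)%N != q) -> l q = 0.
Proof. by move=> h; rewrite /l_coef big1 // => k /eqP pk; case/eqP: (h k). Qed.

Lemma l_coef_at0 : l 0%N = 0.
Proof. by apply: l_coef_eq0 => k; rewrite -lt0n expn_gt0 prime_gt0. Qed.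

(** The exponential of this functional equation is the identity a(T)^p = exp(pT) a(T^p) of Dwork's
    argument. *)
Lemma l_coef_frob q : p%:R * l q = p%:R * (q == 1%N)%:R + expand p l q.
Proof.
have [[k <-]|no] := pselect (exists k, (p ^ k)%N = q).
  rewrite l_coef_pX /expand; case: k => [|k].
    by rewrite expn0 eqxx dvdn1 gtn_eqF ?prime_gt1 // expr0 invr1 addr0.
  rewrite expnS dvdn_mulr // mulKn ?prime_gt0 // l_coef_pX.
  rewrite gtn_eqF; last first.
    apply: leq_trans (prime_gt1 p_prime) _.
    by rewrite leq_pmulr // expn_gt0 prime_gt0.
  by rewrite mulr0 add0r exprS invfM mulrA mulfV // mul1r.
have hno k : (p ^ k)%N != q by apply/eqP => h; apply: no; exists k.
rewrite l_coef_eq0 // mulr0; have := hno 0%N; rewrite expn0 eq_sym => /negPf ->.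
rewrite mulr0 add0r /expand; case: ifP => // /dvdnP [m qE].
rewrite l_coef_eq0 // => k; apply/eqP => h.
apply: no; exists k.+1; rewrite expnS h qE mulnK ?prime_gt0 // mulnC //.
Qed.

Local Notation Zpoly P := (forall i, Zp (P : {poly K})`_i).

Let ZpolyD P Q : Zpoly P -> Zpoly Q -> Zpoly (P + Q).
Proof. by move=> hP hQ i; rewrite coefD; apply: ZpD => //. Qed.

Let ZpolyM P Q : Zpoly P -> Zpoly Q -> Zpoly (P * Q).
Proof. by move=> hP hQ i; rewrite coefM; apply: Zp_sum => // j _; apply: ZpM => //. Qed.

Let Zpoly1 : Zpoly 1.
Proof. by move=> i; rewrite coef1; apply: (Zp_nat abs_na). Qed.

Let ZpolyX P m : Zpoly P -> Zpoly (P ^+ m).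
Proof. by move=> hP; elim: m => [|m IH]; rewrite ?exprS; [exact: Zpoly1|exact: ZpolyM]. Qed.

(** All binomial coefficients except the two extreme ones are divisible by p. *)
Let Zpoly_frobD P Q : Zpoly P -> Zpoly Q -> exists2 S, Zpoly S &
  (P + Q) ^+ p = P ^+ p + Q ^+ p + p%:R *: S.
Proof.
move=> hP hQ; have p1 := prime_gt1 p_prime.
exists (\sum_(1 <= i < p) (P ^+ (p - i) * Q ^+ i) *+ ('C(p, i) %/ p)).
  move=> i; rewrite coef_sum; apply: Zp_sum => // j _.
  by rewrite coefMn -mulr_natr; apply: ZpM => //; [apply: ZpolyM; apply: ZpolyX|apply: Zp_nat => //].
rewrite exprDn -(big_mkord xpredT (fun i => P ^+ (p - i) * Q ^+ i *+ 'C(p, i))).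
rewrite big_nat_recr //= big_ltn ?prime_gt0 //= subn0 subnn !expr0 bin0 binn.
rewrite mulr1 mul1r !mulr1n -!addrA; congr (_ + _); rewrite addrC; congr (_ + _).
rewrite scaler_sumr; apply: eq_big_nat => i /andP [i1 ip].
rewrite scaler_nat -mulrnA; congr (_ *+ _).
by rewrite divnK // prime_dvd_bin // i1.
Qed.

(** Raising to the p-th power is additive modulo p and fixes the coefficients modulo p, so P^p and
    P(T^p) agree modulo p. *)
Let Zpoly_frob n (b : nat -> K) : (forall i, (i < n)%N -> Zp (b i)) ->
  exists2 S, Zpoly S &
    (\poly_(i < n) b i) ^+ p = (\poly_(i < n) b i) \Po 'X^p + p%:R *: S.
Proof.
elim: n => [|n IH] hb.
  exists 0; first by move=> i; rewrite coef0; apply: Zp0.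
  rewrite poly_def big_ord0 comp_poly0 scaler0 addr0 expr0n.
  by rewrite gtn_eqF ?prime_gt0.
have [|S hS IE] := IH; first by move=> i ni; apply: hb; lia.
have E : \poly_(i < n.+1) b i = \poly_(i < n) b i + b n *: 'X^n.
  by rewrite !poly_def big_ord_recr.
have hP : Zpoly (\poly_(i < n) b i).
  by move=> i; rewrite coef_poly; case: ifP => h; [apply: hb; lia|apply: Zp0].
have hQ : Zpoly (b n *: 'X^n).
  move=> i; rewrite coefZ coefXn; apply: ZpM => //; first exact: hb.
  exact: (Zp_nat abs_na).
have [S' hS' SE] := Zpoly_frobD hP hQ.
have [c hc cE] := Zp_fermat p_prime abs_na abs_p (hb n (leqnn _)).
exists (S + S' + c *: 'X^(n * p)).
  apply: ZpolyD; first exact: ZpolyD.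
  move=> i; rewrite coefZ coefXn; apply: ZpM => //.
  exact: (Zp_nat abs_na).
rewrite E SE IE comp_polyD comp_polyZ comp_Xn_poly exprZn -!exprM cE.
rewrite [(p * n)%N]mulnC !scalerDr scalerDl scalerA.
by rewrite -!mul_polyC; ring.
Qed.

(* Dwork's argument: [a] satisfies [a(T)^p = a(T^p) exp(pT)], and comparing the
   coefficients of T^n modulo p shows that [p a_n] lies in [p Z_p]. *)
Theorem artin_hasse_integral n : Zp (a n).
Proof.
elim/ltn_ind: n => n IH.
have [->|n_gt0] := posnP n; first by rewrite exp_coef_at0; apply: Zp1.
have p_gt1 := prime_gt1 p_prime.
have qn : (n %/ p < n)%N by rewrite ltn_Pdiv.
set G := \poly_(i < n) a i.
have [S hS SE] := Zpoly_frob IH.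
have FE : trunc n a = G + a n *: 'X^n by rewrite /trunc /G !poly_def big_ord_recr.
have G0 : G`_0 = 1 by rewrite coef_poly n_gt0 exp_coef_at0.
have F0 : (trunc n a)`_0 = 1 by rewrite coef_trunc // exp_coef_at0.
have X0 (P : {poly K}) k : P`_0 = 1 -> (P ^+ k)`_0 = 1.
  move=> P0; elim: k => [|k IHk]; first by rewrite expr0 coef1.
  by rewrite exprS coefM big_ord1 /= P0 IHk mulr1.
(* With F = [trunc n a], factor F^p - G^p by F - G = a_n T^n; the cofactor has p summands, each with
   constant term 1. *)
have lhs : (trunc n a ^+ p)`_n = p%:R * a n + (G ^+ p)`_n.
  have /eqP := subrXX (trunc n a) G p; rewrite subr_eq => /eqP ->.
  rewrite coefD; congr (_ + _).
  rewrite {1}FE addrAC subrr add0r -scalerAl coefZ mulrC; congr (_ * _).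
  rewrite mulrC coefMXn ltnn subnn coef_sum.
  rewrite (eq_bigr (fun=> 1)); first by rewrite sumr_const card_ord.
  by move=> i _; rewrite coefM big_ord1 /= !X0 // mulr1.
have gE : (G ^+ p)`_n = expand p a n + p%:R * S`_n.
  rewrite SE coefD coefZ coef_comp_poly_Xn ?prime_gt0 //; congr (_ + _).
  by rewrite /expand; case: ifP => // _; rewrite coef_poly qn.
have rhs : (trunc n a ^+ p)`_n =
    \sum_(i < n.+1) p%:R ^+ i / i`!%:R * expand p a (n - i)%N.
  rewrite -(exp_coef_natmul natr_neq0) ?l_coef_at0 //.
  rewrite (exp_coef_ext l_coef_frob) exp_coefD //; last first.
  - by rewrite /expand dvdn0 div0n l_coef_at0.
  - by rewrite mulr0.
  apply: eq_bigr => i _; rewrite exp_coef_linear //; congr (_ * _).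
  by rewrite exp_coef_expand ?prime_gt0 ?l_coef_at0.
(* Except for i = 0, the terms of [rhs] are divisible by p and involve only a_j with j < n. *)
have [c hc cE] : exists2 c, Zp c & (trunc n a ^+ p)`_n = expand p a n + p%:R * c.
  have exb (i : nat) : exists b, Zp b /\
      p%:R ^+ i.+1 / i.+1`!%:R = p%:R * b :> K.
    by have [b hb bE] := Zp_pX_fact p_prime abs_na abs_p (ltn0Sn i); exists b.
  have [b hb] := choice exb.
  exists (\sum_(i < n) b i * expand p a (n - i.+1)%N).
    apply: Zp_sum => // i _; apply: ZpM => //; first exact: (hb i).1.
    rewrite /expand; case: ifP => _; last exact: Zp0.
    apply: IH; apply: leq_ltn_trans (leq_div _ _) _; have := ltn_ord i; lia.
  rewrite rhs big_ord_recl /= expr0 fact0 invr1 !mul1r subn0; congr (_ + _).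
  by rewrite mulr_sumr; apply: eq_bigr => i _; rewrite mulrA -(hb i).2.
(* The common term [expand p a n] cancels and leaves p a_n + p S_n = p c. *)
suff -> : a n = c - S`_n by apply: ZpB.
apply: (mulfI p0); rewrite mulrBr.
move: lhs; rewrite cE gE => /eqP; rewrite addrCA (inj_eq (addrI _)) => /eqP ->.
by rewrite addrK.
Qed.

(** By continuity z may be replaced by a natural number w close to it, for which the series is the
    w-th power of the integral Artin-Hasse series. *)
Theorem exp_l_integral z n : Zp z -> abs (exp_coef (fun i => z * l i) n) <= 1.
Proof.
move=> hz; pose c m := m`!%:R^-1 * (trunc n l ^+ m)`_n.
pose C := \sum_(m < n.+1) abs (c m).
have C0 : 0 <= C by apply: sumr_ge0 => m _; apply: vabs_ge0.
have p_gt0 : 0 < p%:R :> R by rewrite ltr0n prime_gt0.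
(* The precision p^-N absorbs the sizes of the coefficients of the polynomial in z. *)
pose N := Num.bound C.
have CN : C <= p%:R ^+ N.
  apply: le_trans (ltW (archi_boundP C0)) _.
  by rewrite -natrX ler_nat ltnW // ltn_expl // prime_gt1.
have [w hw] := hz N.
rewrite -[exp_coef _ n](subrK (exp_coef (fun i => w%:R * l i) n)).
apply: vabsD_le => //; last first.
  rewrite (@exp_coef_natmul _ natr_neq0 l w n) ?l_coef_at0 //.
  apply: Zp_le1 => //.
  have : Zpoly (trunc n (exp_coef l) ^+ w); last exact.
  apply: ZpolyX => i; rewrite coef_poly; case: ifP => _; last exact: Zp0.
  exact: artin_hasse_integral.
rewrite !exp_coef_scalar -sumrB; apply: vabs_sum_le => // m _.
rewrite -mulrBl vabsM // -/(c m).
apply: (@le_trans _ _ (p%:R ^- N * p%:R ^+ N)).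
  apply: ler_pM; rewrite ?vabs_ge0 //.
    apply: le_trans _ hw; apply: vabs_subX_le => //; first exact: Zp_le1 hz.
    exact: vabs_nat_le1.
  apply: le_trans _ CN; rewrite /C (bigD1 m) //= lerDl.
  by apply: sumr_ge0 => i _; apply: vabs_ge0.
by rewrite mulVf // expf_neq0 // gt_eqF.
Qed.

End ArtinHasse.

(** * Exponentials in H and the group Gamma *)

Lemma exprn_small (R : realType) (rho eps : R) : 0 <= rho -> rho < 1 -> 0 < eps ->
  exists N, forall m, (N <= m)%N -> rho ^+ m <= eps.
Proof.
move=> r0 r1 e0; have /cvg_expr : `|rho| < 1 by rewrite ger0_norm.
move=> /cvgr0Pnorm_le /(_ _ e0) [N _ hN]; exists N => m Nm.
by have := hN m Nm; rewrite /= ger0_norm // exprn_ge0.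
Qed.

Section HringMore.
Context {R : realType} {K : fieldType} {abs : K -> R}.
Variables (abs_na : nonarch_absval abs) (abs_cp : complete_field abs).

Local Notation H := (Hring abs_na abs_cp).
Implicit Types x y z : H.

Definition powser (f : nat -> K) : biseries K :=
  fun j => if j is Posz n then f n else 0.

Lemma powser_neg f (j : int) : j < 0 -> powser f j = 0.
Proof. by case: j. Qed.

Lemma smul_powser f g : smul abs (powser f) (powser g) =
  powser (fun n => \sum_(i < n.+1) f i * g (n - i)%N).
Proof.
apply/funext => -[n|n]; rewrite smulE; last first.
  rewrite (@zsum_finite _ _ _ abs_na abs_cp _ [::]) ?big_nil // => i _.
  have [i0|i0] := lerP 0 i; last by rewrite powser_neg ?mul0r.
  by rewrite [X in _ * X]powser_neg ?mulr0 //; lia.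
rewrite (@zsum_finite _ _ _ abs_na abs_cp _ [seq Posz i | i <- iota 0 n.+1]).
- rewrite big_map -[iota 0 n.+1]/(index_iota 0 n.+1) big_mkord /=.
  by apply: eq_bigr => i _; rewrite subzn // -ltnS.
- by rewrite map_inj_uniq ?iota_uniq // => i j [].
- case=> k hk; last by rewrite mul0r.
  rewrite [X in _ * X]powser_neg ?mulr0 // subr_lt0 ltz_nat.
  rewrite ltnNge; apply/negP => kn; case/negP: hk; apply/mapP; exists k => //.
  by rewrite mem_iota /=; lia.
Qed.

Lemma Hset_powser f (rho : R) : 0 <= rho -> rho < 1 ->
  (forall n, abs (f n) <= rho ^+ n) -> Hset abs (powser f).
Proof.
move=> r0 r1 h; apply/HsetP => //; split.
  exists 1 => -[n|n]; last by rewrite /= vabs0.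
  by apply: le_trans (h n) _; rewrite exprn_ile1 // ltW.
move=> e e0; have [N hN] := exprn_small r0 r1 e0.
by exists N => -[n|n] // Nn; apply: le_trans (h n) (hN _ Nn).
Qed.

Definition supp_le (m : int) x := forall j : int, m < j -> x j = 0.

Lemma supp_leM a b x y : supp_le a x -> supp_le b y -> supp_le (a + b) (x * y).
Proof.
move=> hx hy n hn; rewrite hvalM smulE.
rewrite (@zsum_finite _ _ _ abs_na abs_cp _ [::]) ?big_nil // => i _.
have [ia|ia] := ltrP a i; first by rewrite hx ?mul0r.
by rewrite hy ?mulr0 //; lia.
Qed.

Lemma supp_le1 : supp_le 0 1.
Proof. by move=> j j0; rewrite hval1 gt_eqF. Qed.

Lemma supp_leX x m : supp_le (-1) x -> supp_le (- m%:Z) (x ^+ m).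
Proof.
move=> hx; elim: m => [|m IH]; first by rewrite oppr0 expr0; apply: supp_le1.
have -> : - m.+1%:Z = -1 + - m%:Z by lia.
by rewrite exprS; apply: supp_leM.
Qed.

End HringMore.

Section HringExp.
Context {R : realType} {K : fieldType} {abs : K -> R} {p : nat}.
Hypothesis p_prime : prime p.
Variables (abs_na : nonarch_absval abs) (abs_cp : complete_field abs).
Hypothesis abs_p : abs p%:R = p%:R^-1.
Variable r : R.
Hypothesis r_gt0 : 0 < r.
Hypothesis r_le1 : r <= 1.
Hypothesis r_pow : r ^+ p.-1 = p%:R^-1.

Local Notation H := (Hring abs_na abs_cp).
Implicit Types x y z : H.

Let q : R := p%:R^-1.

Let q_ge0 : 0 <= q. Proof. by rewrite invr_ge0. Qed.

Let q_lt1 : q < 1.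
Proof. by rewrite invf_lt1 ?ltr0n ?ltr1n ?prime_gt0 ?prime_gt1. Qed.

Let natr_neq0 m : (0 < m)%N -> m%:R != 0 :> K.
Proof. exact: (natr_padic_neq0 p_prime abs_na abs_p). Qed.

(** A disc smaller by the factor |p| than the disc of convergence: on it the m-th term of the
    exponential is at most p^-m, uniformly in x. *)
Definition exp_domain x := hbd x (p%:R^-1 * r).

Lemma fact_pow_le m C : 0 <= C ->
  (abs m`!%:R)^-1 * (C * r) ^+ m <= C ^+ m.
Proof.
move=> C0; have f0 : 0 < abs m`!%:R by rewrite vabs_gt0 // natr_neq0 ?fact_gt0.
rewrite mulrC ler_pdivrMr // exprMn ler_wpM2l ?exprn_ge0 //.
exact: (vabs_fact_ge p_prime).
Qed.

Lemma exp_term1_bd x m : exp_domain x ->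
  hbd ((m`!%:R^-1 : K) *: x ^+ m) (q ^+ m).
Proof.
move=> hx; apply: (hbd_le (fact_pow_le m q_ge0)).
by rewrite -vabsV //; apply: hbdZ; apply: hbdX.
Qed.

Definition Hexp x : H := xget 0 [set S | hcvg (fun M => exp_psum M x) S].

Lemma HexpP x : exp_domain x -> hcvg (fun M => exp_psum M x) (Hexp x).
Proof.
move=> hx; have [|S hS] := @hseries_cvg _ _ _ abs_na abs_cp
    (fun m => (m`!%:R^-1 : K) *: x ^+ m).
  move=> e e0; have [N hN] := exprn_small q_ge0 q_lt1 e0.
  by exists N => m Nm; apply: (hbd_le (hN m Nm)); apply: exp_term1_bd.
exact: (@xgetPex _ 0 [set S | hcvg (fun M => exp_psum M x) S] (ex_intro _ S hS)).
Qed.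

Lemma exp_psum_bd x M : exp_domain x -> hbd (exp_psum M x) 1.
Proof.
move=> hx; apply: hbd_sum => // m _.
apply: (hbd_le _ (exp_term1_bd m hx)).
by rewrite exprn_ile1 // ltW.
Qed.

Lemma Hexp_bd x : exp_domain x -> hbd (Hexp x) 1.
Proof.
by move=> hx; apply: (hcvg_bd _ (HexpP hx)) => // m; apply: exp_psum_bd.
Qed.

Lemma exp_domainD x y : exp_domain x -> exp_domain y -> exp_domain (x + y).
Proof. exact: hbdD. Qed.

Lemma exp_domainN x : exp_domain x -> exp_domain (- x).
Proof. exact: hbdN. Qed.

Lemma HexpD x y : exp_domain x -> exp_domain y ->
  Hexp (x + y) = Hexp x * Hexp y.
Proof.
move=> hx hy; apply: (hcvg_unique (HexpP (exp_domainD hx hy))).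
apply: hcvg_ext (hcvgM (HexpP hx) (HexpP hy)) => e e0.
have [N hN] := exprn_small q_ge0 q_lt1 e0; exists N => M NM.
rewrite exp_psumM // addrAC subrr add0r; apply: (hbd_le (hN M NM)).
apply: hbd_sum; first by rewrite exprn_ge0.
move=> i _; rewrite big_nat; apply: hbd_sum; first by rewrite exprn_ge0.
move=> j /andP [Mij _].
have -> : exp_term x y i j =
    ((i`!%:R^-1 : K) *: x ^+ i) * ((j`!%:R^-1 : K) *: y ^+ j).
  by rewrite /exp_term -scalerAl -scalerAr scalerA.
apply: hbd_le (hbdM (exp_term1_bd i hx) (exp_term1_bd j hy)).
by rewrite -exprD ler_wiXn2l ?(ltW q_lt1) //; lia.
Qed.

Lemma Hexp0 : Hexp 0 = 1.
Proof.
have d0 : exp_domain 0 by apply: hbd0; rewrite mulr_ge0 // ltW.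
apply: (hcvg_unique (HexpP d0)) => e e0; exists 1%N => -[//|M] _.
rewrite /exp_psum big_ord_recl /= fact0 invr1 scale1r expr0 opprD addNKr.
apply: hbdN; apply: hbd_sum => [|i _]; first exact: ltW.
by rewrite expr0n /= scaler0; apply: hbd0; apply: ltW.
Qed.

Lemma HexpNr x : exp_domain x -> Hexp x * Hexp (- x) = 1.
Proof.
by move=> hx; rewrite -HexpD ?subrr ?Hexp0 //; apply: exp_domainN.
Qed.

Lemma Hexp_supp x j : exp_domain x -> supp_le (-1) x -> 0 <= j ->
  Hexp x j = (j == 0)%:R.
Proof.
move=> hx sx j0; apply: (@hcvg_coef _ _ _ _ _ _ _ _ _ 1%N (HexpP hx)) => -[//|M] _.
rewrite /exp_psum hval_sum big_ord_recl big1 ?addr0.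
  by rewrite hvalZ fact0 invr1 mul1r expr0 hval1.
move=> i _; rewrite hvalZ (@supp_leX _ _ _ abs_na abs_cp) ?mulr0 //.
by rewrite lift0; lia.
Qed.

Lemma hval_powserX x f m : hval x = powser f ->
  hval (x ^+ m) = powser (fun n => (trunc n f ^+ m)`_n).
Proof.
move=> xE; elim: m => [|m IH].
  apply/funext => -[n|n]; rewrite expr0 hval1 //= coef1.
  by rewrite eqz_nat.
rewrite exprS hvalM IH xE smul_powser //; congr powser.
apply/funext => n; rewrite exprS coefM; apply: eq_bigr => i _.
have ni : (i <= n)%N by rewrite -ltnS.
rewrite coef_trunc //; congr (_ * _).
apply: (@coefX_eq _ _ _ (n - i)) => // j jn; rewrite !coef_trunc //.
by apply: leq_trans jn (leq_subr _ _).
Qed.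

(** Coefficient n of the partial sums is constant from n + 1 terms on, so the limit in H has the
    formal coefficients. *)
Lemma Hexp_powser x f : exp_domain x -> f 0%N = 0 -> hval x = powser f ->
  hval (Hexp x) = powser (exp_coef f).
Proof.
move=> hx f0 xE; apply/funext => j.
pose N := if j is Posz n then n.+1 else 1%N.
apply: (@hcvg_coef _ _ _ _ _ _ _ _ _ N (HexpP hx)) => M.
rewrite /N {N} /exp_psum hval_sum; case: j => n NM.
  rewrite -[RHS]/(exp_coef f n) -(@exp_coef_psum _ f (trunc n f) M) // /exp_psum ?coef_sum.
    by apply: eq_bigr => m _; rewrite hvalZ (hval_powserX m xE) coefZ.
  by move=> i ni; rewrite coef_trunc.
by rewrite big1 // => m _; rewrite hvalZ (hval_powserX m xE) mulr0.
Qed.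

End HringExp.

(** * Gamma, the kernel of its map to Gamma_A, and cosets, in terms of elements of H *)

Section GammaGroup.
Context {R : realType} {K : fieldType} {abs : K -> R}.
Variables (abs_na : nonarch_absval abs) (abs_cp : complete_field abs).
Variable A : set (biseries K).
Hypothesis A_subalg : subalgebra abs A.
Hypothesis A_Hset : A `<=` Hset abs.

Local Notation H := (Hring abs_na abs_cp).
Implicit Types x y z h k u w : H.

Definition approx_in x := forall eps, 0 < eps ->
  exists2 a : H, A (hval a) & hbd (x - a) eps.

Lemma AanP x : Aan abs A (hval x) <-> approx_in x.
Proof.
split=> [[_ h] e e0|h].
  have [a Aa lt] := h e e0.
  by exists (MkH abs_na abs_cp (A_Hset Aa)) => //; apply: gauss_norm_lt.
split=> [|e e0]; first exact: hvalP.
have e2 : 0 < e / 2 by rewrite divr_gt0.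
have [a Aa ha] := h _ e2; exists (hval a) => //.
apply: (@le_lt_trans _ _ (e / 2)); last by lra.
exact: (gauss_norm_le ha).
Qed.

Lemma approx_in1 : approx_in 1.
Proof.
move=> e e0; exists 1; first by case: A_subalg.
by rewrite subrr; apply: hbd0; apply: ltW.
Qed.

Lemma approx_in_of_A x : A (hval x) -> approx_in x.
Proof.
by move=> Ax e e0; exists x => //; rewrite subrr; apply: hbd0; apply: ltW.
Qed.

Lemma approx_inD x y : approx_in x -> approx_in y -> approx_in (x + y).
Proof.
move=> hx hy e e0; have [a Aa ha] := hx e e0; have [b Ab hb] := hy e e0.
exists (a + b); first by case: A_subalg => _ _ h _ _; apply: h.
by rewrite opprD addrACA; apply: hbdD.
Qed.

Lemma approx_inZ c x : approx_in x -> approx_in (c *: x).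
Proof.
move=> hx e e0; have c0 : 0 < abs c + 1 by rewrite ltr_pwDr ?vabs_ge0.
have [a Aa ha] := hx _ (divr_gt0 e0 c0).
exists (c *: a); first by case: A_subalg => _ _ _ h _; apply: h.
rewrite -scalerBr; apply: hbd_le (hbdZ c ha).
by rewrite mulrCA ger_pMr // ler_pdivrMr // mul1r lerDl.
Qed.

Lemma approx_in_hcvg (f : nat -> H) S : hcvg f S -> (forall m, approx_in (f m)) ->
  approx_in S.
Proof.
move=> h hf e e0; have [N hN] := h _ e0; have [a Aa ha] := hf N _ e0.
exists a => //; rewrite -(subrKA (f N)); apply: hbdD => //; exact: hN.
Qed.

Lemma approx_in_sum (I : Type) (s : seq I) (P : pred I) (f : I -> H) :
  (forall i, P i -> approx_in (f i)) -> approx_in (\sum_(i <- s | P i) f i).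
Proof.
move=> h; elim/big_ind: _ => //; last exact: approx_inD.
by rewrite -(scale0r 1); apply: approx_inZ; apply: approx_in1.
Qed.

Lemma approx_inM x y : approx_in x -> approx_in y -> approx_in (x * y).
Proof.
move=> hx hy e e0.
have [C C1 hC] := hbd_exists x; have C0 : 0 < C by apply: lt_le_trans ltr01 C1.
have [b Ab hb] := hy _ (divr_gt0 e0 C0).
have [D D1 hD] := hbd_exists b; have D0 : 0 < D by apply: lt_le_trans ltr01 D1.
have [a Aa ha] := hx _ (divr_gt0 e0 D0).
exists (a * b); first by case: A_subalg => _ _ _ _ h; apply: h.
have -> : x * y - a * b = x * (y - b) + (x - a) * b by ring.
apply: hbdD.
  apply: hbd_le (hbdM hC hb); by rewrite mulrC divfK // gt_eqF.
by apply: hbd_le (hbdM ha hD); rewrite divfK // gt_eqF.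
Qed.

Lemma approx_inX x m : approx_in x -> approx_in (x ^+ m).
Proof.
move=> hx; elim: m => [|m IH]; first exact: approx_in1.
by rewrite exprS; apply: approx_inM.
Qed.

Lemma approx_in_exp_psum x M : approx_in x -> approx_in (exp_psum M x).
Proof.
by move=> hx; apply: approx_in_sum => m _; apply: approx_inZ; apply: approx_inX.
Qed.

Definition approx_unit u := approx_in u /\ exists2 v, approx_in v & u * v = 1.

Lemma approx_unitP u : unit_group abs (Aan abs A) (hval u) <-> approx_unit u.
Proof.
split=> [[/AanP hu [b hb ub]]|[hu [v hv uv]]].
  split=> //; exists (MkH abs_na abs_cp hb.1); first exact/AanP.
  exact: hval_inj.
split; first exact/AanP.
exists (hval v); first exact/AanP.
by rewrite -hvalM uv.
Qed.

Lemma approx_unitM u w : approx_unit u -> approx_unit w -> approx_unit (u * w).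
Proof.
move=> [hu [u' hu' uu']] [hw [w' hw' ww']]; split; first exact: approx_inM.
exists (u' * w'); first exact: approx_inM.
by rewrite mulrACA uu' ww' mulr1.
Qed.

Definition gam (rho : R) x := [/\ exists y, x * y = 1, hbd x 1, abs (x 0) = 1 &
  forall i : nat, (0 < i)%N -> abs (x i%:Z) <= rho ^+ i].

Lemma gamP rho x : Gamma_rho abs rho (hval x) <-> gam rho x.
Proof.
split=> [[[_ [b hb xb]] g0 x0 h]|[[y xy] hx x0 h]].
  split=> //; first by exists (MkH abs_na abs_cp hb); apply: hval_inj.
  move=> j; rewrite -x0 -g0; apply: ub_le_sup; last by exists j.
  by have [C _ hC] := hval_bounded x; exists C => _ [i _ <-].
split=> //; last first.
  apply/eqP; rewrite eq_le; apply/andP; split.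
    by rewrite x0; apply: gauss_norm_le.
  apply: ub_le_sup; last by exists 0.
  by exists 1 => _ [i _ <-].
split; first exact: hvalP.
by exists (hval y); [exact: hvalP | rewrite -hvalM xy].
Qed.

Lemma gam1 rho : 0 <= rho -> gam rho 1.
Proof.
move=> r0; split; first by exists 1; rewrite mulr1.
- exact: hbd1.
- by rewrite hval1 eqxx vabs1.
by move=> i i0; rewrite hval1 eqz_nat gtn_eqF // vabs0 // exprn_ge0.
Qed.

Lemma gam_le rho tau x : 0 <= rho -> rho <= tau -> gam rho x -> gam tau x.
Proof.
move=> r0 rt [h1 h2 h3 h4]; split=> // i i0; apply: le_trans (h4 i i0) _.
by rewrite ler_pXn2r ?nnegrE // (le_trans r0).
Qed.

(** In degree n > 0, either both indices are positive and the two bounds multiply to rho^n, or the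
    only positive index is at least n. In degree 0 the product x_0 y_0 dominates. *)
Lemma gamM rho x y : 0 <= rho -> rho < 1 -> gam rho x -> gam rho y ->
  gam rho (x * y).
Proof.
move=> r0 r1 [[x' xx'] bx x0 hx] [[y' yy'] By y0 hy].
(* The exponent 1 for n = 0 covers the terms other than x_0 y_0. *)
have le_term (n i : int) : 0 <= n -> (0 < i \/ 0 < n - i) ->
    abs (x i * y (n - i)) <= rho ^+ (maxn 1 `|n|).
  move=> n0 hi; rewrite vabsM //.
  have pow_le (j : int) : (maxn 1 `|n| <= `|j|)%N ->
      rho ^+ `|j| <= rho ^+ (maxn 1 `|n|).
    by move=> jn; rewrite ler_wiXn2l // ltW.
  have hx' (j : int) : 0 < j -> abs (x j) <= rho ^+ `|j|.
    by case: j => // j j0; apply: hx.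
  have hy' (j : int) : 0 < j -> abs (y j) <= rho ^+ `|j|.
    by case: j => // j j0; apply: hy.
  have [i0|i0] := lerP i 0.
    rewrite -[leRHS]mul1r; apply: ler_pM; rewrite ?vabs_ge0 //.
    by apply: le_trans (hy' _ _) (pow_le _ _); lia.
  have [ni|ni] := lerP (n - i) 0.
    rewrite -[leRHS]mulr1; apply: ler_pM; rewrite ?vabs_ge0 //.
    by apply: le_trans (hx' _ _) (pow_le _ _); lia.
  apply: (@le_trans _ _ (rho ^+ `|i| * rho ^+ `|(n - i)%R|)).
    by apply: ler_pM; rewrite ?vabs_ge0 ?hx' ?hy'.
  by rewrite -exprD ler_wiXn2l ?(ltW r1) //; lia.
split.
- by exists (x' * y'); rewrite mulrACA xx' yy' mulr1.
- by rewrite -[1]mulr1; apply: hbdM.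
- have := @zsum_approx _ _ _ abs_na abs_cp (fun i => x i * y (0 - i)) [:: 0] rho.
  rewrite big_seq1 subr0 => /(_ (conv_vanishing x y 0) r0 isT) h.
  have xy0 : abs (x 0 * y 0) = 1 by rewrite vabsM // x0 y0 mulr1.
  rewrite hvalM smulE -[zsum _](subrK (x 0 * y 0)) addrC vabsD_eq // xy0.
  apply: le_lt_trans (h _) r1 => i; rewrite inE => i0.
  rewrite -[rho]expr1; apply: (le_term 0) => //.
  by case: (ltrgtP i 0) i0 => // hi _; [right; rewrite sub0r oppr_gt0|left].
move=> n n0; rewrite hvalM smulE; apply: zsum_le => //.
- exact: conv_vanishing.
- exact: exprn_ge0.
have {2}-> : n = maxn 1 `|n%:Z| by lia.
by move=> i; apply: le_term => //; lia.
Qed.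

Definition gamma x := exists rho, [/\ 0 <= rho, rho < 1 & gam rho x].

Lemma gammaP x : Gamma abs (hval x) <-> gamma x.
Proof. by split=> -[rho [r0 r1 /gamP h]]; exists rho; split=> //; apply/gamP. Qed.

Lemma gammaM x y : gamma x -> gamma y -> gamma (x * y).
Proof.
move=> [rho [r0 r1 hx]] [tau [t0 t1 hy]]; exists (Num.max rho tau).
have m1 : Num.max rho tau < 1 by rewrite gt_max r1.
have m0 : 0 <= Num.max rho tau by rewrite le_max r0.
split=> //; apply: gamM => //.
  by apply: gam_le hx; rewrite // le_max lexx.
by apply: gam_le hy; rewrite // le_max lexx orbT.
Qed.

Lemma gamma1 : gamma 1.
Proof. by exists 0; split=> //; apply: gam1. Qed.

Lemma gamma_of_gam0 w : gam 0 w -> gamma w.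
Proof. by exists 0; split. Qed.

Definition gker x := exists u w,
  [/\ approx_unit u, gamma u, gam 0 w & x = u * w].

Lemma gker1 : gker 1.
Proof.
exists 1, 1; split; [|exact: gamma1|exact: gam1|by rewrite mulr1].
by split; [|exists 1; rewrite ?mulr1 //]; apply: approx_in1.
Qed.

Lemma gkerM x y : gker x -> gker y -> gker (x * y).
Proof.
move=> [u [w [u1 u2 w1 ->]]] [u' [w' [u1' u2' w1' ->]]].
exists (u * u'), (w * w'); split; last by rewrite mulrACA.
- exact: approx_unitM.
- exact: gammaM.
- exact: gamM.
Qed.

Lemma Gamma_kerP (f : biseries K) : Gamma_ker abs A f <->
  exists2 x : H, gker x & f = hval x.
Proof.
split=> [[a [b [[ua ga] gb ->]]]|[x [u [w [hu gu gw ->]]] ->]].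
  have Ha : Hset abs a by case: ua => -[].
  have Hb : Hset abs b by case: gb => -[].
  exists (MkH abs_na abs_cp Ha * MkH abs_na abs_cp Hb) => //.
  exists (MkH abs_na abs_cp Ha), (MkH abs_na abs_cp Hb); split=> //.
  - exact/approx_unitP.
  - exact/gammaP.
  - exact/gamP.
exists (hval u), (hval w); split=> //; last exact/gamP.
by split; [exact/approx_unitP|exact/gammaP].
Qed.

Lemma coset_classP h (f : biseries K) : coset_class abs A (hval h) f <->
  exists2 x : H, gker x & f = hval (h * x).
Proof.
split=> [[u /Gamma_kerP [x kx ->] ->]|[x kx ->]]; first by exists x.
by exists (hval x) => //; apply/Gamma_kerP; exists x.
Qed.

Lemma coset_class1 : coset_class abs A (hval (1 : H)) = Gamma_ker abs A.
Proof.
apply/funext => f; apply/propext; split.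
  by move=> /coset_classP [x kx ->]; rewrite mul1r; apply/Gamma_kerP; exists x.
by move=> /Gamma_kerP [x kx ->]; apply/coset_classP; exists x; rewrite ?mul1r.
Qed.

Lemma coset_pow_class h m : coset_pow abs A (coset_class abs A (hval h)) m =
  coset_class abs A (hval (h ^+ m)).
Proof.
elim: m => [|m IH]; first by rewrite expr0 coset_class1.
rewrite /coset_pow iterS -/(coset_pow abs A _ m) IH.
apply/funext => f; apply/propext; split.
  move=> [a [b [/coset_classP [x kx ->] /coset_classP [y ky ->] ->]]].
  apply/coset_classP; exists (x * y); first exact: gkerM.
  by rewrite -hvalM exprS mulrACA.
move=> /coset_classP [x kx ->].
exists (hval h), (hval (h ^+ m * x)); split.
- by apply/coset_classP; exists 1; rewrite ?mulr1 //; apply: gker1.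
- by apply/coset_classP; exists x.
- by rewrite -hvalM exprS mulrA.
Qed.

(** The inverse k' gives the reverse inclusion; in the application k and k' are h_(p^n w) and
    h_(-p^n w). *)
Lemma coset_class_mul h k k' : gker k -> gker k' -> k * k' = 1 ->
  coset_class abs A (hval (h * k)) = coset_class abs A (hval h).
Proof.
move=> hk hk' kk'; apply/funext => f; apply/propext; split.
  move=> /coset_classP [x kx ->]; apply/coset_classP; exists (k * x).
    exact: gkerM.
  by rewrite mulrA.
move=> /coset_classP [x kx ->]; apply/coset_classP; exists (k' * x).
  exact: gkerM.
by rewrite -mulrA (mulrA k) kk' mul1r.
Qed.

Lemma coset_class_self h : coset_class abs A (hval h) (hval h).
Proof. by apply/coset_classP; exists 1; rewrite ?mulr1 //; apply: gker1. Qed.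

Section Twist.
Variable z : K.
Hypothesis z_abs : abs z = 1.
Hypothesis A_twist : forall a, A a -> A (twist z a).

Lemma vabs_twist (a : biseries K) j : abs (twist z a j) = abs (a j).
Proof. by rewrite /twist vabsM // vabs_expz // mulr1. Qed.

Lemma Hset_twist x : Hset abs (twist z (hval x)).
Proof.
apply/HsetP => //; have [C _ hC] := hval_bounded x.
split; first by exists C => j; rewrite vabs_twist.
move=> e e0; have [N hN] := hval_small x e0.
by exists N => j Nj; rewrite vabs_twist hN.
Qed.

Definition htwist x : H := MkH abs_na abs_cp (Hset_twist x).

Let z_neq0 : z != 0.
Proof. by rewrite -(vabs_eq0 abs_na) z_abs oner_eq0. Qed.

Lemma htwistM x y : htwist (x * y) = htwist x * htwist y.
Proof.
apply: hring_ext => n; rewrite [RHS]/= smulE /= /twist smulE mulrC.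
rewrite -zsumZ //; last exact: conv_vanishing.
congr zsum; apply/funext => i.
have -> : z ^ n = z ^ i * z ^ (n - i).
  by rewrite -expfzDr // addrC subrK.
by ring.
Qed.

Lemma htwist1 : htwist 1 = 1.
Proof.
apply: hring_ext => n; rewrite /= /twist /monomial.
by case: eqP => [->|_]; rewrite ?mul0r // expr0z mulr1.
Qed.

Lemma htwistB x y : htwist (x - y) = htwist x - htwist y.
Proof. by apply: hring_ext => n; rewrite /= /twist mulrBl. Qed.

Lemma htwist_bd x C : hbd x C -> hbd (htwist x) C.
Proof. by move=> hx j; rewrite vabs_twist. Qed.

Lemma htwist_approx x : approx_in x -> approx_in (htwist x).
Proof.
move=> hx e e0; have [a Aa ha] := hx e e0.
exists (htwist a); first exact: A_twist.
by rewrite -htwistB; apply: htwist_bd.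
Qed.

Lemma htwist_gam rho x : gam rho x -> gam rho (htwist x).
Proof.
move=> [[y xy] bx x0 hx]; split.
- by exists (htwist y); rewrite -htwistM xy htwist1.
- exact: htwist_bd.
- by rewrite vabs_twist.
- by move=> i i0; rewrite vabs_twist hx.
Qed.

Lemma htwist_gker x : gker x -> gker (htwist x).
Proof.
move=> [u [w [[u1 [u' hu' uu']] [rho [r0 r1 gu]] gw ->]]].
exists (htwist u), (htwist w); split; last exact: htwistM.
- split; first exact: htwist_approx.
  by exists (htwist u'); [exact: htwist_approx|rewrite -htwistM uu' htwist1].
- by exists rho; split=> //; apply: htwist_gam.
- exact: htwist_gam.
Qed.

End Twist.

(** The reverse inclusion needs a preimage of each kernel element, found by twisting with z^-1. *)
Lemma twist_coset (z : K) (z_abs : abs z = 1) h :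
  (forall a, A a -> A (twist z a)) -> (forall a, A a -> A (twist z^-1 a)) ->
  twist z @` coset_class abs A (hval h) =
  coset_class abs A (hval (htwist z_abs h)).
Proof.
move=> Az Azi.
have zi_abs : abs z^-1 = 1 by rewrite vabsV // z_abs invr1.
have z0 : z != 0 by rewrite -(vabs_eq0 abs_na) z_abs oner_eq0.
apply/funext => f; apply/propext; split.
  move=> [_ /coset_classP [x kx ->] <-]; apply/coset_classP.
  exists (htwist z_abs x); first exact: htwist_gker.
  by rewrite -htwistM.
move=> /coset_classP [x kx ->].
exists (hval (h * htwist zi_abs x)).
  by apply/coset_classP; exists (htwist zi_abs x) => //; apply: htwist_gker.
have xE : htwist z_abs (htwist zi_abs x) = x.
  apply: hring_ext => j; rewrite /= /twist -mulrA -expfzMl mulVf //.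
  by rewrite exp1rz mulr1.
by rewrite -[in RHS]xE -htwistM.
Qed.

End GammaGroup.

(** * The series exp (z l(pi T^mu)) *)

Lemma powR_invn (R : realType) (a : R) (N : nat) : 0 <= a -> (0 < N)%N ->
  (a `^ N%:R^-1) ^+ N = a.
Proof.
move=> a0 N0; rewrite -powR_mulrn ?powR_ge0 // -powRrM mulVf ?powRr1 //.
by rewrite pnatr_eq0 -lt0n.
Qed.

Lemma muln_le_exp p j : (1 < p)%N -> (0 < j)%N -> (p * j <= p ^ j)%N.
Proof.
by move=> p1; case: j => // j _; rewrite expnS leq_mul2l ltn_expl // orbT.
Qed.

Section PadicQp.
Context {R : realType} {F : fieldType} {abs : F -> R} {p : nat}.
Hypothesis p_prime : prime p.
Hypothesis F_spec : is_Qp abs p.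

(** A rational number close to x has absolute value at most 1, so up to sign it is a fraction to
    which [Zp_ratio] applies. *)
Lemma Zp_of_integers x : integers abs x -> Zp_in (abs := abs) (p := p) x.
Proof.
case: F_spec => abs_na abs_p _ dense hx N.
have pN0 : 0 < p%:R ^- N :> R by rewrite invr_gt0 exprn_gt0 // ltr0n prime_gt0.
have pN1 : p%:R ^- N <= 1 :> R.
  by rewrite invf_le1 ?exprn_gt0 ?ltr0n ?prime_gt0 // exprn_ege1 // ler1n prime_gt0.
have [q hq] := dense x _ pN0.
have q1 : abs (ratr q) <= 1.
  rewrite -[ratr q](subKr x); apply: vabsB_le => //.
  exact: le_trans (ltW hq) pN1.
have : Zp_in (abs := abs) (p := p) (ratr q).
  have [b bE b0] : exists2 b : nat, denq q = b%:Z & (0 < b)%N.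
    by case: (denq q) (denq_gt0 q) => // b b0; exists b.
  move: q1; rewrite /ratr bE; case: (numq q) => [m|m] h.
    exact: Zp_ratio.
  have E : (Negz m)%:~R / b%:Z%:~R = - (m.+1%:R / b%:R) :> F.
    by rewrite NegzE mulrNz mulNr.
  rewrite E in h *; apply: ZpN => //; apply: Zp_ratio => //.
  by rewrite vabsN in h.
move=> /(_ N) [m hm]; exists m.
by rewrite -(subrKA (ratr q)); apply: vabsD_le => //; apply: ltW.
Qed.

(** A residue exists, so the default value 0 of [Zp_residue] is not what is returned by lack of
    candidates. *)
Lemma Zp_residueP n (c : F) : integers abs c ->
  abs ((Zp_residue abs p n c)%:R - c) <= p%:R ^- n.
Proof.
move=> /Zp_of_integers /(_ n) [m hm]; case: F_spec => abs_na _ _ _.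
rewrite /Zp_residue; case: xgetP => [m' -> //|/(_ m)]; case.
by rewrite /= vabs_subC.
Qed.

End PadicQp.

(** * Size of the coefficients p^(n-k) pi^(p^k), with P for |pi| *)

Section Coefficients.
Context {R : realType} {p n : nat} {P r : R}.
Hypothesis p_prime : prime p.
Hypothesis n_gt0 : (0 < n)%N.
Hypothesis P_ge0 : 0 <= P.
Hypothesis P_lt1 : P < 1.
Hypothesis r_gt0 : 0 < r.
Hypothesis r_le1 : r <= 1.
Hypothesis r_pow : r ^+ p.-1 = p%:R^-1.
Hypothesis P_pow : P ^+ (p ^ n.-1) <= r.

Let q : R := p%:R^-1.
Let q_gt0 : 0 < q. Proof. by rewrite invr_gt0 ltr0n prime_gt0. Qed.
Let q_le1 : q <= 1. Proof. by rewrite invf_le1 ?ltr0n ?ler1n prime_gt0. Qed.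
Let p_gt1 := prime_gt1 p_prime.

(** Here k = n - 1 + j. As p j <= p^j and r^(p-1) = q, one has r^(p^j) <= r^(pj) = r^j q^j, and the
    factor q^j pays for the denominator. *)
Lemma coef_tail_le j : (0 < j)%N ->
  q ^+ n / q ^+ (n.-1 + j) * P ^+ (p ^ (n.-1 + j)) <= q * r ^+ j.
Proof.
move=> j0; have -> : q ^+ n / q ^+ (n.-1 + j) = q / q ^+ j.
  rewrite -{1}(prednK n_gt0) exprS exprD; field.
  by rewrite !expf_neq0 // gt_eqF.
rewrite -mulrA ler_pM2l // mulrC ler_pdivrMr ?exprn_gt0 //.
rewrite expnD exprM -/q.
apply: (@le_trans _ _ (r ^+ (p ^ j))).
  by apply: lerXn2r; rewrite ?nnegrE ?exprn_ge0 ?(ltW r_gt0).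
have -> : r ^+ j * q ^+ j = r ^+ (p * j).
  by rewrite /q -r_pow -exprM -exprD -mulSn prednK // prime_gt0.
by rewrite ler_wiXn2l ?(ltW r_gt0) // muln_le_exp.
Qed.

(** For k = n - 1 this is the assumption on P; for smaller k the quotient supplies at least one
    further factor q, and q <= r. *)
Lemma coef_head_le k : (k < n)%N -> q ^+ n / q ^+ k * P ^+ (p ^ k) <= q * r.
Proof.
move=> kn; have [->|ne] := eqVneq k n.-1.
  have -> : q ^+ n / q ^+ n.-1 = q.
    by rewrite -{1}(prednK n_gt0) exprS mulfK // expf_neq0 // gt_eqF.
  by rewrite ler_pM2l.
have [j jE] : exists j, n = (k + j.+2)%N by exists (n - k).-2; lia.
have -> : q ^+ n / q ^+ k = q * q ^+ j.+1.
  by rewrite jE exprD mulrC mulKf -?exprS // expf_neq0 // gt_eqF.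
rewrite -mulrA ler_pM2l // -[leRHS]mulr1; apply: ler_pM.
- by rewrite exprn_ge0 // ltW.
- exact: exprn_ge0.
- apply: (@le_trans _ _ q); first by rewrite exprS ger_pMr // exprn_ile1 // ltW.
  rewrite /q -r_pow -[leRHS]expr1 ler_wiXn2l ?(ltW r_gt0) //.
  by rewrite -ltnS prednK // prime_gt0.
- by rewrite exprn_ile1 // ltW.
Qed.

Lemma coef_all_le k : q ^+ n / q ^+ k * P ^+ (p ^ k) <= q * r.
Proof.
have [kn|nk] := ltnP k n; first exact: coef_head_le.
have -> : k = (n.-1 + (k - n.-1))%N by lia.
apply: le_trans (coef_tail_le _) _; first by lia.
rewrite ler_pM2l // -[leRHS]expr1 ler_wiXn2l ?(ltW r_gt0) //; lia.
Qed.

Lemma coef_small eps : 0 < eps -> exists N, forall k, (N <= k)%N ->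
  q ^+ n / q ^+ k * P ^+ (p ^ k) <= eps.
Proof.
move=> e0.
have r_lt1 : r < 1.
  rewrite lt_neqAle r_le1 andbT; apply/eqP => r1; move: r_pow.
  rewrite r1 expr1n => /esym/eqP; rewrite invr_eq1 pnatr_eq1 => /eqP pE.
  by move: p_gt1; rewrite pE.
have [N hN] := exprn_small (ltW r_gt0) r_lt1 e0.
exists (n + N)%N => k hk.
have -> : k = (n.-1 + (k - n.-1))%N by lia.
apply: le_trans (coef_tail_le _) _; first by lia.
apply: (@le_trans _ _ (1 * r ^+ (k - n.-1))).
  by rewrite ler_wpM2r // exprn_ge0 // ltW.
by rewrite mul1r; apply: hN; lia.
Qed.

End Coefficients.

Section ExpSeries.
Context {R : realType} {K : fieldType} {abs : K -> R} {p : nat}.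
Hypothesis p_prime : prime p.
Variables (abs_na : nonarch_absval abs) (abs_cp : complete_field abs).
Hypothesis abs_p : abs p%:R = p%:R^-1.
Variable mu : nat.
Hypothesis mu_gt0 : (0 < mu)%N.
Variable pi : K.
Hypothesis pi_lt1 : abs pi < 1.

Local Notation H := (Hring abs_na abs_cp).
Local Notation Zp := (Zp_in (abs := abs) (p := p)).
Local Notation l := (@l_coef K p).

Let natr_neq0 m : (0 < m)%N -> m%:R != 0 :> K.
Proof. exact: (natr_padic_neq0 p_prime abs_na abs_p). Qed.

(** The coefficients of l(pi T^mu). *)
Definition lpi : nat -> K := expand mu (fun i => l i * pi ^+ i).

Lemma lpi_at0 : lpi 0%N = 0.
Proof. by rewrite /lpi /expand dvdn0 div0n l_coef_at0 // mul0r. Qed.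

Lemma lpi_pX k : lpi (mu * p ^ k)%N = p%:R ^- k * pi ^+ (p ^ k).
Proof. by rewrite /lpi /expand dvdn_mulr // mulKn // l_coef_pX. Qed.

Lemma lpi_eq0 j : (forall k, (mu * p ^ k)%N != j) -> lpi j = 0.
Proof.
move=> h; rewrite /lpi /expand; case: ifP => // /dvdnP [m jE].
rewrite l_coef_eq0 ?mul0r // => k; apply: contra (h k) => /eqP kE.
by rewrite kE jE mulnK // mulnC.
Qed.

Lemma exp_lpiE z j : exp_coef (fun i => z * lpi i) j =
  expand mu (fun i => exp_coef (fun i => z * l i) i * pi ^+ i) j.
Proof.
have -> : (fun i => z * lpi i) = expand mu (fun i => z * l i * pi ^+ i).
  apply/funext => i; rewrite /lpi /expand; case: ifP => _; last by rewrite mulr0.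
  by rewrite mulrA.
rewrite exp_coef_expand // ?l_coef_at0 ?mulr0 ?mul0r //.
by rewrite /expand; case: ifP => // _; rewrite exp_coef_dilate // l_coef_at0 ?mulr0.
Qed.

(** The factor 1 presents the series of the theorem as h_z with z = 1. *)
Lemma h_seriesE : h_series p mu pi = powser (exp_coef (fun i => 1 * lpi i)).
Proof.
apply/funext => -[m|m] //=; rewrite exp_lpiE /expand; case: ifP => // _.
rewrite /h_coef exp_coef_dilate ?l_coef_at0 //; congr (exp_coef _ _ * _).
by apply/funext => i; rewrite mul1r.
Qed.

(** With this rho the bound |pi|^q on the coefficient of T^(mu q) reads rho^(mu q), the form
    required by Gamma. *)
Let rho := abs pi `^ mu%:R^-1.

Let rho_ge0 : 0 <= rho. Proof. exact: powR_ge0. Qed.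

Let rho_mu : rho ^+ mu = abs pi.
Proof. by rewrite powR_invn ?vabs_ge0. Qed.

Let rho_lt1 : rho < 1.
Proof.
rewrite ltNge; apply/negP => h; move: pi_lt1; rewrite -rho_mu ltNge.
by rewrite exprn_ege1.
Qed.

Lemma exp_lpi_le z j : Zp z -> abs (exp_coef (fun i => z * lpi i) j) <= rho ^+ j.
Proof.
move=> hz; rewrite exp_lpiE /expand; case: ifP => [/dvdnP [m ->]|_]; last first.
  by rewrite vabs0 // exprn_ge0.
rewrite mulnK // vabsM // mulnC exprM rho_mu vabsX // -[leRHS]mul1r.
by rewrite ler_wpM2r ?exprn_ge0 ?vabs_ge0 // (exp_l_integral p_prime).
Qed.

Definition hz z : H :=
  xget 0 [set x : H | hval x = powser (exp_coef (fun i => z * lpi i))].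

Lemma hzE z : Zp z -> hval (hz z) = powser (exp_coef (fun i => z * lpi i)).
Proof.
move=> h; have Hp := @Hset_powser _ _ _ abs_na _ _ rho_ge0 rho_lt1
  (fun j => exp_lpi_le j h).
rewrite /hz; case: xgetP => [x -> //|/(_ (MkH abs_na abs_cp Hp))].
by case.
Qed.

Lemma hzD z w : Zp z -> Zp w -> hz (z + w) = hz z * hz w.
Proof.
move=> h h'; apply: hval_inj; rewrite hvalM !hzE //; last exact: ZpD.
rewrite smul_powser //; congr powser; apply/funext => j.
rewrite -exp_coefD ?lpi_at0 ?mulr0 //; congr exp_coef; apply/funext => i.
by rewrite mulrDl.
Qed.

Lemma hz0 : hz 0 = 1.
Proof.
apply: hring_ext => -[j|j]; rewrite hzE ?hval1 //=; try exact: Zp0.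
rewrite eqz_nat -exp_coef_zero; congr exp_coef; apply/funext => i.
by rewrite mul0r.
Qed.

Lemma hz_nat m : hz m%:R = hz 1 ^+ m.
Proof.
elim: m => [|m IH]; first exact: hz0.
by rewrite exprS -IH -hzD ?nat1r //; [exact: Zp1|exact: Zp_nat].
Qed.

Lemma hz_gamma z : Zp z -> gamma (hz z).
Proof.
move=> h; exists rho; split=> //.
have hN : Zp (- z) by apply: ZpN.
have he j : abs (hz z (Posz j)) <= rho ^+ j by rewrite hzE //; apply: exp_lpi_le.
split.
- by exists (hz (- z)); rewrite -hzD // subrr hz0.
- move=> -[j|j]; last by rewrite hzE //= vabs0.
  by apply: le_trans (he j) _; rewrite exprn_ile1 // ltW.
- by rewrite hzE //= exp_coef_at0 vabs1.
- by move=> j _; apply: he.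
Qed.

Lemma hz_sub1_bd z : Zp z -> hbd (hz z - 1) (abs pi).
Proof.
move=> h -[j|j]; rewrite hvalB hval1 hzE //=; last first.
  by rewrite subrr vabs0 // vabs_ge0.
case: j => [|j]; first by rewrite exp_coef_at0 subrr vabs0 // vabs_ge0.
rewrite subr0 exp_lpiE /expand; case: ifP => [/dvdnP [m jE]|_]; last first.
  by rewrite vabs0 // vabs_ge0.
rewrite jE mulnK // vabsM // vabsX //.
case: m jE => // m _; rewrite exprS mulrA -[leRHS]mulr1.
apply: ler_pM; rewrite ?mulr_ge0 ?exprn_ge0 ?vabs_ge0 //.
  rewrite -[leRHS]mul1r ler_wpM2r ?vabs_ge0 //.
  exact: (exp_l_integral p_prime).
by rewrite exprn_ile1 ?vabs_ge0 // ltW.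
Qed.

End ExpSeries.

(** * Injectivity *)

Section StandardBasis.
Context {R : realType} {K : fieldType} {abs : K -> R}.
Variables (abs_na : nonarch_absval abs) (abs_cp : complete_field abs).
Variables (A : set (biseries K)) (s : nat -> nat) (v : nat -> biseries K).
Hypothesis s_incr : forall k m : nat, (k < m)%N -> (s k < s m)%N.
Hypothesis v_basis : standard_basis A s v.
Hypothesis A_integral : forall (k : nat) (j : int), integers abs (v k j).

Local Notation H := (Hring abs_na abs_cp).

(** At the degrees s_k the reduced basis is the identity matrix, so coordinates can be read off
    there. *)
Lemma standard_coord (N : nat) (c : nat -> K) k : (k < N)%N ->
  \sum_(i < N) c i * v i (s k)%:Z = c k.
Proof.
move=> kN; case: v_basis => _ deg lead red.
rewrite (bigD1 (Ordinal kN)) //= lead mulr1 big1 ?addr0 // => i ik.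
have [lt|gt|eq] := ltngtP i k.
- by rewrite (deg i).2 ?mulr0 // ltz_nat s_incr.
- by rewrite red ?mulr0.
- by case/eqP: ik; apply: val_inj.
Qed.

(** The coefficients at the degrees s_k are the coordinates in a basis with integral coefficients,
    so they bound all the others. *)
Lemma subalg_coef_le (a : biseries K) C : A a -> 0 <= C ->
  (forall k, abs (a (s k)%:Z) <= C) -> forall j, abs (a j) <= C.
Proof.
case: v_basis => -[span _] _ _ _ /span [N [c ->]] C0 h j.
apply: vabs_sum_le => // i _; rewrite vabsM // -[leRHS]mulr1.
apply: ler_pM; rewrite ?vabs_ge0 //; last exact: A_integral.
by have := h i; rewrite standard_coord.
Qed.

Lemma subalg_Hset : A `<=` Hset abs.
Proof.
case: v_basis => -[span _] deg _ _ a /span [N [c ->]]; apply/HsetP => //; split.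
  exists (\sum_(i < N) abs (c i)) => j; apply: vabs_sum_le => //.
    by apply: sumr_ge0 => i _; apply: vabs_ge0.
  move=> i _; rewrite vabsM // (bigD1 i) //= -[leLHS]addr0 lerD //.
    by rewrite -[leRHS]mulr1 ler_wpM2l ?vabs_ge0 // A_integral.
  by apply: sumr_ge0 => k _; apply: vabs_ge0.
move=> e e0; exists (s N) => j hj; rewrite big1 ?vabs0 ?ltW // => i _.
rewrite (deg i).2 ?mulr0 //; apply: lt_le_trans hj.
by rewrite ltz_nat s_incr.
Qed.

Lemma approx_coef_le (x : H) C : approx_in A x -> 0 <= C ->
  (forall k, abs (x (s k)%:Z) <= C) -> hbd x C.
Proof.
move=> Ax C0 h j; apply/ler_addgt0Pr => e e0; have [a Aa ha] := Ax e e0.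
have Ce : 0 <= C + e by rewrite addr_ge0 // ltW.
have eCe : e <= C + e by rewrite lerDr.
rewrite -[x](subrK a) hvalD; apply: vabsD_le => //.
  exact: le_trans (ha j) eCe.
apply: (subalg_coef_le Aa Ce) => k; rewrite -[a](subKr x) hvalB.
apply: vabsB_le => //; last exact: le_trans (ha _) eCe.
by apply: le_trans (h k) _; rewrite lerDl ltW.
Qed.

End StandardBasis.

(* If h(pi) and h(pi') have the same class, their quotient
   f = 1 + (pi - pi') T^mu + (smaller terms) factors as f = (1 + x) w with x
   in A^an and w in K[[1/T]].  As mu is a gap, the coefficients of f at the
   degrees s_k are smaller than |pi - pi'|; they bound x, so the coefficient of
   T^mu in f is too small as well, unless pi = pi'. *)
Section Injectivity.
Context {R : realType} {K : fieldType} {abs : K -> R} {p : nat}.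
Hypothesis p_prime : prime p.
Variables (abs_na : nonarch_absval abs) (abs_cp : complete_field abs).
Hypothesis abs_p : abs p%:R = p%:R^-1.
Variables (A : set (biseries K)) (s : nat -> nat) (v : nat -> biseries K).
Hypothesis A_subalg : subalgebra abs A.
Hypothesis s_incr : forall k m : nat, (k < m)%N -> (s k < s m)%N.
Hypothesis v_basis : standard_basis A s v.
Hypothesis A_integral : forall (k : nat) (j : int), integers abs (v k j).
Variable mu : nat.
Hypothesis mu_gt0 : (0 < mu)%N.
Hypothesis mu_gap : forall k, s k != mu.

Local Notation H := (Hring abs_na abs_cp).

(** As sigma < 1, the conclusion leaves only c = 0. In the application f is h(pi)/h(pi') and c is pi
    - pi'. *)
Lemma gker_mono_small (f E : H) c sigma : 0 <= sigma -> sigma < 1 -> abs c < 1 ->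
  gker A f -> f = 1 + c *: H_mono abs_na abs_cp mu%:Z + E ->
  hbd E (sigma * abs c) -> abs c <= sigma * abs c.
Proof.
move=> s0 s1 c1 [u [w [[Au _] [rho [r0 r1 [_ bu u0 hu]]] [_ bw w0 hw] fuw]]] fE bE.
have e0 : 0 <= abs c by apply: vabs_ge0.
have u0_neq0 : u 0 != 0 by rewrite -(vabs_eq0 abs_na) u0 oner_eq0.
(* Moving the constant u_0 from u to w gives x the constant coefficient 0. *)
pose x := (u 0)^-1 *: u - 1; pose w' := u 0 *: w.
have Ax : approx_in A x.
  apply: approx_inD => //; first exact: approx_inZ.
  by rewrite -scaleN1r; apply: approx_inZ => //; apply: approx_in1.
have x0 : x 0 = 0 by rewrite hvalB hvalZ hval1 eqxx mulVf // subrr.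
have x_pos (j : nat) : (0 < j)%N -> x j%:Z = (u 0)^-1 * u j%:Z.
  by move=> j0; rewrite hvalB hvalZ hval1 eqz_nat (gtn_eqF j0) subr0.
have sw : supp_le 0 w'.
  move=> -[j|j] // j0; rewrite hvalZ; apply/eqP; rewrite mulf_eq0.
  apply/orP; right; rewrite -(vabs_eq0 abs_na) eq_le vabs_ge0 // andbT.
  have := hw j j0; rewrite expr0n; case: j j0 => //.
have bw' : hbd w' 1 by have := hbdZ (u 0) bw; rewrite u0 mulr1.
have fxw : f = (1 + x) * w'.
  by rewrite /x /w' addrC subrK -scalerAl -scalerAr scalerA mulVf // scale1r.
pose eta := gauss_norm abs (hval x).
have bx : hbd x eta.
  move=> j; apply: ub_le_sup; last by exists j.
  by have [C _ hC] := hval_bounded x; exists C => _ [i _ <-].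
have eta0 : 0 <= eta := hbd_ge0 bx.
(* On A^an it is enough to look at the degrees s_k; there x is at most rho by the definition of
   Gamma_rho. *)
have eta1 : eta < 1.
  apply: (le_lt_trans _ r1); apply: gauss_norm_le.
  apply: (approx_coef_le s_incr v_basis A_integral) => // k.
  case: (posnP (s k)) => [->|sk0]; first by rewrite x0 vabs0.
  rewrite x_pos // vabsM // vabsV // u0 invr1 mul1r.
  apply: le_trans (hu _ sk0) _; rewrite -[leRHS]expr1.
  by rewrite ler_wiXn2l ?(ltW r1).
have f1E : f - 1 = c *: H_mono abs_na abs_cp mu%:Z + E by rewrite fE; ring.
have bf : hbd (f - 1) (abs c).
  rewrite f1E; apply: hbdD.
    have := @hbdZ _ _ _ abs_na abs_cp c (H_mono abs_na abs_cp mu%:Z) 1.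
    by rewrite mulr1; apply => j; apply: vabs_nat_le1.
  by apply: hbd_le bE; rewrite ler_piMl // ltW.
pose tau := Num.max (abs c) eta.
have tau1 : tau < 1 by rewrite gt_max c1.
have bw1 : hbd (w' - 1) tau.
  have -> : w' - 1 = (f - 1) - x * w' by rewrite fxw; ring.
  apply: hbdB; first by apply: hbd_le bf; rewrite le_max lexx.
  apply: (@hbd_le _ _ _ _ _ _ (eta * 1)); last exact: hbdM.
  by rewrite mulr1 le_max lexx orbT.
have bxw : hbd (x * (w' - 1)) (eta * tau) by apply: hbdM.
(* The series w' - 1 has no terms in positive degree. *)
have x_coef (j : nat) : (0 < j)%N -> x j%:Z = (f - 1) j%:Z - (x * (w' - 1)) j%:Z.
  move=> j0; have xE : x = (f - 1) - x * (w' - 1) - (w' - 1) by rewrite fxw; ring.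
  rewrite {1}xE [LHS]hvalB [(w' - 1) _]hvalB sw // hval1 eqz_nat (gtn_eqF j0).
  by rewrite subrr subr0.
have se0 : 0 <= sigma * abs c by apply: mulr_ge0.
(* Bootstrap: eta <= eta * tau with tau < 1 would force eta = 0, so the bound follows from either
   alternative of the maximum. *)
have eta_le : eta <= sigma * abs c.
  have : eta <= Num.max (sigma * abs c) (eta * tau).
    apply: gauss_norm_le; apply: (approx_coef_le s_incr v_basis A_integral) => //.
      by rewrite le_max se0.
    move=> k; case: (posnP (s k)) => [->|sk0].
      by rewrite x0 vabs0 // le_max se0.
    rewrite x_coef //; apply: vabsB_le => //; last first.
      by apply: le_trans (bxw _) _; rewrite le_max lexx orbT.
    rewrite f1E hvalD hvalZ /= /monomial eqz_nat (negPf (mu_gap k)) mulr0 add0r.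
    by apply: le_trans (bE _) _; rewrite le_max lexx.
  rewrite le_max => /orP [//|h]; suff /le_trans : eta <= 0 by apply.
  rewrite -(pmulr_lle0 _ (_ : 0 < 1 - tau)) ?subr_gt0 //.
  by rewrite mulrBr mulr1 subr_le0.
have cE : c = (x + x * (w' - 1) - E) mu%:Z.
  rewrite hvalB hvalD x_coef // subrK f1E hvalD addrK hvalZ /=.
  by rewrite /monomial eqxx mulr1.
rewrite {1}cE.
have : hbd (x + x * (w' - 1) - E) (sigma * abs c); last exact.
apply: hbdB => //; apply: hbdD; first exact: hbd_le bx.
by apply: hbd_le bxw; apply: le_trans _ eta_le; rewrite ler_piMr // ltW.
Qed.

Lemma hz_class_inj (pi pi' : K) : abs pi < 1 -> abs pi' < 1 ->
  coset_class abs A (h_series p mu pi) = coset_class abs A (h_series p mu pi') ->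
  pi = pi'.
Proof.
move=> h1 h2 eq_class.
have A_Hset := subalg_Hset abs_na s_incr v_basis A_integral.
have Z1 : Zp_in (abs := abs) (p := p) 1 by apply: Zp1.
have ZN1 : Zp_in (abs := abs) (p := p) (-1) by apply: ZpN.
have E1 := hzE p_prime abs_na abs_cp abs_p mu_gt0 h1 Z1.
have E2 := hzE p_prime abs_na abs_cp abs_p mu_gt0 h2 Z1.
have D2 := hzD p_prime abs_na abs_cp abs_p mu_gt0 h2 Z1 ZN1.
rewrite subrr hz0 // in D2.
have S2 := hz_sub1_bd p_prime abs_na abs_cp abs_p mu_gt0 h2 ZN1.
set g1 := hz (p := p) abs_na abs_cp mu pi 1 in E1.
set g2 := hz (p := p) abs_na abs_cp mu pi' 1 in E2 D2.
set k2 := hz (p := p) abs_na abs_cp mu pi' (-1) in D2 S2.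
rewrite !(h_seriesE p_prime mu_gt0) -E1 -E2 in eq_class.
clearbody g1 g2 k2.
have := coset_class_self A_subalg A_Hset g1.
rewrite eq_class => /(coset_classP A_Hset) [f kf /hval_inj g1E].
pose a := exp_coef (fun i => 1 * l_coef K p i).
have a_le q : abs (a q) <= 1 by apply: (exp_l_integral p_prime).
have g12 (j : nat) : (g1 - g2) j%:Z = expand mu (fun q => a q * (pi ^+ q - pi' ^+ q)) j.
  rewrite hvalB E1 E2 /= !exp_lpiE // /expand; case: ifP => _; last by rewrite subrr.
  by rewrite mulrBr.
pose sigma := Num.max (abs pi) (abs pi').
have s0 : 0 <= sigma by rewrite le_max vabs_ge0.
have s1 : sigma < 1 by rewrite gt_max h1.
have [ps ps'] : abs pi <= sigma /\ abs pi' <= sigma.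
  by rewrite /sigma !le_max !lexx orbT.
pose c := pi - pi'.
have cs : abs c <= sigma.
  by rewrite /c /sigma; apply: (vabsB_le abs_na); rewrite le_max lexx ?orbT.
pose m := H_mono abs_na abs_cp mu%:Z.
(* For q >= 2, pi^q - pi'^q is c times a homogeneous polynomial of degree q - 1 >= 1 in pi and pi',
   which contributes a factor sigma. *)
have bD : hbd (g1 - g2 - c *: m) (sigma * abs c).
  have sc0 : 0 <= sigma * abs c by rewrite mulr_ge0 // vabs_ge0.
  move=> -[j|j]; last first.
    by rewrite hvalB (hvalB g1) E1 E2 hvalZ /= /monomial mulr0 !subr0 vabs0.
  rewrite hvalB g12 hvalZ /= /monomial eqz_nat /expand.
  case: (boolP (mu %| j)%N) => [/dvdnP [q jE]|nd]; last first.
    have -> : (j == mu) = false by apply: contraNF nd => /eqP ->.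
    by rewrite mulr0 subr0 vabs0.
  rewrite jE mulnK // -{2}[mu]mul1n eqn_pmul2r //.
  case: q jE => [|[|q]] _; rewrite ?expr0 ?subrr ?mulr0 ?subr0 ?vabs0 //.
    by rewrite !expr1 /a exp_coef_at1 -(expn0 p) l_coef_pX // expr0 invr1 !mul1r
      mulr1 subrr vabs0.
  rewrite vabsM // -[leRHS]mul1r; apply: ler_pM; rewrite ?vabs_ge0 //.
  rewrite subrXX vabsM // mulrC ler_wpM2r ?vabs_ge0 //.
  apply: vabs_sum_le => // i _; rewrite vabsM // !(vabsX abs_na).
  apply: (@le_trans _ _ (sigma ^+ (q.+1 - i) * sigma ^+ i)).
    apply: ler_pM; rewrite ?exprn_ge0 ?vabs_ge0 //;
      by apply: lerXn2r; rewrite ?nnegrE ?(vabs_ge0 abs_na).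
  rewrite -exprD -[leRHS]expr1 ler_wiXn2l ?(ltW s1) //.
  by have := ltn_ord i; lia.
(* Here f - 1 = k2 (g1 - g2), where k2 is the inverse of g2 and k2 - 1 is at most sigma. *)
pose E := (g1 - g2 - c *: m) + (k2 - 1) * (g1 - g2).
have fE : f = 1 + c *: m + E.
  have -> : f = k2 * g1 by rewrite g1E mulrA [k2 * g2]mulrC -D2 mul1r.
  rewrite /E; have -> : k2 * g1 = k2 * (g1 - g2) + g2 * k2 by ring.
  by rewrite -D2; ring.
have bm : hbd (c *: m) (abs c).
  have := @hbdZ _ _ _ abs_na abs_cp c m 1.
  by rewrite mulr1; apply => j; apply: vabs_nat_le1.
have bE : hbd E (sigma * abs c).
  apply: hbdD => //; apply: hbdM.
    by apply: hbd_le S2; rewrite le_max lexx orbT.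
  rewrite -[g1 - g2](subrK (c *: m)); apply: hbdD => //.
  by apply: hbd_le bD; rewrite ler_piMl ?vabs_ge0 // ltW.
have := gker_mono_small s0 s1 (le_lt_trans cs s1) kf fE bE.
rewrite -subr_ge0 -{2}[abs c]mul1r -mulrBl => h.
apply/eqP; rewrite -subr_eq0 -(vabs_eq0 abs_na) eq_le vabs_ge0 // andbT.
by rewrite -(pmulr_rle0 _ (_ : 0 < 1 - sigma)) ?subr_gt0 // -oppr_ge0 -mulNr opprB.
Qed.

End Injectivity.

(** * Torsion and eigenspaces *)

Section Torsion.
Context {R : realType} {K : fieldType} {abs : K -> R} {p : nat}.
Hypothesis p_prime : prime p.
Variables (abs_na : nonarch_absval abs) (abs_cp : complete_field abs).
Hypothesis abs_p : abs p%:R = p%:R^-1.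
Variable A : set (biseries K).
Hypothesis A_subalg : subalgebra abs A.
Variables (mu n : nat) (pi : K) (r : R).
Hypothesis mu_gt0 : (0 < mu)%N.
Hypothesis n_gt0 : (0 < n)%N.
Hypothesis pi_lt1 : abs pi < 1.
Hypothesis r_gt0 : 0 < r.
Hypothesis r_le1 : r <= 1.
Hypothesis r_pow : r ^+ p.-1 = p%:R^-1.
Hypothesis pi_pow : abs pi ^+ (p ^ n.-1) <= r.

Local Notation H := (Hring abs_na abs_cp).
Local Notation mono := (H_mono abs_na abs_cp).
Local Notation Zp := (Zp_in (abs := abs) (p := p)).

Variables (e : nat -> K) (a t : nat -> H).
Hypothesis mono_dec : forall k,
  mono (mu * p ^ k)%N%:Z = e k *: mono mu%:Z + (a k + t k).
Hypothesis a_A : forall k, A (hval (a k)).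
Hypothesis a_bd : forall k, hbd (a k) 1.
Hypothesis t_supp : forall k, supp_le (-1) (t k).
Hypothesis t_bd : forall k, hbd (t k) 1.
Hypothesis l_root :
  tends_to abs (fun N => \sum_(k < N) e k / p%:R ^+ k * pi ^+ (p ^ k)) 0.

(** The coefficient of T^(mu p^k) in p^n l(pi T^mu). *)
Let c k : K := p%:R ^+ n / p%:R ^+ k * pi ^+ (p ^ k).

Let c_abs k : abs (c k) =
  p%:R^-1 ^+ n / p%:R^-1 ^+ k * abs pi ^+ (p ^ k).
Proof. by rewrite /c !(vabsM abs_na) (vabsV abs_na) !(vabsX abs_na) abs_p. Qed.

Let c_le k : abs (c k) <= p%:R^-1 * r.
Proof. by rewrite c_abs coef_all_le ?vabs_ge0. Qed.

Let c_small eps : 0 < eps -> exists N, forall k, (N <= k)%N -> abs (c k) <= eps.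
Proof.
move=> e0.
have [N hN] := coef_small p_prime n_gt0 (vabs_ge0 abs_na pi) pi_lt1 r_gt0 r_le1 r_pow
  pi_pow e0.
by exists N => k /hN; rewrite c_abs.
Qed.

Let c_series (x : nat -> H) : (forall k, hbd (x k) 1) ->
  exists2 S, hcvg (fun N => \sum_(k < N) c k *: x k) S & exp_domain (p := p) r S.
Proof.
move=> hx.
have cx k C : abs (c k) <= C -> hbd (c k *: x k) C.
  by move=> hC; apply: hbd_le (hbdZ (c k) (hx k)); rewrite mulr1.
have [|S hS] := @hseries_cvg _ _ _ abs_na abs_cp (fun k => c k *: x k).
  by move=> eps /c_small [N hN]; exists N => k /hN /cx.
have q0 : 0 <= p%:R^-1 * r by rewrite mulr_ge0 ?invr_ge0 // ltW.
exists S => //; apply: (hcvg_bd q0 hS) => N; apply: hbd_sum => // k _.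
exact: cx.
Qed.

Lemma pX_lpi_dec : exists aa tt : H, [/\ approx_in A aa, supp_le (-1) tt,
  exp_domain (p := p) r aa, exp_domain (p := p) r tt &
  hval (aa + tt) = powser (fun j => p%:R ^+ n * lpi (p := p) mu pi j)].
Proof.
have p0 : p%:R != 0 :> K by apply: (p_neq0 p_prime abs_na abs_p).
have [aa ha da] := c_series a_bd; have [tt ht dt] := c_series t_bd.
have mono_bd k : hbd (mono (mu * p ^ k)%N%:Z) 1.
  by move=> j; apply: vabs_nat_le1.
have [y hy _] := c_series mono_bd.
exists aa, tt; split=> //.
- apply: (approx_in_hcvg ha) => N; apply: approx_in_sum => // k _.
  by apply: approx_inZ => //; apply: approx_in_of_A.
- move=> j hj; apply: (@hcvg_coef _ _ _ _ _ _ _ _ _ 0%N ht) => N _.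
  by rewrite hval_sum big1 // => k _; rewrite hvalZ t_supp // mulr0.
(* The partial sums differ by -p^n T^mu times a partial sum of l_i(pi), which tends to 0. *)
have -> : aa + tt = y.
  apply: (hcvg_unique _ hy).
  apply: hcvg_ext (hcvgD ha ht) => eps e0.
  have pn0 : 0 < abs (p%:R ^+ n) by rewrite vabs_gt0 // expf_neq0.
  have [N hN] := (tends_toP abs_na _ _).1 l_root _ (divr_gt0 e0 pn0).
  exists N => M /hN; rewrite subr0.
  set E := \sum_(k < M) _ => hE.
  have -> : \sum_(k < M) c k *: a k + \sum_(k < M) c k *: t k -
      \sum_(k < M) c k *: mono (mu * p ^ k)%N%:Z = - (p%:R ^+ n * E) *: mono mu%:Z.
    rewrite -big_split /= -sumrB /E mulr_sumr scaleNr scaler_suml -sumrN.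
    apply: eq_bigr => k _; rewrite mono_dec !scalerDr opprD addrCA subrr addr0.
    by rewrite scalerA; congr (- (_ *: _)); rewrite /c; ring.
  apply: (@hbd_le _ _ _ _ _ _ (abs (- (p%:R ^+ n * E)) * 1)).
    by rewrite mulr1 vabsN // vabsM // mulrC -ler_pdivlMr.
  by apply: hbdZ => j; apply: vabs_nat_le1.
apply/funext => j.
have term k : (c k *: mono (mu * p ^ k)%N%:Z) j = c k * (j == (mu * p ^ k)%N%:Z)%:R.
  by [].
have [[k jE]|no] := pselect (exists k, j = (mu * p ^ k)%N%:Z).
  apply: (@hcvg_coef _ _ _ _ _ _ _ _ _ k.+1 hy) => N kN.
  rewrite hval_sum (bigD1 (Ordinal kN)) // big1.
    by rewrite [LHS]addr0 [LHS](term k) jE eqxx mulr1 [RHS]/= lpi_pX // mulrA.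
  move=> i ik; rewrite term jE eqz_nat eqn_pmul2l // eqn_exp2l ?prime_gt1 //.
  have -> : (k == i) = false; last by rewrite mulr0.
  by apply: contraNF ik => /eqP ki; apply/eqP/val_inj.
have -> : powser (fun j0 => p%:R ^+ n * lpi (p := p) mu pi j0) j = 0.
  case: j no {term} => j no //=; rewrite lpi_eq0 ?mulr0 // => k.
  by apply/eqP => kj; apply: no; exists k; rewrite kj.
apply: (@hcvg_coef _ _ _ _ _ _ _ _ _ 0%N hy) => N _.
rewrite hval_sum big1 // => i _; rewrite term.
case: eqP => [jE|_]; last by rewrite mulr0.
by case: no; exists i.
Qed.

Lemma gker_hz z : Zp z -> gker A (hz (p := p) abs_na abs_cp mu pi (p%:R ^+ n * z)).
Proof.
move=> Zz; have z1 : abs z <= 1 by apply: Zp_le1 Zz.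
have [aa [tt [Aa st da dt dec]]] := pX_lpi_dec.
have dZ (x : H) : exp_domain (p := p) r x -> exp_domain (p := p) r (z *: x).
  move=> hx; apply: hbd_le (hbdZ z hx).
  by rewrite ler_piMl // mulr_ge0 ?invr_ge0 // ltW.
have Zpz : Zp (p%:R ^+ n * z).
  by apply: ZpM => //; apply: ZpX => //; apply: Zp_nat.
have hzexp : hz (p := p) abs_na abs_cp mu pi (p%:R ^+ n * z) = Hexp (z *: (aa + tt)).
  apply: hval_inj; rewrite hzE //.
  rewrite (@Hexp_powser _ _ _ _ p_prime abs_na abs_cp abs_p r r_gt0 r_le1 r_pow _
    (fun j => p%:R ^+ n * z * lpi (p := p) mu pi j)) ?lpi_at0 ?mulr0 //.
    by apply: dZ; apply: hbdD.
  apply/funext => j; rewrite hvalZ dec; case: j => j /=; last by rewrite mulr0.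
  by ring.
have sz : supp_le (-1) (z *: tt) by move=> j hj; rewrite hvalZ st ?mulr0.
(* With only negative exponents in x, exp(x) is 1 plus negative powers of T. *)
have gt (x : H) : exp_domain (p := p) r x -> supp_le (-1) x -> gam 0 (Hexp x).
  move=> dx sx; split.
  - exists (Hexp (- x)).
    exact: (HexpNr p_prime abs_p r_gt0 r_le1 r_pow).
  - exact: (Hexp_bd p_prime abs_p r_gt0 r_le1 r_pow).
  - rewrite (Hexp_supp p_prime abs_p r_gt0 r_le1 r_pow) //.
    by rewrite eqxx vabs1.
  - move=> i i0; rewrite (Hexp_supp p_prime abs_p r_gt0 r_le1 r_pow) //.
    by rewrite eqz_nat (gtn_eqF i0) vabs0 // exprn_ge0.
have split_exp : Hexp (z *: (aa + tt)) = Hexp (z *: aa) * Hexp (z *: tt).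
  by rewrite scalerDr (HexpD p_prime abs_p r_gt0 r_le1 r_pow) //; apply: dZ.
have Aexp (x : H) : exp_domain (p := p) r x -> approx_in A x -> approx_in A (Hexp x).
  move=> dx Ax.
  apply: (approx_in_hcvg (HexpP p_prime abs_p r_gt0 r_le1 r_pow dx)) => M.
  exact: approx_in_exp_psum.
exists (Hexp (z *: aa)), (Hexp (z *: tt)); split.
- split; first by apply: Aexp; [apply: dZ|apply: approx_inZ].
  exists (Hexp (- (z *: aa))); last first.
    by apply: (HexpNr p_prime abs_p r_gt0 r_le1 r_pow); apply: dZ.
  apply: Aexp; first by apply: exp_domainN; apply: dZ.
  by rewrite -scaleNr; apply: approx_inZ.
(* No bound of the form rho^i is known for the coefficients of [aa], so membership in Gamma is
   transferred from h_(p^n z) and exp(-z tt). *)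
- have -> : Hexp (z *: aa) =
      hz (p := p) abs_na abs_cp mu pi (p%:R ^+ n * z) * Hexp (- (z *: tt)).
    rewrite hzexp split_exp -mulrA (HexpNr p_prime abs_p r_gt0 r_le1 r_pow) ?mulr1 //.
    exact: dZ.
  apply: gammaM; first exact: hz_gamma.
  apply: gamma_of_gam0; apply: gt; first by apply: exp_domainN; apply: dZ.
  by move=> j hj; rewrite hvalN sz ?oppr0.
- by apply: gt => //; apply: dZ.
- by rewrite hzexp.
Qed.

End Torsion.

(** * The action of delta on the Frobenius matrices *)

Section FrobeniusMatrix.
Context {R : realType} {K : fieldType} {abs : K -> R} {p : nat}.
Hypothesis abs_na : nonarch_absval abs.
Variables (A : set (biseries K)) (s : nat -> nat) (v : nat -> biseries K).
Hypothesis A_subalg : subalgebra abs A.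
Hypothesis s_incr : forall k m : nat, (k < m)%N -> (s k < s m)%N.
Hypothesis v_basis : standard_basis A s v.
Hypothesis A_integral : forall (k : nat) (j : int), integers abs (v k j).
Variables (g : nat) (mu : 'I_g -> nat).
Hypothesis mu_inj : injective mu.
Hypothesis mu_gap : forall i k, s k != mu i.
Variable z : K.
Hypothesis A_twist : forall a, A a -> A (twist z a).
Hypothesis z_p : z ^+ p = z.
Hypothesis z_mu_inj : forall i j, z ^+ mu i = z ^+ mu j -> i = j.

(** At the degrees s_k both the gap monomials and t vanish, so a is 0 there and then everywhere. *)
Lemma gap_independent (c : 'I_g -> K) (a t : biseries K) : A a ->
  (forall j, 0 <= j -> t j = 0) ->
  (forall m, \sum_(i < g) c i * monomial K (mu i)%:Z m = a m + t m) ->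
  forall i, c i = 0.
Proof.
move=> Aa t0 h i.
have a0 j : a j = 0.
  apply/eqP; rewrite -(vabs_eq0 abs_na) eq_le vabs_ge0 // andbT.
  apply: (subalg_coef_le abs_na s_incr v_basis A_integral Aa) => // k.
  have := h (s k)%:Z; rewrite t0 // addr0 => <-.
  rewrite big1 ?vabs0 // => l _.
  by rewrite /monomial eqz_nat (negPf (mu_gap l k)) mulr0.
have := h (mu i)%:Z; rewrite a0 t0 // addr0 (bigD1 i) //= big1 ?addr0.
  by rewrite /monomial eqxx mulr1.
move=> l li; rewrite /monomial eqz_nat (inj_eq mu_inj) eq_sym (negPf li).
by rewrite mulr0.
Qed.

Lemma frobenius_matrix_diag k (e : 'M[K]_g) : frobenius_matrix abs p A mu k e ->
  forall i j, j != i -> e j i = 0.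
Proof.
move=> [_ /[swap] i /(_ i) [a [t [[Aa _] [t0 _] E]]]] j ji.
have zpk m : z ^+ (m * p ^ k) = z ^+ m.
  rewrite mulnC exprM; congr (_ ^+ m).
  by elim: k {E} => [|k IH]; rewrite ?expn0 ?expr1 // expnS exprM z_p.
pose w := z ^+ mu i.
case: A_subalg => _ _ addA scaleA _.
(* The operator delta - w preserves A and the tail, kills T^(mu_i p^k) because z^(p^k) = z, and
   multiplies T^(mu_l) by z^(mu_l) - w, which is nonzero for l <> i. *)
pose a' : biseries K := twist z a + (fun m => - w * a m).
pose t' : biseries K := fun m => twist z t m - w * t m.
have Aa' : A a' by apply: addA; [apply: A_twist|apply: scaleA].
have h := @gap_independent (fun l => e l i * (w - z ^+ mu l)) a' t' Aa'.
suff : e j i * (w - z ^+ mu j) = 0.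
  move=> /eqP; rewrite mulf_eq0 => /orP [/eqP //|].
  by rewrite subr_eq0 => /eqP /z_mu_inj ij; rewrite ij eqxx in ji.
apply: h => [m m0|m]; first by rewrite /t' /twist t0 // mul0r mulr0 subrr.
have Em : a m + t m = monomial K (mu i * p ^ k)%N%:Z m -
    \sum_(l < g) e l i * monomial K (mu l)%:Z m by rewrite -[LHS]/((a + t) m) -E.
have -> : a' m + t' m = (a m + t m) * (z ^ m - w).
  rewrite -[a' m]/(twist z a m + - w * a m) /t' /twist; ring.
rewrite Em mulrBl.
have -> : monomial K (mu i * p ^ k)%N%:Z m * (z ^ m - w) = 0.
  rewrite /monomial; case: eqP => [->|_]; last by rewrite mul0r.
  by rewrite -exprnP zpk subrr mulr0.
rewrite sub0r mulr_suml -sumrN; apply: eq_bigr => l _.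
rewrite /monomial; case: eqP => [->|_]; last by rewrite !mulr0 mul0r oppr0.
by rewrite -exprnP; ring.
Qed.

Lemma frobenius_decomposition (abs_cp : complete_field abs) k (e : 'M[K]_g) i :
  frobenius_matrix abs p A mu k e ->
  exists a t : Hring abs_na abs_cp,
  [/\ H_mono abs_na abs_cp (mu i * p ^ k)%N%:Z =
        e i i *: H_mono abs_na abs_cp (mu i)%:Z + (a + t),
      A (hval a), hbd a 1, supp_le (-1) t & hbd t 1].
Proof.
move=> F; have diag := frobenius_matrix_diag F.
case: F => _ /(_ i) [a [t [[Aa ia] [t0 it] E]]].
have A_Hset := subalg_Hset abs_na s_incr v_basis A_integral.
have tH : Hset abs t.
  apply/HsetP => //; split; first by exists 1.
  by move=> eps e0; exists 0%N => j j0; rewrite t0 // vabs0 // ltW.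
exists (MkH abs_na abs_cp (A_Hset a Aa)), (MkH abs_na abs_cp tH).
split=> //.
apply: hring_ext => m; rewrite hvalD hvalZ [hval (_ + _) m]/=.
have -> : a m + t m = monomial K (mu i * p ^ k)%N%:Z m -
    e i i * monomial K (mu i)%:Z m.
  rewrite -[LHS]/((a + t) m) -E (bigD1 i) //= big1 ?addr0 // => l li.
  by rewrite diag ?mul0r.
by rewrite /= addrC subrK.
Qed.

End FrobeniusMatrix.

Theorem proposition3p13
  (R : realType) (p : nat) (p_prime : prime p)
  (Qp : fieldType) (absp : Qp -> R) (Qp_spec : is_Qp absp p)
  (K : fieldExtType Qp) (abs : K -> R) (abs_spec : nonarch_absval abs)
  (abs_ext : forall x : Qp, abs (x%:A) = absp x)
  (A : set (biseries K)) (A_subalg : subalgebra abs A)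
  (A_const : A `&` @powser_inv K = range (@const_series K))
  (g : nat)
  (A_dim : quotient_dim (@laurent K) (sum_set A (@powser_inv K)) g)
  (s : nat -> nat) (s_incr : forall k m : nat, (k < m)%N -> (s k < s m)%N)
  (s_range : range (fun k : nat => (s k)%:Z) = degrees A)
  (mu : 'I_g -> nat)
  (mu_incr : forall i j : 'I_g, (i < j)%N -> (mu i < mu j)%N)
  (mu_range : range (fun i : 'I_g => (mu i)%:Z) =
              [set m : int | 0 <= m] `\` degrees A)
  (v : nat -> biseries K) (v_basis : standard_basis A s v)
  (A_integral : forall (k : nat) (j : int), integers abs (v k j))
  (d : nat) (p_mod_d : p = 1 %[mod d])
  (mu_le_d : forall i : 'I_g, (mu i <= d)%N)
  (zeta : Qp) (zeta_int : integers absp zeta)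
  (zeta_prim : d.-primitive_root zeta)
  (delta_A : twist (zeta%:A : K) @` A = A)
  (e : nat -> 'M[K]_g)
  (e_spec : forall k : nat, frobenius_matrix abs p A mu k (e k))
  (n : nat) (n_gt0 : (0 < n)%N) (i : 'I_g) :
  (forall pi : K, T_set abs p e n i pi ->
     Gamma_eigen absp abs p n zeta A (mu i)
       (coset_class abs A (h_series p (mu i) pi))) /\
  set_inj (T_set abs p e n i)
    (fun pi : K => coset_class abs A (h_series p (mu i) pi)).
Proof.
have [absp_na absp_p absp_cp _] := Qp_spec.
have abs_cp := finite_ext_complete absp_na absp_cp abs_spec abs_ext.
have abs_nat m : abs m%:R = absp m%:R by rewrite -abs_ext scaler_nat.
have abs_p : abs p%:R = p%:R^-1 by rewrite abs_nat.
have mu_notin j : ~ degrees A (mu j)%:Z.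
  have : ([set m : int | 0 <= m] `\` degrees A) (mu j)%:Z.
    by rewrite -mu_range; exists j.
  by case.
have mu_gap j k : s k != mu j.
  apply/eqP => sm; apply: (mu_notin j); rewrite -s_range -sm.
  by exists k.
have mu_gt0 j : (0 < mu j)%N.
  rewrite lt0n; apply/eqP => m0; apply: (mu_notin j); rewrite m0.
  exists (monomial K 0); first by case: A_subalg.
  split; first by rewrite /monomial eqxx oner_eq0.
  by move=> m m_gt0; rewrite /monomial gt_eqF.
have mu_inj : injective mu.
  move=> j k jk; apply: val_inj; case: (ltngtP j k) => // /mu_incr;
    by rewrite jk ltnn.
have A_Hset := subalg_Hset abs_spec s_incr v_basis A_integral.
split; last first.
  move=> pi pi' /set_mem [h1 _ _] /set_mem [h2 _ _].
  exact: (hz_class_inj p_prime abs_spec abs_cp abs_p A_subalg s_incr v_basis A_integral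
    (mu_gt0 i) (mu_gap i) h1 h2).
pose z : K := zeta%:A.
have zeta_abs : absp zeta = 1.
  have d_gt0 := prim_order_gt0 zeta_prim.
  apply/eqP; rewrite -(@eqrXn2 _ d) ?vabs_ge0 // -vabsX //.
  by rewrite (prim_expr_order zeta_prim) vabs1 // expr1n.
have z_abs : abs z = 1 by rewrite abs_ext.
have z0 : z != 0 by rewrite -(vabs_eq0 abs_spec) z_abs oner_eq0.
have zX m : z ^+ m = (zeta ^+ m)%:A.
  by rewrite -[z]/(in_alg K zeta) -rmorphXn.
have z_p : z ^+ p = z.
  rewrite zX -(prim_expr_mod zeta_prim p) p_mod_d (prim_expr_mod zeta_prim).
  by rewrite expr1.
(* The gaps lie between 1 and d, hence are distinct modulo d; the value d takes the residue 0. *)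
have z_mu_inj j k : z ^+ mu j = z ^+ mu k -> j = k.
  rewrite !zX => /(fmorph_inj (in_alg K)) /eqP.
  rewrite (eq_prim_root_expr zeta_prim) => /eqP jk; apply: mu_inj.
  have := mu_le_d j; have := mu_le_d k; have := mu_gt0 j; have := mu_gt0 k.
  case: (ltngtP (mu j) d) => // jd; case: (ltngtP (mu k) d) => // kd _ _ _ _.
  - by move: jk; rewrite !modn_small.
  - by move: jk; rewrite kd modnn modn_small // => h; have := mu_gt0 j; rewrite h.
  - by move: jk; rewrite jd modnn modn_small // => h; have := mu_gt0 k; rewrite -h.
  - by rewrite jd kd.
have Az a : A a -> A (twist z a) by move=> Aa; rewrite -delta_A; exists a.
have Azi a : A a -> A (twist z^-1 a).
  rewrite -{1}delta_A => -[b Ab <-].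
  suff -> : twist z^-1 (twist (zeta%:A : K) b) = b by [].
  by apply/funext => j; rewrite /twist -/z -mulrA -expfzMl mulfV // exp1rz mulr1.
move=> pi [pi_lt1 l_root pi_le].
have p_gt1 := prime_gt1 p_prime.
have q_ge0 : 0 <= p%:R^-1 :> R by rewrite invr_ge0.
have p1_gt0 : (0 < p.-1)%N by rewrite -ltnS prednK // prime_gt0.
pose r : R := p%:R^-1 `^ p.-1%:R^-1.
have r_pow : r ^+ p.-1 = p%:R^-1 by rewrite powR_invn.
have r_gt0 : 0 < r by rewrite powR_gt0 // invr_gt0 ltr0n prime_gt0.
have r_le1 : r <= 1.
  rewrite -(expr_le1 p1_gt0) ?(ltW r_gt0) // r_pow.
  by rewrite invf_le1 ?ltr0n ?ler1n prime_gt0.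
(* Both sides are compared after raising to the power p - 1, as p^n - p^(n-1) = p^(n-1) (p - 1). *)
have pi_pow : abs pi ^+ (p ^ n.-1) <= r.
  rewrite -(@ler_pXn2r _ p.-1) ?nnegrE ?exprn_ge0 ?(vabs_ge0 abs_spec) ?(ltW r_gt0) //.
  have NE : (p ^ n - p ^ n.-1 = p ^ n.-1 * p.-1)%N.
    have pnE : (p ^ n = p ^ n.-1 * p)%N by rewrite mulnC -expnS prednK.
    by rewrite pnE -[p.-1]subn1 mulnBr muln1.
  have N_gt0 : (0 < p ^ n.-1 * p.-1)%N by rewrite muln_gt0 expn_gt0 prime_gt0.
  rewrite -exprM r_pow -[leRHS](powR_invn _ N_gt0) //.
  apply: lerXn2r; rewrite ?nnegrE ?(vabs_ge0 abs_spec) ?powR_ge0 //.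
  by move: pi_le; rewrite NE abs_p.
have dec k := frobenius_decomposition abs_spec A_subalg s_incr v_basis A_integral
  mu_inj mu_gap Az z_p z_mu_inj abs_cp i (e_spec k).
have [a ha] := choice dec; have [t hat] := choice ha.
have ker w : Zp_in (abs := abs) (p := p) w ->
    gker A (hz (p := p) abs_spec abs_cp (mu i) pi (p%:R ^+ n * w)).
  have hat1 k := let: And5 x _ _ _ _ := hat k in x.
  have hat2 k := let: And5 _ x _ _ _ := hat k in x.
  have hat3 k := let: And5 _ _ x _ _ := hat k in x.
  have hat4 k := let: And5 _ _ _ x _ := hat k in x.
  have hat5 k := let: And5 _ _ _ _ x := hat k in x.
  exact: (gker_hz p_prime abs_p A_subalg (mu_gt0 i) n_gt0 pi_lt1
    r_gt0 r_le1 r_pow pi_pow hat1 hat2 hat3 hat4 hat5 l_root).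
have Z1 : Zp_in (abs := abs) (p := p) 1 by apply: Zp1.
have ZA (x : Qp) : integers absp x -> Zp_in (abs := abs) (p := p) (x%:A : K).
  move=> /(Zp_of_integers p_prime Qp_spec) hx N; have [m hm] := hx N; exists m.
  by rewrite -scaler_nat -scalerBl abs_ext.
have hD := hzD p_prime abs_spec abs_cp abs_p (mu_gt0 i) pi_lt1.
have h0 := hz0 p_prime abs_spec abs_cp abs_p (mu_gt0 i) pi_lt1.
have hnat := hz_nat p_prime abs_spec abs_cp abs_p (mu_gt0 i) pi_lt1.
have hE := hzE p_prime abs_spec abs_cp abs_p (mu_gt0 i) pi_lt1.
have hG := hz_gamma p_prime abs_spec abs_cp abs_p (mu_gt0 i) pi_lt1 Z1.
have Zpn w : Zp_in (abs := abs) (p := p) w -> Zp_in (abs := abs) (p := p) (p%:R ^+ n * w).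
  by move=> hw; apply: ZpM => //; apply: ZpX => //; apply: Zp_nat.
have coset_ker x w : Zp_in (abs := abs) (p := p) w ->
    coset_class abs A (hval (x * hz (p := p) abs_spec abs_cp (mu i) pi (p%:R ^+ n * w))) =
    coset_class abs A (hval x).
  move=> hw; have hNw : Zp_in (abs := abs) (p := p) (- w) by apply: ZpN.
  apply: (coset_class_mul A_subalg A_Hset _ (ker _ hw) (ker _ hNw)).
  by rewrite -hD ?mulrN ?subrr ?h0 //; [apply: Zpn|rewrite -mulrN; apply: Zpn].
rewrite (h_seriesE p_prime (mu_gt0 i)) -(hE _ Z1).
set h := hz abs_spec abs_cp (mu i) pi 1 in hG *.
split.
  split; first by exists (hval h) => //; apply/gammaP.
  rewrite (coset_pow_class A_subalg A_Hset) -hnat -(coset_class1 abs_spec abs_cp A_Hset).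
  by rewrite -(coset_ker 1 1 Z1) mul1r mulr1 natrX.
have zmu_int : integers absp (zeta ^+ mu i).
  by rewrite /integers /= vabsX // zeta_abs expr1n.
set m := Zp_residue absp p n (zeta ^+ mu i).
have hm : absp (m%:R - zeta ^+ mu i) <= p%:R ^- n := Zp_residueP p_prime Qp_spec n zmu_int.
have pQ0 : p%:R != 0 :> Qp := p_neq0 p_prime absp_na absp_p.
(* This is integral because m is congruent to zeta^mu modulo p^n; by [coset_ker] the classes of
   h_(zeta^mu) = h_(m + p^n w) and of h^m then agree. *)
pose w : Qp := (zeta ^+ mu i - m%:R) / p%:R ^+ n.
have w_int : integers absp w.
  rewrite /integers /= vabsM // vabsV // vabsX // absp_p vabs_subC // exprVn invrK.
  by rewrite -ler_pdivlMr ?exprn_gt0 ?ltr0n ?prime_gt0 // div1r.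
have zE : z ^+ mu i = m%:R + p%:R ^+ n * (w%:A : K).
  have -> : p%:R ^+ n * (w%:A : K) = (p%:R ^+ n * w)%:A.
    by rewrite -[RHS]/(in_alg K (p%:R ^+ n * w)) rmorphM rmorphXn rmorph_nat.
  rewrite mulrC divfK ?expf_neq0 // scalerBl -zX scaler_nat.
  by rewrite addrC subrK.
rewrite /Zp_act (coset_pow_class A_subalg A_Hset).
rewrite (twist_coset A_Hset z_abs h Az Azi) -/m -hnat.
rewrite -[RHS](coset_ker _ _ (ZA _ w_int)) -hD; last exact/Zpn/ZA.
  congr (coset_class abs A _); rewrite -zE hE; last by rewrite zX; apply: ZA.
  apply/funext => -[j|j]; rewrite /= /twist hE //= ?mul0r //.
  rewrite -exprnP -exp_coef_dilate ?lpi_at0 ?mulr0 //.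
  congr exp_coef; apply/funext => l; rewrite mul1r.
  (* A nonzero coefficient sits in a degree mu p^k, where delta multiplies by z^(mu p^k) = z^mu. *)
  have [[k <-]|no] := pselect (exists k, (mu i * p ^ k)%N = l).
    rewrite mulrC; congr (_ * _); rewrite mulnC exprM; congr (_ ^+ _).
    by elim: k => [|k IH]; rewrite ?expn0 ?expr1 // expnS exprM z_p.
  rewrite lpi_eq0 ?mul0r ?mulr0 // => k; apply/eqP => kl.
  by apply: no; exists k.
exact: Zp_nat.
Qed.
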